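(* Let $R$ be a cubiculated region and $t$ a tiling of $R$. Let $\psi:S\to R^\ast$ be an embedded discrete surface with $\partial S=\emptyset$, and assume there exists a topological $3$-manifold $M_1\subset R^\ast$ whose boundary is $\psi[S]$ (with $S$ carrying the boundary orientation). Then $\phi(t;S)=0$.
   Context: A cubiculated region $R$ is a finite cubical complex embedded as a polyhedron in some $\mathbb{R}^N$ which is a connected oriented topological $3$-manifold with (possibly empty) boundary, such that every interior edge lies in exactly four cubes, cubes are colored black and white with face-adjacent cubes of opposite colors, and there are as many black as white cubes. The dual complex $R^\ast\subset R$ has vertices the centers of cubes of $R$, edges joining centers of face-adjacent cubes, squares dual to interior edges and cubes dual to interior vertices of $R$. A tiling is a perfect matching of the $1$-skeleton of $R^\ast$ (matched edges are dimers). An embedded discrete surface is a pair $(S,\psi)$ with $S$ an oriented topological surface and $\psi:S\to R^\ast$ injective continuous with image a union of vertices, edges and squares of $R^\ast$; the orientations of $S$ and $R$ determine a normal vector on each square. The flux of $t$ through $S$ is $\phi(t;S)=\sum_v \mathrm{color}(v)\,\epsilon(v)$, summed over vertices $v$ of $R^\ast$ in $\psi(S\setminus\partial S)$, where $\mathrm{color}(v)=+1$ if $v$ is the center of a black cube and $-1$ if white, and $\epsilon(v)=+1,0,-1$ according as the dimer of $t$ at $v$, drawn from $v$, points above $\psi[S]$ (the side of the normal), lies in $\psi[S]$, or points below $\psi[S]$.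
   Formalization: The 3-manifold M_1 is assumed compact; without this the claim fails (in a 3-torus a slice S is the boundary of S×[0,1) but can have nonzero flux). *)

(* Defs.v *)
From HB Require Import structures.
From mathcomp Require Import all_boot all_order all_algebra all_fingroup.
From mathcomp Require Import all_classical all_reals all_analysis.

Set Implicit Arguments.
Unset Strict Implicit.
Unset Printing Implicit Defensive.

Import Order.TTheory GRing.Theory Num.Theory.
Import numFieldNormedType.Exports.

Local Open Scope classical_set_scope.
Local Open Scope ring_scope.

(** * Topological manifolds with boundary, as subsets of a topological space *)

Definition homeomorphic (T U : topologicalType) (A : set T) (B : set U) :=
  exists (f : T -> U) (g : U -> T),
    [/\ f @` A `<=` B, g @` B `<=` A,
        (forall x, A x -> g (f x) = x) & (forall y, B y -> f (g y) = y)] /\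
    {within A, continuous f} /\ {within B, continuous g}.

Definition half_space (K : realType) (n : nat) : set 'rV[K]_n :=
  [set y | forall i : 'I_n, nat_of_ord i = 0%N -> 0 <= y ord0 i].

(* The Hausdorff and second countability axioms are automatic for subsets of
   'rV[K]_N; they are imposed separately on abstract surfaces. *)
Definition manifold (K : realType) (n : nat) (T : topologicalType)
    (M : set T) :=
  forall x, M x -> exists (U : set T) (V : set 'rV[K]_n),
    [/\ open U, U x, open V & homeomorphic (M `&` U) (V `&` @half_space K n)].

Definition manifold_interior (K : realType) (n : nat) (T : topologicalType)
    (M : set T) : set T :=
  [set x | M x /\ exists (U : set T) (V : set 'rV[K]_n),
    [/\ open U, U x, open V & homeomorphic (M `&` U) V]].

Definition manifold_boundary (K : realType) (n : nat) (T : topologicalType)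
    (M : set T) : set T :=
  M `\` manifold_interior K n M.

(** * The standard cube [0,1]^3 *)

Definition unit_cube (K : realType) : set 'rV[K]_3 :=
  [set x | forall i, 0 <= x ord0 i <= 1].

Definition open_unit_cube (K : realType) : set 'rV[K]_3 :=
  [set x | forall i, 0 < x ord0 i < 1].

(* [f i = Some b] means that the i-th coordinate is fixed, equal to b;
   [f i = None] means that it is free. *)
Definition face := {ffun 'I_3 -> option bool}.

Definition face_dim (f : face) : nat := #|[pred i | f i == None]|.

Definition face_set (K : realType) (f : face) : set 'rV[K]_3 :=
  [set x | unit_cube x /\ forall i b, f i = Some b -> x ord0 i = b%:R].

(* The part, inside one cube, of the dual cell of f: the center of the cube for
   the whole cube, a half-edge for a 2-face, a quarter of a square for an edge,
   an octant for a vertex. *)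
Definition dual_set (K : realType) (f : face) : set 'rV[K]_3 :=
  [set x : 'rV[K]_3 | forall i, match f i return Prop with
                                | None => x ord0 i = 2^-1
                                | Some true => 2^-1 <= x ord0 i <= 1
                                | Some false => 0 <= x ord0 i <= 2^-1
                                end].

(* (i, true) is the direction +e_i and (i, false) is -e_i. *)
Definition direction := ('I_3 * bool)%type.

Definition opposite (a : direction) : direction := (a.1, ~~ a.2).

Definition dvec (K : realType) (a : direction) : 'rV[K]_3 :=
  (-1) ^+ (~~ a.2) *: delta_mx ord0 a.1.

Definition facet (a : direction) : face :=
  [ffun i => if i == a.1 then Some a.2 else None].

Definition edge_face (a b : direction) : face :=
  [ffun i => if i == a.1 then Some a.2
             else if i == b.1 then Some b.2 else None].

(* Isometries of [0,1]^3: a permutation of the coordinates, followed by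
   reflections x_i |-> 1 - x_i in the coordinates i marked by h.2. *)
Definition cube_isometry := ('S_3 * {ffun 'I_3 -> bool})%type.

Definition cube_move (K : realType) (h : cube_isometry) (x : 'rV[K]_3) :
    'rV[K]_3 :=
  \row_i (if h.2 i then 1 - x ord0 (h.1 i) else x ord0 (h.1 i)).

Definition orientation_reversing (h : cube_isometry) : bool :=
  odd_perm h.1 (+) odd #|[pred i | h.2 i]|.

Definition conv_hull (K : realType) (n : nat) (s : seq 'rV[K]_n) :
    set 'rV[K]_n :=
  [set x | exists w : 'I_(size s) -> K,
    [/\ forall i, 0 <= w i, \sum_i w i = 1 & x = \sum_i w i *: s`_i]].

Definition piecewise_linear (K : realType) (N : nat)
    (p : 'rV[K]_3 -> 'rV[K]_N) :=
  {within @unit_cube K, continuous p} /\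
  exists P : seq (seq 'rV[K]_3),
    @unit_cube K `<=` [set x | exists2 s, s \in P & conv_hull s x] /\
    forall s, s \in P -> conv_hull s `<=` @unit_cube K /\
      exists (A : 'M[K]_(3, N)) (b : 'rV[K]_N),
        forall x, conv_hull s x -> p x = x *m A + b.

(** * Cubical complexes of pure dimension 3 in 'rV[K]_N *)

(* p and q identify exactly the face f of the source of p with the face h(f) of
   the source of q, along the isometry h. *)
Definition glued (K : realType) (N : nat) (p q : 'rV[K]_3 -> 'rV[K]_N)
    (f : face) (h : cube_isometry) :=
  forall x y, unit_cube x -> unit_cube y ->
    (p x = q y <-> face_set f x /\ y = cube_move h x).

(* Cubical complexes in the sense of Bridson-Haefliger, I.7.32: each cube is
   embedded, and two cubes that meet do so exactly in one common face, glued by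
   an isometry.  Only the 3-dimensional cubes are recorded, the other cells
   being their faces: a cubical complex which is a 3-manifold has no cell that
   is not a face of a 3-dimensional cube. *)
Record cubical_complex (K : realType) (N : nat) := CubicalComplex {
  cube : finType ;
  chart : cube -> 'rV[K]_3 -> 'rV[K]_N ;
  chart_pl : forall c, piecewise_linear (chart c) ;
  chart_inj : forall c x y, unit_cube x -> unit_cube y ->
    chart c x = chart c y -> x = y ;
  chart_glue : forall c d, c != d ->
    (exists x y, [/\ unit_cube x, unit_cube y & chart c x = chart d y]) ->
    exists f h, (face_dim f < 3)%N /\ glued (chart c) (chart d) f h }.

Arguments chart {K N c0}.

Section Complex.
Variables (K : realType) (N : nat) (R : cubical_complex K N).

Definition cube_set (c : cube R) : set 'rV[K]_N := chart c @` @unit_cube K.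

Definition carrier : set 'rV[K]_N := [set y | exists c, cube_set c y].

Definition cell (c : cube R) (f : face) : set 'rV[K]_N :=
  chart c @` @face_set K f.

Definition interior_cell (c : cube R) (f : face) :=
  ~ (cell c f `<=` manifold_boundary K 3 carrier).

Definition neighbor (c : cube R) (a : direction) (d : cube R) :=
  c != d /\ exists h, glued (chart c) (chart d) (facet a) h.

Definition center (c : cube R) : 'rV[K]_N := chart c (const_mx 2^-1).

(* The dual cell of a cell of R; it only depends on the set [cell c f]. *)
Definition dual_cell (c : cube R) (f : face) : set 'rV[K]_N :=
  [set y | exists d g, cell d g = cell c f /\ (chart d @` @dual_set K g) y].

(* The cells of R having a dual cell in the dual complex: all cubes, the 2-faces
   common to two cubes, the interior edges and the interior vertices. *)
Definition has_dual (c : cube R) (f : face) :=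
  match face_dim f with
  | 3 => True
  | 2 => exists a d, f = facet a /\ neighbor c a d
  | _ => interior_cell c f
  end.

Definition dual_complex : set 'rV[K]_N :=
  [set y | exists c f, has_dual c f /\ dual_cell c f y].

(* o c tells whether the chart of c is positively oriented.  If c and d are
   glued along a facet by h, then h folds c onto d, so that the unfolded change
   of charts (h followed by a reflection) preserves orientation if and only if
   h reverses it. *)
Definition coherent_orientation (o : cube R -> bool) :=
  forall c d a h, c != d -> glued (chart c) (chart d) (facet a) h ->
    (o c == o d) = orientation_reversing h.

End Complex.

(** * Cubiculated regions, tilings *)

Record cubiculated_region (K : realType) (N : nat) := CubiculatedRegion {
  complex :> cubical_complex K N ;
  region_manifold : manifold K 3 (carrier complex) ;
  region_connected : connected (carrier complex) ;
  orient : cube complex -> bool ;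
  orient_coherent : coherent_orientation orient ;
  interior_edge4 : forall (c : cube complex) (f : face),
    face_dim f = 1%N -> interior_cell c f ->
    #|[set d : cube complex | `[< cell c f `<=` cube_set d >]]%SET| = 4%N ;
  black : cube complex -> bool ;
  black_neighbor : forall c a d, neighbor c a d -> black d = ~~ black c ;
  black_balanced :
    #|[set c | black c]%SET| = #|[set c | ~~ black c]%SET| }.

Section Flux.
Variables (K : realType) (N : nat) (R : cubiculated_region K N).

(* The vertices of the dual complex are identified with the cubes of R. *)
Definition tiling (t : {set {set cube R}}) :=
  (forall e, e \in t ->
     exists v a w, neighbor v a w /\ e = [set v; w]%SET) /\
  (forall v, #|[set e in t | v \in e]%SET| = 1%N).

(* Three consecutive vertices u, v, w of a square of the dual complex contained
   in X, where a and b are the directions of vw and vu in the chart of v. *)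
Definition corner (X : set 'rV[K]_N) (u v w : cube R) (a b : direction) :=
  [/\ neighbor v a w, neighbor v b u, a.1 != b.1,
      interior_cell v (edge_face a b) & dual_cell v (edge_face a b) `<=` X].

(* The frame (n, a, b), read in the chart of v, is positive for R. *)
Definition positive_frame (v : cube R) (n a b : direction) : bool :=
  (0 < \det (\matrix_(k < 3) nth 0 [:: dvec K n; dvec K a; dvec K b] k))
    == orient v.

(* An orientation of a union X of cells of the dual complex, as a coherent
   choice of a direction of rotation on each of its squares: [o u v w] tells
   whether u, v, w are met in this order when the boundary of the square is
   travelled in the positive direction, i.e. whether (vw, vu) is a positive
   frame.  Squares sharing an edge induce opposite directions on it. *)
Definition surface_orientation (X : set 'rV[K]_N)
    (o : cube R -> cube R -> cube R -> bool) :=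
  [/\ forall u v w a b, corner X u v w a b -> o w v u = ~~ o u v w,
      forall u v w x a b a' b', corner X u v w a b -> corner X v w x a' b' ->
        dual_cell v (edge_face a b) = dual_cell w (edge_face a' b') ->
        o v w x = o u v w
    & forall u u' v w a b b', corner X u v w a b -> corner X u' v w a b' ->
        u != u' -> o u' v w = ~~ o u v w].

Record embedded_discrete_surface := EmbeddedDiscreteSurface {
  surface : topologicalType ;
  surface_hausdorff : hausdorff_space surface ;
  surface_second_countable : @second_countable surface ;
  surface_manifold : manifold K 2 [set: surface] ;
  psi : surface -> 'rV[K]_N ;
  psi_continuous : continuous psi ;
  psi_injective : injective psi ;
  psi_cells : exists F : set (cube R * face),
    (forall e, F e -> has_dual e.1 e.2 /\ (1 <= face_dim e.2)%N) /\
    range psi = [set y | exists2 e, F e & dual_cell e.1 e.2 y] ;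
  positive : cube R -> cube R -> cube R -> bool ;
  positive_orientation : surface_orientation (range psi) positive }.

Arguments psi : clear implicits.

Definition surface_boundary (S : embedded_discrete_surface) :
    set (surface S) :=
  manifold_boundary K 2 [set: surface S].

Arguments surface_boundary : clear implicits.

(* The normal to S at a positive corner u, v, w, directed along n. *)
Definition normal (S : embedded_discrete_surface) (u v w : cube R)
    (a b n : direction) :=
  [/\ corner (range (psi S)) u v w a b, positive S u v w,
      n.1 != a.1, n.1 != b.1 & positive_frame v n a b].

Definition near_center (v : cube R) (x : 'rV[K]_3) : 'rV[K]_N :=
  chart v (const_mx 2^-1 + 4^-1 *: x).

(* The point at one side, given by n, of the center of the quarter of square
   spanned at v by the directions a and b. *)
Definition beside (v : cube R) (a b n : direction) : 'rV[K]_N :=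
  near_center v (dvec K a + dvec K b + dvec K n).

Definition cube_minus (S : embedded_discrete_surface) (v : cube R) :
    set 'rV[K]_N :=
  (chart v @` @open_unit_cube K) `\` range (psi S).

(* Inside the open cube centered at v the surface is a cone with apex v, which
   has two sides if v is an interior point of S.  Both predicates are false if
   the edge at v of direction d lies in the surface. *)
Definition points_above (S : embedded_discrete_surface) (v : cube R)
    (d : direction) :=
  exists u w a b n, normal S u v w a b n /\
    connected_component (cube_minus S v) (beside v a b n)
      (near_center v (dvec K d)).

Definition points_below (S : embedded_discrete_surface) (v : cube R)
    (d : direction) :=
  exists u w a b n, normal S u v w a b n /\
    connected_component (cube_minus S v) (beside v a b (opposite n))
      (near_center v (dvec K d)).

Definition dimer_direction (t : {set {set cube R}}) (v : cube R)
    (d : direction) :=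
  exists2 w, neighbor v d w & [set v; w]%SET \in t.

Definition epsilon (t : {set {set cube R}}) (S : embedded_discrete_surface)
    (v : cube R) : int :=
  if `[< exists2 d, dimer_direction t v d & points_above S v d >] then 1
  else if `[< exists2 d, dimer_direction t v d & points_below S v d >] then -1
  else 0.

Definition color (v : cube R) : int := if black v then 1 else -1.

Definition flux (t : {set {set cube R}}) (S : embedded_discrete_surface) : int :=
  \sum_(v : cube R | `[< (psi S @` (~` surface_boundary S)) (center v) >])
    color v * epsilon t S v.

(* S carries the orientation of the boundary of M (outward normal first), where
   M is oriented as R. *)
Definition boundary_orientation (S : embedded_discrete_surface)
    (M : set 'rV[K]_N) :=
  forall u v w a b n, corner (range (psi S)) u v w a b ->
    n.1 != a.1 -> n.1 != b.1 -> ~ M (beside v a b n) ->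
    positive S u v w = positive_frame v n a b.

End Flux.

Arguments psi {K N R} e.
Arguments surface_boundary {K N R} S.

(* Main.v *)
(* Let B be the boundary of M1, and let g(v) be 2, 1 or 0 according as the vertex v
   is interior to M1, on B or outside M1.  The vertex v belongs to a dimer with a
   definite status: 2 if the half-edge of the dimer at v runs inside M1, 1 if it lies
   in B, 0 if it runs outside.  If v is on B, the status is 1 - epsilon(v); otherwise
   it is g(v).  The status is the same at both ends of a dimer, whose colors are
   opposite, so that the flux is the sum of color(v) g(v).

   This sum does not involve the tiling any more.  As M1 is a 3-manifold, g(v) is the
   Euler characteristic of the link of v in M1 (a sphere, a disk or nothing), that is
   the alternating number of edges, squares and cubes of M1 at v.  Every such cell is
   balanced: crossing a facet of a cube of R is a color-reversing involution of the
   flags of M1.  Hence the sum is 0.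

   That the link is a disk when v is on B follows from a check on the 256 sets of
   octants at v and from three facts: a point of B is adherent to both M1 and its
   complement, the interior of M1 is locally connected at B, and B is not locally
   disconnected by a point.  These facts, like the fact that M1 is a union of dual
   cells which do not stop at the facets, rest on invariance of domain in dimension 3,
   deduced from the Poincare-Miranda theorem, which itself comes from Stokes' formula
   for a cup product of cochains on a cubical grid. *)

Require Import Defs.
From mathcomp Require Import all_boot all_order all_algebra all_fingroup.
From mathcomp Require Import all_classical all_reals all_analysis.
From mathcomp Require Import ring lra zify.

Set Implicit Arguments.
Unset Strict Implicit.
Unset Printing Implicit Defensive.

Import Order.TTheory GRing.Theory Num.Theory.
Import numFieldNormedType.Exports.

Local Open Scope classical_set_scope.
Local Open Scope ring_scope.

(** * Invariance of domain in dimension 3 *)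

(** [M1] is only a topological manifold, without any cell structure, while the flux is
    combinatorial: the obstacle is to extract combinatorics from charts. Comparing each coordinate
    with 1/2 cuts an open cube of [R] into strata. There the surface is a union of strata of
    dimension at most 2, so [M1] is encoded by its set of occupied octants. Inside a cube all the
    topology is funnelled into [local_region]; crossing a facet uses invariance of domain once more,
    and compares points of the common facet instead of composing gluing isometries.

    The Euler characteristic helps because it is a sum over cells: a link cell of dimension 2 - k
    comes from a face of dimension k, which lies in 3 - k facets of its cube; crossing these pairs
    the flags, and the factor 3 - k is not zero. Its value alone does not suffice at a vertex of the
    surface: the occupied octants and the empty ones must both be connected, so that the sides
    tested by [points_below] and [points_above] are the inside and the outside of [M1]. *)

Section DiscreteStokes.
Variable p : nat.
Implicit Types A B C : nat -> nat -> nat -> int.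

(* The cup product dA dB dC on the unit cube at (x, y, z): one signed term for
   each monotone path from (x, y, z) to (x+1, y+1, z+1). *)
Definition cup3 A B C x y z : int :=
    (A x.+1 y z - A x y z) * (B x.+1 y.+1 z - B x.+1 y z)
      * (C x.+1 y.+1 z.+1 - C x.+1 y.+1 z)
  - (A x.+1 y z - A x y z) * (B x.+1 y z.+1 - B x.+1 y z)
      * (C x.+1 y.+1 z.+1 - C x.+1 y z.+1)
  - (A x y.+1 z - A x y z) * (B x.+1 y.+1 z - B x y.+1 z)
      * (C x.+1 y.+1 z.+1 - C x.+1 y.+1 z)
  + (A x y.+1 z - A x y z) * (B x y.+1 z.+1 - B x y.+1 z)
      * (C x.+1 y.+1 z.+1 - C x y.+1 z.+1)
  + (A x y z.+1 - A x y z) * (B x.+1 y z.+1 - B x y z.+1)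
      * (C x.+1 y.+1 z.+1 - C x.+1 y z.+1)
  - (A x y z.+1 - A x y z) * (B x y.+1 z.+1 - B x y z.+1)
      * (C x.+1 y.+1 z.+1 - C x y.+1 z.+1).

Definition cup2 (B C : nat -> nat -> int) y z : int :=
    (B y.+1 z - B y z) * (C y.+1 z.+1 - C y.+1 z)
  - (B y z.+1 - B y z) * (C y.+1 z.+1 - C y z.+1).

(** dA dB dC is the coboundary of A dB dC: the differences are taken between opposite facets of the
    unit cube, with the signs of the cubical boundary. *)
Lemma cup3_exact A B C x y z :
  cup3 A B C x y z =
      (A x.+1 y z * cup2 (B x.+1) (C x.+1) y z - A x y z * cup2 (B x) (C x) y z)
    - (A x y.+1 z * cup2 (fun i k => B i y.+1 k) (fun i k => C i y.+1 k) x z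
       - A x y z * cup2 (fun i k => B i y k) (fun i k => C i y k) x z)
    + (A x y z.+1 * cup2 (fun i j => B i j z.+1) (fun i j => C i j z.+1) x y
       - A x y z * cup2 (fun i j => B i j z) (fun i j => C i j z) x y).
Proof. rewrite /cup3 /cup2; ring. Qed.

(** Again dB dC = d(B dC). On the sides z = 0 and z = p the function [C] is constant, so dC
    vanishes; [B] is 0 on y = 0, and on y = p the sum of dC telescopes to 1. *)
Lemma sum_cup2 (B C : nat -> nat -> int) :
  (forall z, (z <= p)%N -> B 0%N z = 0) -> (forall z, (z <= p)%N -> B p z = 1) ->
  (forall y, (y <= p)%N -> C y 0%N = 0) -> (forall y, (y <= p)%N -> C y p = 1) ->
  \sum_(0 <= y < p) \sum_(0 <= z < p) cup2 B C y z = 1.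
Proof.
move=> B0 B1 C0 C1.
transitivity (\sum_(0 <= y < p) \sum_(0 <= z < p)
    (B y.+1 z * (C y.+1 z.+1 - C y.+1 z) - B y z * (C y z.+1 - C y z))
  - \sum_(0 <= y < p) \sum_(0 <= z < p)
    (B y z.+1 * (C y.+1 z.+1 - C y z.+1) - B y z * (C y.+1 z - C y z))).
  rewrite -sumrB; apply: eq_bigr => y _; rewrite -sumrB; apply: eq_bigr => z _.
  rewrite /cup2; ring.
rewrite exchange_big /=.
under eq_bigr do rewrite (telescope_sumr (fun y => B y _ * (C y _ - C y _)) (leq0n p)).
rewrite [X in _ - X]big1_seq ?subr0 => [|y /andP[_]]; last first.
  rewrite mem_index_iota /= => yp.
  rewrite (telescope_sumr (fun z => B y z * (C y.+1 z - C y z)) (leq0n p)).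
  by rewrite !C0 ?C1 ?(ltnW yp) // subrr !mulr0 subrr.
rewrite big_nat.
rewrite (eq_bigr (fun z => C p z.+1 - C p z)) => [|z /andP[_ zp]]; last first.
  by rewrite B0 ?B1 ?(ltnW zp) // mul0r mul1r subr0.
by rewrite -big_nat (telescope_sumr (C p) (leq0n p)) C0 ?C1 // subr0.
Qed.

(** By exactness only the boundary of the grid contributes: dC vanishes on the z-facets and dB on
    the y-facets, [A] kills x = 0, and x = p leaves the two-dimensional sum. *)
Lemma sum_cup3 A B C :
  (forall y z, (y <= p)%N -> (z <= p)%N -> A 0%N y z = 0) ->
  (forall y z, (y <= p)%N -> (z <= p)%N -> A p y z = 1) ->
  (forall x z, (x <= p)%N -> (z <= p)%N -> B x 0%N z = 0) ->
  (forall x z, (x <= p)%N -> (z <= p)%N -> B x p z = 1) ->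
  (forall x y, (x <= p)%N -> (y <= p)%N -> C x y 0%N = 0) ->
  (forall x y, (x <= p)%N -> (y <= p)%N -> C x y p = 1) ->
  \sum_(0 <= x < p) \sum_(0 <= y < p) \sum_(0 <= z < p) cup3 A B C x y z = 1.
Proof.
move=> A0 A1 B0 B1 C0 C1.
pose X x y z := A x y z * cup2 (B x) (C x) y z.
pose Y x y z := A x y z * cup2 (fun i k => B i y k) (fun i k => C i y k) x z.
pose Z x y z := A x y z * cup2 (fun i j => B i j z) (fun i j => C i j z) x y.
transitivity (\sum_(0 <= x < p) \sum_(0 <= y < p) \sum_(0 <= z < p)
    (X x.+1 y z - X x y z)
  - \sum_(0 <= x < p) \sum_(0 <= y < p) \sum_(0 <= z < p) (Y x y.+1 z - Y x y z)
  + \sum_(0 <= x < p) \sum_(0 <= y < p) \sum_(0 <= z < p) (Z x y z.+1 - Z x y z)).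
  rewrite -sumrB -big_split; apply: eq_bigr => x _ /=.
  rewrite -sumrB -big_split; apply: eq_bigr => y _ /=.
  rewrite -sumrB -big_split; apply: eq_bigr => z _ /=; exact: cup3_exact.
rewrite [X in _ + X]big1_seq ?addr0 => [|x /andP[_]]; last first.
  rewrite mem_index_iota => /andP[_ xp]; rewrite big1_seq// => y /andP[_].
  rewrite mem_index_iota => /andP[_ yp].
  rewrite (telescope_sumr (Z x y) (leq0n p)) /Z /cup2.
  rewrite !C0 ?C1 //; try lia; ring.
rewrite [X in _ - X]big1_seq ?subr0 => [|x /andP[_]]; last first.
  rewrite mem_index_iota => /andP[_ xp]; rewrite exchange_big /=.
  rewrite big1_seq// => z /andP[_].
  rewrite mem_index_iota => /andP[_ zp].
  rewrite (telescope_sumr (Y x ^~ z) (leq0n p)) /Y /cup2.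
  rewrite !B0 ?B1 //; try lia; ring.
rewrite exchange_big /= -[RHS](@sum_cup2 (B p) (C p)); first last.
- by move=> *; apply: C1.
- by move=> *; apply: C0.
- by move=> *; apply: B1.
- by move=> *; apply: B0.
apply: congr_big_nat => // y /andP[_ yp].
rewrite exchange_big /=; apply: congr_big_nat => // z /andP[_ zp].
rewrite (telescope_sumr (fun x => X x y z) (leq0n p)) /X.
by rewrite A0 ?A1 ?(ltnW yp) ?(ltnW zp) // mul0r mul1r subr0.
Qed.

Definition mixed (l : nat -> nat -> nat -> bool) x y z :=
  forall c : bool, exists i j k : bool, l (x + i)%N (y + j)%N (z + k)%N = c.

Lemma mixedPn l x y z : ~ mixed l x y z -> exists c : bool,
  forall i j k : bool, l (x + i)%N (y + j)%N (z + k)%N = c.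
Proof.
move=> nm; have [c nc] : exists c : bool, ~ exists i j k : bool,
   l (x + i)%N (y + j)%N (z + k)%N = c by apply/existsNP => H; exact: nm.
exists (~~ c) => i j k; apply/eqP; case: eqP => // E; exfalso; apply: nc.
by exists i, j, k; move: E; case: (l _ _ _); case: c.
Qed.

(** A cubical analogue of Sperner's lemma: where one labelling is constant on a unit cube, a factor
    of dA dB dC vanishes, so without a common mixed cube the total would be 0 instead of 1. *)
Lemma grid_mixed (a b c : nat -> nat -> nat -> bool) :
  (forall y z, (y <= p)%N -> (z <= p)%N -> ~~ a 0%N y z /\ a p y z) ->
  (forall x z, (x <= p)%N -> (z <= p)%N -> ~~ b x 0%N z /\ b x p z) ->
  (forall x y, (x <= p)%N -> (y <= p)%N -> ~~ c x y 0%N /\ c x y p) ->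
  exists x y z, [/\ (x < p)%N, (y < p)%N & (z < p)%N] /\
    [/\ mixed a x y z, mixed b x y z & mixed c x y z].
Proof.
move=> Ha Hb Hc; apply: contrapT => H.
pose I (l : nat -> nat -> nat -> bool) x y z : int := (l x y z)%:R.
have Z (l : nat -> nat -> nat -> bool) x y z : ~~ l x y z -> I l x y z = 0.
  by rewrite /I => /negbTE ->.
have O (l : nat -> nat -> nat -> bool) x y z : l x y z -> I l x y z = 1.
  by rewrite /I => ->.
have cst l x y z : ~ mixed l x y z -> forall i j k i' j' k' : bool,
  I l (x + i)%N (y + j)%N (z + k)%N = I l (x + i')%N (y + j')%N (z + k')%N.
  by move=> /mixedPn [u Hu] *; rewrite /I !Hu.
suff /eqP : (0 : int) = 1 by [].
rewrite -(@sum_cup3 (I a) (I b) (I c)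
  (fun y z hy hz => Z _ _ _ _ (Ha y z hy hz).1)
  (fun y z hy hz => O _ _ _ _ (Ha y z hy hz).2)
  (fun y z hy hz => Z _ _ _ _ (Hb y z hy hz).1)
  (fun y z hy hz => O _ _ _ _ (Hb y z hy hz).2)
  (fun y z hy hz => Z _ _ _ _ (Hc y z hy hz).1)
  (fun y z hy hz => O _ _ _ _ (Hc y z hy hz).2)).
symmetry; rewrite big1_seq// => x /andP[_].
rewrite mem_index_iota => /andP[_ xp]; rewrite big1_seq// => y /andP[_].
rewrite mem_index_iota => /andP[_ yp]; rewrite big1_seq// => z /andP[_].
rewrite mem_index_iota => /andP[_ zp].
have {H} : ~ mixed a x y z \/ ~ mixed b x y z \/ ~ mixed c x y z.
  apply: contrapT => H'; apply: H; exists x, y, z; split=> //.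
  by split; apply: contrapT => ?; apply: H'; tauto.
have nn (l : nat -> nat -> nat -> bool) : ~ mixed l x y z ->
  [/\ [/\ I l x.+1 y z = I l x y z, I l x y.+1 z = I l x y z & I l x y z.+1 = I l x y z],
   [/\ I l x.+1 y.+1 z = I l x y z, I l x y.+1 z.+1 = I l x y z & I l x.+1 y z.+1 = I l x y z]
   & I l x.+1 y.+1 z.+1 = I l x y z].
  move=> /cst E.
  by split; [split|split|]; [
    move: (E true false false false false false)|
    move: (E false true false false false false)|
    move: (E false false true false false false)|
    move: (E true true false false false false)|
    move: (E false true true false false false)|
    move: (E true false true false false false)|
    move: (E true true true false false false)]; rewrite ?addn0 ?addn1.
rewrite /cup3.
by move=> [/nn|[/nn|/nn]] [[E1 E2 E3] [E4 E5 E6] E7];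
  rewrite ?E7 ?E4 ?E5 ?E6 ?E1 ?E2 ?E3; ring.
Qed.

End DiscreteStokes.

Lemma nbhs_norm_ltP (K : realType) (V : normedModType K) (x : V) (P : set V) :
  nbhs x P <-> exists2 d : K, 0 < d & forall y, `|x - y| < d -> P y.
Proof.
split => [/nbhs_normP[d d0 H]|[d d0 H]].
  by exists d => // y; apply: H.
by apply/nbhs_normP; exists d => // y; apply: H.
Qed.

Lemma within_contP (K : realType) (V W : normedModType K) (A : set V)
    (f : V -> W) :
  {within A, continuous f} <-> forall x, A x -> forall e : K, 0 < e ->
  exists2 d : K, 0 < d & forall y, A y -> `|x - y| < d -> `|f x - f y| < e.
Proof.
split => [/subspace_continuousP H x Ax e e0|H].
  have /cvgrPdist_lt/(_ e e0) := H x Ax.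
  rewrite near_withinE => /nbhs_norm_ltP[d d0 Hd].
  by exists d => // y Ay /Hd; apply.
apply/subspace_continuousP => x Ax; apply/cvgrPdist_lt => e e0.
rewrite near_withinE; apply/nbhs_norm_ltP.
by have [d d0 Hd] := H x Ax e e0; exists d => // y ? ?; apply: Hd.
Qed.

Lemma row_norm_le (K : realType) n (x : 'rV[K]_n) (r : K) : 0 <= r ->
  (`|x| <= r) <-> forall i, `|x ord0 i| <= r.
Proof.
move=> r0; rewrite /Num.norm/= mx_normrE; split => [H i|H].
  apply: le_trans H.
  exact: (@le_bigmax _ _ _ 0 (fun ij : 'I_1 * 'I_n => `|x ij.1 ij.2|) (ord0, i)).
by apply/bigmax_leP; split => // -[i j] _; rewrite ord1; exact: H.
Qed.

Lemma row_coord_le (K : realType) n (x : 'rV[K]_n) i : `|x ord0 i| <= `|x|.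
Proof. by move: i; apply/row_norm_le. Qed.

Lemma row_hausdorff (K : realType) n : hausdorff_space 'rV[K]_n.
Proof. exact: norm_hausdorff. Qed.

(** * Zeros of maps of a cube with prescribed signs on the facets *)

Section PoincareMiranda.
Variable K : realType.

Definition row3 (a b c : K) : 'rV[K]_3 := \row_i [:: a; b; c]`_i.

Lemma forall_ord3 (P : 'I_3 -> Prop) :
  P ord0 -> P (inord 1) -> P (inord 2) -> forall i, P i.
Proof.
move=> P0 P1 P2 [[|[|[|//]]] Hi].
- by rewrite (_ : Ordinal Hi = ord0) //; apply: val_inj.
- by rewrite (_ : Ordinal Hi = inord 1) //; apply: val_inj; rewrite /= inordK.
- by rewrite (_ : Ordinal Hi = inord 2) //; apply: val_inj; rewrite /= inordK.
Qed.

Lemma closed_cube_compact : compact [set x : 'rV[K]_3 | `|x| <= 1].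
Proof.
have -> : [set x : 'rV[K]_3 | `|x| <= 1] =
    [set v : 'rV[K]_3 | forall i, `[-1, 1]%classic (v ord0 i)]; last first.
  by apply: (@rV_compact K 3 (fun=> `[-1, 1]%classic)) => i; exact: segment_compact.
apply/seteqP; split=> x /=.
  by move=> /row_norm_le -/(_ ler01) H i; rewrite in_itv /= -ler_norml.
by move=> H; apply/row_norm_le => // i; rewrite ler_norml; have := H i; rewrite in_itv.
Qed.

(** The signs of the coordinates of [f] label finer and finer grids. A mixed cube has vertices of
    both signs for every coordinate, and a cluster point of such cubes is a zero. *)
Theorem poincare_miranda (f : 'rV[K]_3 -> 'rV[K]_3) :
  {within [set x : 'rV[K]_3 | `|x| <= 1], continuous f} ->
  (forall (x : 'rV[K]_3) i, `|x| <= 1 -> x ord0 i = 1 -> 0 <= f x ord0 i) ->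
  (forall (x : 'rV[K]_3) i, `|x| <= 1 -> x ord0 i = -1 -> f x ord0 i <= 0) ->
  exists2 x : 'rV[K]_3, `|x| <= 1 & f x = 0.
Proof.
move=> cf fp fm.
pose co n (i : nat) : K := -1 + 2 * (i%:R / n.+1%:R).
pose pt n (x y z : nat) := row3 (co n x) (co n y) (co n z).
have n0 n : 0 < n.+1%:R :> K by rewrite ltr0n.
have co1 n i : (i <= n.+1)%N -> `|co n i| <= 1.
  move=> ip; rewrite ler_norml /co.
  have : 0 <= i%:R / n.+1%:R :> K by rewrite divr_ge0.
  have : i%:R / n.+1%:R <= 1 :> K by rewrite ler_pdivrMr ?n0// mul1r ler_nat.
  by move: (_ / _) => t ? ?; apply/andP; split; lra.
have co_p n : co n n.+1 = 1 by rewrite /co divff ?gt_eqF//; lra.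
have co_0 n : co n 0%N = -1 by rewrite /co mul0r mulr0 addr0.
have coS n i (b : bool) : `|co n i - co n (i + b)%N| <= 2 * n.+1%:R^-1.
  rewrite /co natrD (_ : _ - _ = - (2 * n.+1%:R^-1 * b%:R)); last first.
    by move: n.+1%:R^-1 => t; ring.
  rewrite normrN ger0_norm ?mulr_ge0 ?invr_ge0//.
  by case: b; rewrite ?mulr1 ?mulr0 ?mulr_ge0 ?invr_ge0.
have pt1 n x y z : (x <= n.+1)%N -> (y <= n.+1)%N -> (z <= n.+1)%N ->
    `|pt n x y z| <= 1.
  move=> hx hy hz; apply/row_norm_le => // i; rewrite /pt mxE.
  by case: i => [[|[|[|]]]] //= _; exact: co1.
have ptS n x y z (i j k : bool) :
    `|pt n x y z - pt n (x + i) (y + j) (z + k)| <= 2 * n.+1%:R^-1.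
  apply/row_norm_le => [|l]; first by rewrite mulr_ge0 ?invr_ge0.
  by rewrite /pt !mxE; case: l => [[|[|[|]]]] //= _; exact: coS.
(* The label is the sign of coordinate i of [f], except that it is forced where coordinate i of the
   point is 1 or -1: [f] may vanish there, and its sign alone would not give the boundary values
   required by [grid_mixed]. *)
pose lab (i : 'I_3) n x y z : bool :=
  let c := nth 0%N [:: x; y; z] i in
  (c == n.+1) || (c != 0%N) && (0 <= f (pt n x y z) ord0 i).
have pti (i : 'I_3) n x y z : pt n x y z ord0 i = co n (nth 0%N [:: x; y; z] i).
  by rewrite /pt mxE; case: i => [[|[|[|]]]] //=.
have labT i n x y z : (x <= n.+1)%N -> (y <= n.+1)%N -> (z <= n.+1)%N ->
    lab i n x y z -> 0 <= f (pt n x y z) ord0 i.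
  move=> hx hy hz /orP[/eqP E|/andP[]//].
  by apply: fp; [exact: pt1|rewrite pti E co_p].
have labF i n x y z : (x <= n.+1)%N -> (y <= n.+1)%N -> (z <= n.+1)%N ->
    lab i n x y z = false -> f (pt n x y z) ord0 i <= 0.
  move=> hx hy hz; rewrite /lab; case: eqP => //= _; case: eqP => /= [E _|_].
    by apply: fm; [exact: pt1|rewrite pti E co_0].
  by move/negbT; rewrite -ltNge; exact: ltW.
have key n : exists q : 'rV[K]_3, `|q| <= 1 /\ forall i (b : bool), exists u : 'rV[K]_3,
    [/\ `|u| <= 1, `|q - u| <= 2 * n.+1%:R^-1 &
     if b then 0 <= f u ord0 i else f u ord0 i <= 0].
  have [||| x [y [z [[xp yp zp] [m0 m1 m2]]]]] := @grid_mixed n.+1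
    (lab ord0 n) (lab (inord 1) n) (lab (inord 2) n); rewrite /lab ?inordK //=.
  - by move=> y z _ _; rewrite eqxx.
  - by move=> y z _ _; rewrite eqxx.
  - by move=> y z _ _; rewrite eqxx.
  exists (pt n x y z); split; first by apply: pt1; exact: ltnW.
  have E (l : bool) a : (a < n.+1)%N -> (a + l <= n.+1)%N by case: l => ?; lia.
  have G i : mixed (lab i n) x y z -> forall b : bool, exists u : 'rV[K]_3,
    [/\ `|u| <= 1, `|pt n x y z - u| <= 2 * n.+1%:R^-1 &
     if b then 0 <= f u ord0 i else f u ord0 i <= 0].
    move=> m b; have [l1 [l2 [l3 Hl]]] := m b.
    exists (pt n (x + l1) (y + l2) (z + l3))%N; split.
    - by apply: pt1; exact: E.
    - exact: ptS.
    by case: b Hl => Hl; [apply: labT|apply: labF] => //; exact: E.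
  by apply: forall_ord3; apply: G.
have /choice[q Hq] := key.
have [x [/= x1 clx]] : [set x : 'rV[K]_3 | `|x| <= 1] `&` cluster (q @ \oo) !=set0.
  apply: closed_cube_compact.
  have : \forall n \near \oo, `|q n| <= 1 by apply: nearW => n; case: (Hq n).
  by [].
exists x => //; apply/rowP => i; rewrite mxE; apply/eqP; apply/negP => /negP fi0.
have e0 : 0 < `|f x ord0 i| by rewrite normr_gt0.
have [d d0 Hd] := (within_contP _ _).1 cf x x1 _ e0.
have d40 : 0 < d / 4 by lra.
pose S := [set q n | n in [set n | n.+1%:R^-1 < d / 4]].
have [|| y [[n /= nd <-] /= xq]] := clx S [set y | `|x - y| < d / 2].
- have : \forall n \near \oo, S (q n); last by [].
  near=> n; exists n => //=.
  by near: n; exact: (near_infty_natSinv_lt (PosNum d40)).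
- by apply/nbhs_norm_ltP; exists (d / 2) => //; lra.
(* At [u] coordinate i of [f] vanishes or has the sign opposite to the one at [x], so it differs
   from it by at least its modulus at [x], against continuity. *)
have [_ /(_ i (f x ord0 i < 0))[u [u1 qu fu]]] := Hq n.
have : `|f x - f u| < `|f x ord0 i|.
  apply: Hd => //; apply: le_lt_trans (_ : `|x - q n| + `|q n - u| < d).
    by rewrite (le_trans _ (ler_normD _ _))// addrA subrK.
  by move: n.+1%:R^-1 nd qu => s nd qu; lra.
move=> /(le_lt_trans (row_coord_le _ i)); rewrite !mxE.
move: fu; case: ltrP fi0 => [fx _|].
  by rewrite (ltr0_norm fx) => ?; rewrite ler0_norm; lra.
rewrite le_eqVlt eq_sym => /orP[->//|fx _].
by rewrite (gtr0_norm fx) => ?; rewrite ger0_norm; lra.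
Unshelve. all: by end_near. Qed.

End PoincareMiranda.

(** * Openness of injective continuous maps, by approximate inverses *)

Section InvarianceOfDomain.
Variable K : realType.
Local Notation V := 'rV[K]_3.
Local Notation B := [set x : 'rV[K]_3 | `|x| <= 1].

(** On the compact set of pairs at distance at least [e], |f x - f y| attains a minimum, positive by
    injectivity; this is [m]. If there is no such pair, 1 will do. *)
Lemma compact_injective_modulus (W1 W2 : normedModType K) (A : set W1)
    (f : W1 -> W2) (e : K) : compact A -> {within A, continuous f} ->
  (forall x y, A x -> A y -> f x = f y -> x = y) -> 0 < e ->
  exists2 m : K, 0 < m & forall x y, A x -> A y -> `|f x - f y| < m -> `|x - y| < e.
Proof.
move=> cA cf injf e0.
pose D := (A `*` A) `&` [set p : W1 * W1 | e <= `|p.1 - p.2|].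
have cD : compact D.
  apply: compact_closedI; first exact: compact_setX.
  rewrite (_ : [set _ | _] = (fun p : W1 * W1 => `|p.1 - p.2|) @^-1` [set t | e <= t]) //.
  apply: preimage_closed; last exact: closed_ge.
  move=> p _; apply: cvg_norm; apply: cvgB; [exact: cvg_fst|exact: cvg_snd].
have [[p Dp]|D0] := pselect (D !=set0); last first.
  exists 1 => // x y Ax Ay _; rewrite ltNge; apply/negP => H.
  by apply: D0; exists (x, y).
have cF : {within D, continuous (fun p : W1 * W1 => `|f p.1 - f p.2|)}.
  apply/within_contP => -[x y] [[/= Ax Ay] _] r r0.
  have r2 : 0 < r / 2 by lra.
  have [d1 d10 H1] := (within_contP _ _).1 cf x Ax _ r2.
  have [d2 d20 H2] := (within_contP _ _).1 cf y Ay _ r2.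
  exists (Num.min d1 d2); first by rewrite lt_min d10.
  move=> [u v] [[/= Au Av] _]; rewrite prod_normE /= gt_max !lt_min.
  move=> /andP[/andP[/(H1 _ Au) ? _] /andP[_ /(H2 _ Av) ?]].
  apply: (@le_lt_trans _ _ (`|f x - f u| + `|f y - f v|)); last by lra.
  rewrite (le_trans (ler_dist_dist _ _))// (le_trans _ (ler_normB _ _))//.
  by rewrite !opprD !opprK addrACA.
have [|q /set_mem [[/= Ax Ay] exy] H] := compact_EVT_min _ cD cF; first by exists p.
exists `|f q.1 - f q.2|.
  rewrite normr_gt0 subr_eq0; apply/negP => /eqP /(injf _ _ Ax Ay) E.
  by move: exy => /=; rewrite E subrr normr0 leNgt e0.
move=> x y Ax' Ay'; apply: contraTT; rewrite -!leNgt => exy'.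
by apply: (H (x, y)); apply/mem_set.
Qed.

(* Coordinatewise, P is the infimum over x of x_i + L |y - f x|. *)
Lemma lipschitz_inverse (f : V -> V) (e : K) :
  {within B, continuous f} ->
  (forall x y : V, `|x| <= 1 -> `|y| <= 1 -> f x = f y -> x = y) -> 0 < e ->
  exists (L : K) (P : V -> V), [/\ 0 < L,
    forall y y' i, `|P y ord0 i - P y' ord0 i| <= L * `|y - y'| &
    forall (x : V) i, `|x| <= 1 -> `|P (f x) ord0 i - x ord0 i| <= e].
Proof.
move=> cf injf e0.
have [m m0 Hm] := compact_injective_modulus (@closed_cube_compact K) cf injf e0.
(* Coordinates in the cube differ by at most 2: a [u] with |f x - f u| >= m pays at least 2, hence
   cannot bring the infimum at [f x] below x_i. *)
pose L := 2 / m; have L0 : 0 < L by rewrite divr_gt0.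
pose E (i : 'I_3) (y : V) := [set x ord0 i + L * `|y - f x| | x in B].
have xi (x : V) i : `|x| <= 1 -> -1 <= x ord0 i <= 1.
  by move=> ?; rewrite -ler_norml (le_trans (row_coord_le _ _)).
have Elb i y : has_lbound (E i y).
  exists (-1) => _ [x /= x1 <-]; have := xi x i x1.
  have : 0 <= L * `|y - f x| by rewrite mulr_ge0// ltW.
  by move: (L * _) => ? ? /andP[? ?]; lra.
have E0 i y : E i y !=set0 by exists ((0 : V) ord0 i + L * `|y - f 0|), 0; rewrite //= normr0.
pose P y := \row_i inf (E i y) : V.
have PL y y' i : inf (E i y) <= inf (E i y') + L * `|y - y'|.
  rewrite -lerBlDr; apply: lb_le_inf => // _ [x /= x1 <-].
  have : inf (E i y) <= x ord0 i + L * `|y - f x|.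
    by apply: ge_inf => //; exists x.
  have : `|y - f x| <= `|y - y'| + `|y' - f x|.
    by rewrite (le_trans _ (ler_normD _ _))// addrA subrK.
  rewrite -(ler_pM2l L0) mulrDr; lra.
exists L, P; split => //.
  move=> y y' i; rewrite !mxE ler_norml.
  by have := PL y y' i; have := PL y' y i; rewrite (distrC y' y); lra.
move=> x i x1; rewrite mxE ler_norml; apply/andP; split; last first.
  rewrite lerBlDr (@le_trans _ _ (x ord0 i + L * `|f x - f x|))//.
    by apply: ge_inf => //; exists x.
  by rewrite subrr normr0 mulr0; lra.
rewrite lerBrDr; apply: lb_le_inf => // _ [u /= u1 <-].
have [lt|ge] := ltP `|f x - f u| m.
  have := Hm x u x1 u1 lt => /(le_lt_trans (row_coord_le _ i)).
  rewrite !mxE ltr_norml => /andP[_ ?].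
  have : 0 <= L * `|f x - f u| by rewrite mulr_ge0// ltW.
  by move: (L * _) => ? ?; lra.
have : 2 <= L * `|f x - f u| by rewrite /L mulrAC ler_pdivlMr// ler_pM2l.
have := xi x i x1; have := xi u i u1.
by move: (L * _) => ? /andP[? ?] /andP[? ?] ?; lra.
Qed.

(** The pigeonhole count for n = q m, with 3 * 2 the number of facets of a cube: since q m + 1 <= 2
    q m, there are at most 24 q^2 m^2 cells, which is less than m^3 by the choice of m. *)
Lemma cell_count q (m := (24 * q ^ 2).+1) : (0 < q)%N ->
  (3 * 2 * (q * m).+1 * (q * m).+1 < m * m * m)%N.
Proof.
move=> q1; have Em : (m = 24 * q ^ 2 + 1)%N by rewrite /m addn1.
move: m Em => m Em.
apply: (@leq_ltn_trans (6 * ((2 * q * m) * (2 * q * m)))).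
  have : ((q * m).+1 <= 2 * q * m)%N by nia.
  by move=> H; rewrite -(mulnA (3 * 2)); apply: leq_mul => //; exact: leq_mul.
have -> : (6 * (2 * q * m * (2 * q * m)) = 24 * q ^ 2 * (m * m))%N by ring.
have -> : (m * m * m = m * (m * m))%N by ring.
by rewrite ltn_pmul2r; nia.
Qed.

(* The sphere is covered by 6 (n+1)^2 cells of diameter 2 r / n, while the
   target cube contains m^3 points with pairwise distances at least d / m. *)
Lemma lipschitz_sphere_avoid (P : V -> V) (L r d : K) (c : V) :
  0 < L -> 0 < r -> 0 < d ->
  (forall y y' i, `|P y ord0 i - P y' ord0 i| <= L * `|y - y'|) ->
  exists2 z : V, `|z| <= d & forall y, `|y - c| = r -> P y <> z.
Proof.
move=> L0 r0 d0 HP; apply: contrapT => nH.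
have sur (z : V) : `|z| <= d -> exists2 y, `|y - c| = r & P y = z.
  move=> zd; apply: contrapT => H; apply: nH; exists z => // y yc Py.
  by apply: H; exists y.
(* Points of the sphere in the same cell are at distance at most 2 r / n with n = q m, so the
   coordinates of their images differ by at most 2 L r / (q m) < d / m, the mesh of the points
   [z]. *)
pose q := (Num.bound (2 * L * r / d)).+1.
have Hq : 2 * L * r / d < q%:R.
  rewrite (lt_trans (archi_boundP _))//; last by rewrite ltr_nat.
  by rewrite divr_ge0 ?mulr_ge0 ?ltW.
pose m := (24 * q ^ 2).+1; pose n := (q * m)%N.
have m0 : 0 < m%:R :> K by rewrite ltr0n.
have q0 : 0 < q%:R :> K by rewrite ltr0n.
have nE : n%:R = q%:R * m%:R :> K by rewrite natrM.
have n0 : 0 < n%:R :> K by rewrite nE mulr_gt0.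
pose z (a : 'I_m * 'I_m * 'I_m) : V :=
  row3 (a.1.1%:R * (d / m%:R)) (a.1.2%:R * (d / m%:R)) (a.2%:R * (d / m%:R)).
have dm0 : 0 < d / m%:R by rewrite divr_gt0.
have zd a : `|z a| <= d.
  apply/row_norm_le => [|i]; first exact: ltW.
  have K0 (k : 'I_m) : `|k%:R * (d / m%:R)| <= d.
    rewrite ger0_norm; last by rewrite mulr_ge0 ?(ltW dm0).
    rewrite mulrCA ger_pMr//.
    by rewrite ler_pdivrMr// mul1r ler_nat ltnW.
  by rewrite mxE; case: i => [[|[|[|]]]] //= _; exact: K0.
have /choice[y Hy] : forall a, exists y, `|y - c| = r /\ P y = z a.
  by move=> a; have [y] := sur _ (zd a); exists y.
pose w a (j : 'I_3) := (y a ord0 j - c ord0 j + r) / (2 * r) * n%:R.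
have wE a j : y a ord0 j = w a j / n%:R * (2 * r) + c ord0 j - r.
  by rewrite /w mulfK ?gt_eqF// mulfVK ?gt_eqF ?mulr_gt0//; lra.
have w01 a j : 0 <= w a j <= n%:R.
  have : `|(y a - c) ord0 j| <= r by rewrite -(Hy a).1 row_coord_le.
  rewrite !mxE ler_norml => /andP[? ?]; apply/andP; split.
    by rewrite /w mulr_ge0 ?(ltW n0)// divr_ge0//; lra.
  by rewrite /w ler_piMl ?(ltW n0)// ler_pdivrMr; lra.
have /choice[i Hi] : forall a, exists i : 'I_3, `|(y a - c) ord0 i| = r.
  move=> a; have := @mx_norm_neq0 _ _ _ (y a - c).
  rewrite -[mx_norm _]/(`|y a - c|) (Hy a).1 gt_eqF// => /(_ isT)[[i0 i] ->].
  by exists i; rewrite /= (ord1 i0).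
pose cell a (j : 'I_3) : 'I_n.+1 := inord (Num.truncn (w a j)).
have cellE a j : (cell a j : nat) = Num.truncn (w a j).
  rewrite inordK// ltnS; have /andP[w0 w1] := w01 a j.
  by rewrite -(ler_nat K) (le_trans _ w1)// truncn_le.
(* For the maximum norm the sphere is the surface of a cube: a facet is given by a coordinate of
   modulus [r] and its sign, the place on it by the cells of the two other coordinates. *)
pose code a := (i a, 0 <= (y a - c) ord0 (i a),
  cell a (lift (i a) ord0), cell a (lift (i a) ord_max)).
suff /leq_card : injective code.
  rewrite !card_prod !card_ord card_bool /n => H.
  have := cell_count (isT : (0 < q)%N); rewrite -/m ltnNge => /negP[].
  exact: H.
move=> a b [Ei Es E1 E2].
have wab j : `|w a j - w b j| < 1.
  have [->|ja] := eqVneq j (i a).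
    have := Hi a; have := Hi b; rewrite -Ei.
    move: Es; rewrite -Ei => Es; case: (lerP 0 ((y a - c) ord0 (i a))) Es => Ha Es.
      rewrite (ger0_norm Ha) ger0_norm -?Es// => Hb' Ha'.
      rewrite /w; move: Ha' Hb'; rewrite !mxE => -> ->; by rewrite subrr normr0.
    have Hb : (y b - c) ord0 (i a) < 0 by rewrite ltNge -Es.
    rewrite (ltr0_norm Ha) (ltr0_norm Hb) => Hb' Ha'.
    have -> : w a (i a) = w b (i a); last by rewrite subrr normr0.
    suff E : y a ord0 (i a) = y b ord0 (i a) by rewrite /w E.
    by move: Ha' Hb'; rewrite !mxE; lra.
  have Ej : Num.truncn (w a j) = Num.truncn (w b j).
    rewrite -!cellE; congr (nat_of_ord _).
    rewrite eq_sym in ja; have [k -> _] := unlift_some ja.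
    have [->|->] : k = ord0 \/ k = ord_max.
      by case: k => [[|[|]]] // Hk; [left|right]; apply: val_inj.
    - by rewrite E1 Ei.
    - by rewrite E2 Ei.
  have /andP[wa0 _] := w01 a j; have /andP[wb0 _] := w01 b j.
  have := truncn_itv wa0; have := truncn_itv wb0; rewrite Ej -natr1.
  by move=> /andP[? ?] /andP[? ?]; rewrite ltr_norml; lra.
have yab : `|y a - y b| <= 2 * r / n%:R.
  have rn0 : 0 <= 2 * r / n%:R by rewrite divr_ge0 ?mulr_ge0 ?ltW.
  apply/row_norm_le => // j.
  rewrite !mxE !wE (_ : _ - _ = (w a j - w b j) * (2 * r / n%:R)); last by ring.
  rewrite normrM [`|2 * _ / _|]ger0_norm//.
  by rewrite ler_piMl ?(ltW (wab j)).
have zab j : `|z a ord0 j - z b ord0 j| < d / m%:R.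
  rewrite -(Hy a).2 -(Hy b).2 (le_lt_trans (HP _ _ j))//.
  rewrite (@le_lt_trans _ _ (L * (2 * r / n%:R)))// ?ler_pM2l//.
  rewrite nE ltr_pdivlMr// invfM; move: Hq; rewrite ltr_pdivrMr//.
  rewrite (_ : L * _ * _ = 2 * L * r / q%:R * (m%:R / m%:R)); last by ring.
  by rewrite divff ?gt_eqF// mulr1 ltr_pdivrMr// [d * _]mulrC.
have ord_close (k l : 'I_m) : `|k%:R * (d / m%:R) - l%:R * (d / m%:R)| < d / m%:R -> k = l.
  rewrite -mulrBl normrM (gtr0_norm dm0) gtr_pMl// => H; apply: val_inj => /=.
  apply/eqP; rewrite eqn_leq -[(k <= l)%N]ltnS -[(l <= k)%N]ltnS.
  rewrite -!(ltr_nat K) -!natr1.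
  by move: H; rewrite ltr_norml => /andP[? ?]; apply/andP; split; lra.
have z0 := zab ord0; have z1 := zab (inord 1); have z2 := zab (inord 2).
move: z0 z1 z2; rewrite !mxE !inordK //= => /ord_close e0 /ord_close e1 /ord_close e2.
by case: a b {Ei Es E1 E2 wab yab zab} e0 e1 e2 => [[? ?] ?] [[? ?] ?] /= -> -> ->.
Qed.
Definition radial_push (W : normedModType K) (c : W) (r : K) (y : W) : W :=
  c + (Num.max r `|y - c| / `|y - c|) *: (y - c).

Lemma radial_push_cont (W : normedModType K) (c : W) r y :
  y != c -> {for y, continuous (radial_push c r)}.
Proof.
move=> yc; have n0 : `|y - c| != 0 by rewrite normr_eq0 subr_eq0.
have cd : {for y, continuous (fun y : W => `|y - c|)}.
  by apply: cvg_norm; apply: cvgB; [exact: cvg_id|exact: cvg_cst].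
apply: cvgD; first exact: cvg_cst.
apply: cvgZ; last by apply: cvgB; [exact: cvg_id|exact: cvg_cst].
apply: cvgM; last by apply: cvgV.
apply: (@continuous_max K _ (fun=> r) (fun y : W => `|y - c|)) => //.
exact: cvg_cst.
Qed.

Lemma radial_push_out (W : normedModType K) (c : W) r y :
  y != c -> r <= `|y - c| -> radial_push c r y = y.
Proof.
move=> yc ry; rewrite /radial_push (max_idPr ry) divff ?normr_eq0 ?subr_eq0//.
by rewrite scale1r addrC subrK.
Qed.

Lemma radial_push_in (W : normedModType K) (c : W) r y :
  0 < r -> y != c -> `|y - c| <= r -> `|radial_push c r y - c| = r.
Proof.
move=> r0 yc ry; have n0 : 0 < `|y - c| by rewrite normr_gt0 subr_eq0.
rewrite /radial_push (max_idPl ry) addrC addKr normrZ.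
by rewrite ger0_norm ?divr_ge0 ?(ltW r0)// mulfVK ?gt_eqF.
Qed.

Definition clamp (a t : K) := Num.max (- a) (Num.min a t).

Lemma clampP a t : 0 <= a ->
  [\/ clamp a t = t /\ `|t| <= a, clamp a t = a /\ a < t | clamp a t = - a /\ t < - a].
Proof.
move=> a0; rewrite /clamp; case: (ltP a t) => at1.
  constructor 2; split=> //; apply/max_idPr; lra.
case: (ltP t (- a)) => at2; first by constructor 3.
by constructor 1; split=> //; rewrite ler_norml; lra.
Qed.

Lemma clamp_lip a t u : 0 <= a -> `|clamp a t - clamp a u| <= `|t - u|.
Proof.
move=> a0.
case: (clampP t a0) => -[-> +]; case: (clampP u a0) => -[-> +];
  rewrite ?ler_norml; case: (lerP 0 (t - u)) => H;
  rewrite ?(ger0_norm H) ?(ltr0_norm H) ?ler_norml; lra.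
Qed.

(* T. Tao's argument: if the point c near f 0 were missed by f, a perturbation of
   an approximate inverse of f, precomposed with the radial push away from c,
   would have no zero on the image of f, contrary to Poincare-Miranda. *)
Lemma injective_cube_interior (f : V -> V) :
  {within B, continuous f} ->
  (forall x y : V, `|x| <= 1 -> `|y| <= 1 -> f x = f y -> x = y) ->
  exists2 e : K, 0 < e & forall c, `|f 0 - c| < e -> exists2 x : V, `|x| <= 1 & f x = c.
Proof.
move=> cf injf.
have B0 : `|0 : V| <= 1 by rewrite normr0.
have q0 : 0 < 4^-1 :> K by lra.
(* With the constant 1/4, points sent within [e] of [c] have norm less than 1/4. This leaves room,
   in the bound on h x - x by 1, for |Q| <= 1/2 and |z| <= d / 4 <= 1/16. *)
have [e2 e20 He2] := compact_injective_modulus (@closed_cube_compact K) cf injf q0.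
pose e := e2 / 2; have e0 : 0 < e by rewrite /e; lra.
exists e => // c fc; apply: contrapT => nc.
have fneq (x : V) : `|x| <= 1 -> f x != c.
  by move=> x1; apply/eqP => E; apply: nc; exists x.
have fin (x : V) : `|x| <= 1 -> `|f x - c| < e -> `|x| < 4^-1.
  move=> x1 fxc; rewrite -[x]subr0; apply: He2 => //=.
  apply: (@le_lt_trans _ _ (`|f x - c| + `|f 0 - c|)).
    by rewrite (distrC (f 0)) (le_trans _ (ler_normD _ _))// addrA subrK.
  by move: fc fxc; rewrite /e; lra.
have [d [d0 d1 Hd]] : exists d : K, [/\ 0 < d, d <= 4^-1 &
    forall x : V, `|x| <= 1 -> `|x| < d -> `|f x - c| < e].
  have ee : 0 < e - `|f 0 - c| by lra.
  have [d d0 Hd] := (within_contP _ _).1 cf 0 B0 _ ee.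
  exists (Num.min d 4^-1); split; rewrite ?ge_min ?lexx ?orbT ?lt_min ?d0// => x x1.
  rewrite lt_min => /andP[xd _].
  have := Hd x x1; rewrite sub0r normrN => /(_ xd) H.
  apply: (@le_lt_trans _ _ (`|f 0 - f x| + `|f 0 - c|)); last by lra.
  by rewrite (distrC (f 0)) (le_trans _ (ler_normD _ _))// addrA subrK.
have d20 : 0 < d / 2 by lra.
have [L [P [L0 PL PE]]] := lipschitz_inverse cf injf d20.
pose Q y : V := \row_i clamp 2^-1 (P y ord0 i).
have h0 : 0 <= 2^-1 :> K by lra.
have QL y y' i : `|Q y ord0 i - Q y' ord0 i| <= L * `|y - y'|.
  by rewrite !mxE (le_trans (clamp_lip _ _ h0)).
have d40 : 0 < d / 4 by lra.
have [z zd Hz] := lipschitz_sphere_avoid c L0 e0 d40 QL.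
have zi i : `|z ord0 i| <= d / 4 by rewrite (le_trans (row_coord_le _ _)).
have Qh y i : `|Q y ord0 i| <= 2^-1.
  by rewrite mxE; case: (clampP (P y ord0 i) h0) => -[-> //];
    rewrite ?normrN ger0_norm.
pose h x := Q (radial_push c e (f x)) - z.
have ch : {within B, continuous h}.
  apply/within_contP => x x1 r r0.
  have rL : 0 < r / (2 * L) by rewrite divr_gt0 ?mulr_gt0.
  have /cvgrPdist_lt/(_ _ rL)/nbhs_norm_ltP[s s0 Hs] :=
    @radial_push_cont _ c e (f x) (fneq x x1).
  have [t t0 Ht] := (within_contP _ _).1 cf x x1 _ s0.
  exists t => // y y1 /(Ht _ y1)/Hs H.
  apply: (@le_lt_trans _ _ (r / 2)); last by lra.
  apply/row_norm_le => [|i]; first by lra.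
  rewrite /h opprB addrA subrK [X in `|X|]mxE [X in _ + X]mxE.
  rewrite (le_trans (QL _ _ i))//.
  move/ltW: H; rewrite -(ler_pM2l L0) => /le_trans; apply.
  suff -> : L * (r / (2 * L)) = r / 2 by [].
  by field; rewrite gt_eqF.
(* This yields the boundary condition of [poincare_miranda]: where x_i is 1 or -1, coordinate i of
   [h x] has the same weak sign. *)
have hx (x : V) i : `|x| <= 1 -> `|h x ord0 i - x ord0 i| <= 1.
  move=> x1.
  have -> : h x ord0 i = Q (radial_push c e (f x)) ord0 i - z ord0 i.
    by rewrite /h !mxE.
  have xi : `|x ord0 i| <= 1 by rewrite (le_trans (row_coord_le _ _)).
  have [le|gt] := leP e `|f x - c|.
    rewrite radial_push_out ?fneq//.
    have := PE x i x1; have := zi i; move: xi; rewrite !mxE !ler_norml.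
    by case: (clampP (P (f x) ord0 i) h0) => -[-> +]; rewrite ?ler_norml; lra.
  have xq : `|x ord0 i| <= 4^-1.
    by rewrite (le_trans (row_coord_le _ _))// ltW// fin.
  have := zi i; have := Qh (radial_push c e (f x)) i; move: xq.
  by rewrite !ler_norml; lra.
have [||x x1 hx0] := poincare_miranda ch.
- by move=> x i x1 xi; have := hx x i x1; rewrite xi ler_norml; lra.
- by move=> x i x1 xi; have := hx x i x1; rewrite xi ler_norml; lra.
move/eqP: hx0; rewrite subr_eq0 => /eqP Qz.
(* If [f x] is pushed to the sphere, this contradicts the choice of [z]. Otherwise |x| >= d, and
   [P (f x)], within d / 2 of x, has a coordinate of modulus at least d / 2, which clamping keeps
   above |z| <= d / 4. *)
have [le|gt] := leP e `|f x - c|; last first.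
  by apply: Hz Qz; rewrite radial_push_in ?fneq// ltW.
have dx : d <= `|x| by rewrite leNgt; apply/negP => /(Hd x x1); rewrite ltNge le.
have [|[i0 i] /= Ei] := @mx_norm_neq0 _ _ _ x.
  by rewrite -[mx_norm _]/(`|x|) gt_eqF// (lt_le_trans d0).
rewrite -[mx_norm _]/(`|x|) (ord1 i0) in Ei.
have := PE x i x1; have := zi i.
rewrite -Qz radial_push_out ?fneq// mxE.
rewrite Ei in dx; move: dx; case: (lerP 0 (x ord0 i)) => H;
  rewrite ?(ger0_norm H) ?(ltr0_norm H) !ler_norml;
  case: (clampP (P (f x) ord0 i) h0) => -[-> +]; rewrite ?ler_norml; lra.
Qed.

Theorem invariance_of_domain (U : set V) (f : V -> V) :
  open U -> {within U, continuous f} ->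
  (forall x y, U x -> U y -> f x = f y -> x = y) -> open (f @` U).
Proof.
move=> oU cf injf; rewrite openE => _ [u Uu <-]; rewrite /interior.
have /nbhs_norm_ltP[r r0 Hr] : nbhs u U by apply: open_nbhs_nbhs.
pose s := r / 2; have s0 : 0 < s by rewrite /s; lra.
have Us (x : V) : `|x| <= 1 -> U (u + s *: x).
  move=> x1; apply: Hr; rewrite opprD addrA subrr sub0r normrN normrZ gtr0_norm//.
  by rewrite (@le_lt_trans _ _ s)// ?ger_pMr// /s; lra.
have [||e e0 He] := @injective_cube_interior (fun x => f (u + s *: x)).
- apply/within_contP => x x1 e e0.
  have [d d0 Hd] := (within_contP _ _).1 cf _ (Us _ x1) _ e0.
  exists (d / s); first by rewrite divr_gt0.
  move=> y y1; rewrite ltr_pdivlMr// => H; apply: Hd; first exact: Us.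
  rewrite opprD addrACA subrr add0r -scalerBr normrZ gtr0_norm// mulrC//.
- move=> x y x1 y1 /(injf _ _ (Us _ x1) (Us _ y1)) /addrI /eqP.
  by rewrite -subr_eq0 -scalerBr scaler_eq0 gt_eqF//= subr_eq0 => /eqP.
apply/nbhs_norm_ltP; exists e => // y; rewrite -[u]addr0 -(scaler0 _ s) => /He[x x1 <-].
by exists (u + s *: x) => //; exact: Us.
Qed.

End InvarianceOfDomain.

(** * Boundary charts of 3-manifolds *)

Section Convex.
Variables (K : realType) (W : normedModType K).

Definition segment_set (x y : W) := [set x + t *: (y - x) | t in `[0 : K, 1]].

Lemma segment_set_connected (x y : W) : connected (segment_set x y).
Proof.
apply: connected_continuous_connected; first exact: segment_connected.
apply: continuous_subspaceT => t; apply: cvgD; first exact: cvg_cst.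
by apply: cvgZr_tmp; exact: cvg_id.
Qed.

Lemma segment_set0 (x y : W) : segment_set x y x.
Proof. by exists 0; rewrite ?scale0r ?addr0//= in_itv/= lexx ler01. Qed.

Lemma segment_set1 (x y : W) : segment_set x y y.
Proof. by exists 1; rewrite ?scale1r ?(addrC x) ?subrK//= in_itv/= lexx ler01. Qed.

Lemma convex_connected (A : set W) :
  (forall x y, A x -> A y -> segment_set x y `<=` A) -> connected A.
Proof.
move=> Acvx; have [[a Aa]|A0] := pselect (A !=set0); last first.
  rewrite (_ : A = set0); first exact: connected0.
  by apply/seteqP; split=> // x Ax; apply: A0; exists x.
rewrite (_ : A = \bigcup_(y in A) segment_set a y).
  apply: bigcup_connected; first by exists a => y _; exact: segment_set0.
  by move=> y _; exact: segment_set_connected.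
apply/seteqP; split=> [y Ay|y [z Az]]; first by exists y => //; exact: segment_set1.
exact: Acvx.
Qed.

End Convex.

Lemma within_continuous_comp_sub (T1 T2 T3 : topologicalType) (A : set T1)
    (B : set T2) (f : T1 -> T2) (g : T2 -> T3) :
  f @` A `<=` B -> {within A, continuous f} -> {within B, continuous g} ->
  {within A, continuous (g \o f)}.
Proof.
move=> fAB /subspace_continuousP cf /subspace_continuousP cg.
apply/subspace_continuousP => x Ax.
have Bfx : B (f x) by apply: fAB; exists x.
suff cf' : f @ within A (nbhs x) --> within B (nbhs (f x)).
  exact: cvg_comp cf' (cg _ Bfx).
move=> P; rewrite /within /= => HP.
have H : nbhs x [set y | A y -> B (f y) -> P (f y)] := cf x Ax _ HP.
move: H.
by apply: filterS => y Hy Ay; apply: Hy => //; apply: fAB; exists y.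
Qed.

Lemma open_within_preimage (T U : topologicalType) (A : set T) (f : T -> U)
    (X : set U) : open A -> {within A, continuous f} -> open X ->
  open (A `&` f @^-1` X).
Proof.
move=> oA; rewrite continuous_open_subspace// => cf oX.
exact: (continuous_inP f oA).1.
Qed.

Section ManifoldCharts.
Variables (K : realType) (T : normedModType K).
Local Notation V := 'rV[K]_3.
Local Notation H := (@half_space K 3).
Implicit Types M : set T.

Lemma half_spaceE (y : V) : H y <-> 0 <= y ord0 ord0.
Proof.
split=> [|y0 i i0]; first exact.
by rewrite (_ : i = ord0)//; exact: val_inj.
Qed.

Lemma coord_open_gt (i : 'I_3) (a : K) : open [set y : V | a < y ord0 i].
Proof.
apply: (@open_comp _ _ (fun y : V => y ord0 i) [set t | a < t]); last exact: open_gt.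
by move=> y _; exact: coord_continuous.
Qed.

(** A chart of [manifold] with its two maps exposed and the half-space reduced to the sign of
    coordinate 0. One notion serves interior and boundary points, which that coordinate tells
    apart. *)
Record bd_chart M (U : set T) (W : set V) (f : T -> V) (g : V -> T) := BdChart {
  bc_oU : open U ;
  bc_oV : open W ;
  bc_f : forall x, M x -> U x -> W (f x) /\ 0 <= f x ord0 ord0 ;
  bc_g : forall y, W y -> 0 <= y ord0 ord0 -> M (g y) /\ U (g y) ;
  bc_gf : forall x, M x -> U x -> g (f x) = x ;
  bc_fg : forall y, W y -> 0 <= y ord0 ord0 -> f (g y) = y ;
  bc_cf : {within M `&` U, continuous f} ;
  bc_cg : {within W `&` H, continuous g} }.

Lemma manifold_chart M p : manifold K 3 M -> M p ->
  exists U W f g, U p /\ bd_chart M U W f g.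
Proof.
move=> mM /mM [U [W [oU Up oV [f [g [[fA gB gf fg] [cf cg]]]]]]].
exists U, W, f, g; split=> //; split=> //.
- move=> x Mx Ux; have [] : (W `&` H) (f x) by apply: fA; exists x.
  by move=> ? /half_spaceE.
- by move=> y Vy y0; apply: gB; exists y => //; split=> //; exact/half_spaceE.
- by move=> x Mx Ux; apply: gf.
- by move=> y Vy y0; apply: fg; split=> //; exact/half_spaceE.
Qed.

Lemma bd_chart_interior M U W f g x : bd_chart M U W f g -> M x -> U x ->
  0 < f x ord0 ord0 -> manifold_interior K 3 M x.
Proof.
move=> [oU oV fA gB gf fg cf cg] Mx Ux fx; split=> //.
pose V' := W `&` [set y | 0 < y ord0 ord0].
have oV' : open V' by apply: openI => //; exact: coord_open_gt.
have /open_subspaceP[Z oO EO] : open (f @^-1` V' : set (subspace (M `&` U))).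
  by move/continuousP: cf; apply.
have OE y : M y -> U y -> Z y <-> V' (f y).
  move=> My Uy; have : (Z `&` (M `&` U)) y <-> (f @^-1` V' `&` (M `&` U)) y by rewrite EO.
  by move=> /= [h1 h2]; split=> h; [case: h1|case: h2].
exists (U `&` Z), V'; split=> //.
- exact: openI.
- by split=> //; apply/OE => //; split=> //; case: (fA x Mx Ux).
exists f, g; split; first split.
- by move=> _ [y [My [Uy Oy]] <-]; exact/OE.
- move=> _ [y [Vy y0] <-]; have [? ?] := gB y Vy (ltW y0).
  by split=> //; split=> //; apply/OE => //; rewrite fg ?(ltW y0).
- by move=> y [My [Uy _]]; exact: gf.
- by move=> y [Vy y0]; apply: fg => //; exact: ltW.
split; first by apply: continuous_subspaceW cf => y [My [Uy _]].
by apply: continuous_subspaceW cg => y [Vy y0]; split=> //; apply/half_spaceE/ltW.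
Qed.

Lemma open_not_in_half_space (A : set V) y : open A -> A y -> y ord0 ord0 = 0 ->
  exists2 z, A z & z ord0 ord0 < 0.
Proof.
move=> oA Ay y0; have /nbhs_norm_ltP[r r0 Hr] : nbhs y A by exact: open_nbhs_nbhs.
exists (y - (r / 2) *: delta_mx ord0 ord0).
  apply: Hr; rewrite opprB addrCA subrr addr0 normrZ gtr0_norm; last by lra.
  apply: (@le_lt_trans _ _ (r / 2 * 1)); last by lra.
  rewrite ler_pM2l; last by lra.
  by apply/row_norm_le => // i; rewrite mxE; case: andP => _; rewrite ?normr1 ?normr0.
by rewrite !mxE y0 eqxx /=; lra.
Qed.

(** Invariance of the boundary: the transition map from an interior chart would be injective on an
    open set, hence open, yet its image stays in the half-space and touches the bounding plane. *)
Lemma bd_chart_not_interior M U W f g x : bd_chart M U W f g -> M x -> U x ->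
  f x ord0 ord0 = 0 -> ~ manifold_interior K 3 M x.
Proof.
move=> [oU oV fA gB gf fg cf cg] Mx Ux fx0.
move=> [_ [U' [V' [oU' U'x oV' [f' [g' [[fA' gB' gf' fg'] [cf' cg']]]]]]]].
have Mg' y : V' y -> M (g' y) by move=> Vy; case: (gB' (g' y)) => //; exists y.
pose V2 := V' `&` g' @^-1` U.
have oV2 : open V2 by apply: open_within_preimage.
have : open ((f \o g') @` V2).
  apply: invariance_of_domain => //.
    apply: (@within_continuous_comp_sub _ _ _ _ (M `&` U)) => //.
      by move=> _ [y [Vy Uy] <-]; split=> //; exact: Mg'.
    by apply: continuous_subspaceW cg' => y [].
  move=> y z [Vy Uy] [Vz Uz] /= E; rewrite -(fg' y)// -(fg' z)//; congr (f' _).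
  by rewrite -[LHS](gf _ (Mg' _ Vy) Uy) E gf//; exact: Mg'.
move=> /(@open_not_in_half_space _ (f x)).
have V'x : V' (f' x) by apply: fA'; exists x.
case=> //.
  exists (f' x) => /=; last by rewrite gf'.
  by split=> //; rewrite /= gf'.
move=> _ [y [Vy Uy] <-]; rewrite ltNge.
by have [_ ->] := fA (g' y) (Mg' y Vy) Uy.
Qed.

Lemma manifold_boundary_chart M p : manifold K 3 M -> manifold_boundary K 3 M p ->
  exists U W (f : T -> V) g, [/\ U p, f p ord0 ord0 = 0 & bd_chart M U W f g].
Proof.
move=> mM [Mp nint]; have [U [W [f [g [Up bc]]]]] := manifold_chart mM Mp.
exists U, W, f, g; split=> //; apply/eqP; rewrite eq_le.
have [_ ->] := bc_f bc Mp Up; rewrite andbT leNgt; apply/negP => f0.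
exact/nint/(bd_chart_interior bc).
Qed.

Lemma bd_chart_boundary M U W f g x : bd_chart M U W f g -> M x -> U x ->
  (manifold_boundary K 3 M x <-> f x ord0 ord0 = 0).
Proof.
move=> bc Mx Ux; split=> [[_ nint]|f0]; last first.
  by split=> //; exact: (bd_chart_not_interior bc).
apply/eqP; rewrite eq_le; have [_ ->] := bc_f bc Mx Ux; rewrite andbT leNgt.
by apply/negP => ?; exact/nint/(bd_chart_interior bc).
Qed.

Lemma bd_chart_small M U W f g p (O : set T) : bd_chart M U W f g -> M p -> U p ->
  f p ord0 ord0 = 0 -> nbhs p O ->
  exists2 r : K, 0 < r & forall y : V, `|f p - y| < r -> W y /\ (0 <= y ord0 ord0 -> O (g y)).
Proof.
move=> bc Mp Up fp0 /nbhs_norm_ltP[e e0 He].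
have [Wfp fpH] := bc_f bc Mp Up.
have /nbhs_norm_ltP[r1 r10 Hr1] : nbhs (f p) W.
  by apply: open_nbhs_nbhs; split=> //; exact: bc_oV bc.
have WH : (W `&` H) (f p) by split=> //; exact/half_spaceE.
have [r2 r20 Hr2] := (within_contP _ _).1 (bc_cg bc) _ WH _ e0.
exists (Num.min r1 r2); first by rewrite lt_min r10.
move=> y; rewrite lt_min => /andP[/Hr1 Wy yr2]; split=> // y0.
apply: He; rewrite -{1}(bc_gf bc Mp Up); apply: Hr2 => //.
by split=> //; exact/half_spaceE.
Qed.

Lemma bd_chart_back M U W f g p (r : K) : bd_chart M U W f g -> M p -> U p ->
  0 < r -> nbhs p [set x | M x -> U x /\ `|f p - f x| < r].
Proof.
move=> bc Mp Up r0.
have [d d0 Hd] := (within_contP _ _).1 (bc_cf bc) p (conj Mp Up) _ r0.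
have : nbhs p U by apply: open_nbhs_nbhs; split=> //; exact: bc_oU bc.
apply: filterS2 (_ : nbhs p [set x | `|p - x| < d]) => [x xd Ux Mx|].
  by split=> //; exact: Hd.
by apply/nbhs_norm_ltP; exists d.
Qed.

(** In a boundary chart [C] is the image of an open half-ball, which is convex and adherent to all
    nearby points of the half-space. *)
Lemma boundary_interior_connected M p (O : set T) :
  manifold K 3 M -> manifold_boundary K 3 M p -> nbhs p O ->
  exists C, [/\ connected C, C `<=` manifold_interior K 3 M `&` O &
    nbhs p [set x | M x -> closure C x]].
Proof.
move=> mM bp nO; have [U [W [f [g [Up fp0 bc]]]]] := manifold_boundary_chart mM bp.
have Mp : M p by case: bp.
have [r r0 Hr] := bd_chart_small bc Mp Up fp0 nO.
pose D := [set y : V | `|f p - y| < r /\ 0 < y ord0 ord0].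
have cD : connected D.
  apply: convex_connected => x y [xr x0] [yr y0] _ [t /= + <-].
  rewrite in_itv /= => /andP[t0 t1]; split; last first.
    rewrite !mxE (_ : _ + _ = (1 - t) * x ord0 ord0 + t * y ord0 ord0); last by ring.
    have [->|tn0] := eqVneq t 0; first by rewrite mul0r addr0 subr0 mul1r.
    by rewrite ltr_wpDl ?mulr_gt0 ?mulr_ge0 ?subr_ge0 ?(ltW x0)// lt0r tn0.
  rewrite (_ : f p - _ = (1 - t) *: (f p - x) + t *: (f p - y)); last first.
    by apply/rowP => i; rewrite !mxE; ring.
  rewrite (le_lt_trans (ler_normD _ _))// !normrZ !ger0_norm ?subr_ge0//.
  have [->|tn0] := eqVneq t 0; first by rewrite mul0r addr0 subr0 mul1r.
  rewrite (_ : r = (1 - t) * r + t * r); last by ring.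
  rewrite ler_ltD ?ler_wpM2l ?subr_ge0 ?(ltW xr)// ltr_pM2l// lt0r tn0//.
have DW y : D y -> (W `&` H) y.
  by move=> [/Hr[Wy _] /ltW y0]; split=> //; exact/half_spaceE.
exists (g @` D); split.
- apply: connected_continuous_connected cD _.
  exact: continuous_subspaceW DW (bc_cg bc).
- move=> _ [y [yr y0] <-]; have [Wy /(_ (ltW y0)) Oy] := Hr y yr.
  have [Mg Ug] := bc_g bc Wy (ltW y0); split=> //.
  by apply: (bd_chart_interior bc) => //; rewrite (bc_fg bc) ?(ltW y0).
have := bd_chart_back bc Mp Up r0; apply: filterS => x Hx Mx.
have [Ux xr] := Hx Mx; have [Wfx fx0] := bc_f bc Mx Ux.
move=> P /nbhs_norm_ltP[e e0 He].
have WHx : (W `&` H) (f x) by split=> //; exact/half_spaceE.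
have [d d0 Hd] := (within_contP _ _).1 (bc_cg bc) _ WHx _ e0.
pose s := Num.min (d / 2) ((r - `|f p - f x|) / 2).
have s0 : 0 < s by rewrite lt_min; apply/andP; split; lra.
have sd : s < d by rewrite /s gt_min; apply/orP; left; lra.
have sr : s < r - `|f p - f x| by rewrite /s gt_min; apply/orP; right; lra.
pose y := f x + s *: delta_mx ord0 ord0.
have yx : `|f x - y| <= s.
  rewrite /y opprD addrA subrr sub0r normrN normrZ gtr0_norm//.
  rewrite ler_piMr ?(ltW s0)//.
  by apply/row_norm_le => // i; rewrite mxE; case: andP => _; rewrite ?normr1 ?normr0.
have Dy : D y.
  split; last by rewrite /y !mxE eqxx mulr1 ltr_wpDl.
  apply: (@le_lt_trans _ _ (`|f p - f x| + `|f x - y|)); last by lra.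
  by rewrite (le_trans _ (ler_normD _ _))// addrA subrK.
exists (g y); split; first by exists y.
apply: He; rewrite -{1}(bc_gf bc Mx Ux); apply: Hd; first exact: DW.
exact: le_lt_trans yx sd.
Qed.

(** The punctured square is covered by four convex half-squares, one for each sign of each of the
    coordinates 1 and 2; half-squares of different coordinates overlap. *)
Lemma punctured_square_connected (q : V) (r : K) : q ord0 ord0 = 0 -> 0 < r ->
  connected [set y : V | [/\ `|q - y| < r, y ord0 ord0 = 0 & y <> q]].
Proof.
move=> q0 r0.
pose A (i : 'I_3) (b : bool) := [set y : V | [/\ `|q - y| < r, y ord0 ord0 = 0 &
  0 < (-1) ^+ b * (y ord0 i - q ord0 i)]].
have cA i b : connected (A i b).
  apply: convex_connected => x y [xr x0 xi] [yr y0 yi] _ [t /= + <-].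
  rewrite in_itv /= => /andP[t0 t1]; split.
  - rewrite (_ : q - _ = (1 - t) *: (q - x) + t *: (q - y)); last first.
      by apply/rowP => k; rewrite !mxE; ring.
    rewrite (le_lt_trans (ler_normD _ _))// !normrZ !ger0_norm ?subr_ge0//.
    have [->|tn0] := eqVneq t 0; first by rewrite mul0r addr0 subr0 mul1r.
    rewrite (_ : r = (1 - t) * r + t * r); last by ring.
    rewrite ler_ltD ?ler_wpM2l ?subr_ge0 ?(ltW xr)// ltr_pM2l// lt0r tn0//.
  - by rewrite !mxE x0 y0; ring.
  rewrite !mxE (_ : _ * _ = (1 - t) * ((-1) ^+ b * (x ord0 i - q ord0 i))
    + t * ((-1) ^+ b * (y ord0 i - q ord0 i))); last by ring.
  have [->|tn0] := eqVneq t 0; first by rewrite mul0r addr0 subr0 mul1r.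
  apply: ltr_wpDl; first by apply: mulr_ge0; [rewrite subr_ge0|exact: ltW].
  by apply: mulr_gt0 => //; rewrite lt0r tn0.
pose P (b c : bool) : V := \row_k (q ord0 k + r / 2 *
  (if k == inord 1 then (-1) ^+ b else if k == inord 2 then (-1) ^+ c else 0)).
have PA b c : A (inord 1) b (P b c) /\ A (inord 2) c (P b c).
  have i21 : (inord 2 == inord 1 :> 'I_3) = false by rewrite -val_eqE /= !inordK.
  have i01 : (ord0 == inord 1 :> 'I_3) = false by rewrite -val_eqE /= inordK.
  have i02 : (ord0 == inord 2 :> 'I_3) = false by rewrite -val_eqE /= inordK.
  have Pr : `|q - P b c| < r.
    apply: (@le_lt_trans _ _ (r / 2)); last by lra.
    apply/row_norm_le => [|k]; first by lra.
    rewrite !mxE opprD addrA subrr sub0r normrN normrM gtr0_norm; last by lra.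
    apply: ler_piMr; first by lra.
    by case: ifP => _; [|case: ifP => _]; rewrite ?normrX ?normrN1 ?expr1n ?normr0.
  have P0 : P b c ord0 ord0 = 0 by rewrite !mxE i01 i02 q0 mulr0 addr0.
  have sg (e : bool) : (-1) ^+ e * (-1) ^+ e = 1 :> K by case: e; rewrite ?mulrNN mulr1.
  split; split=> //; rewrite !mxE ?i21 eqxx addrC addKr mulrCA sg mulr1; lra.
rewrite (_ : [set _ | _] = ((A (inord 1) false `|` A (inord 2) false)
    `|` A (inord 1) true) `|` A (inord 2) true).
  apply: connectedU => //; last apply: connectedU => //; last apply: connectedU => //.
  - exists (P false true); split; last exact: (PA false true).2.
    by left; left; exact: (PA false true).1.
  - exists (P true false); split; last exact: (PA true false).1.
    by right; exact: (PA true false).2.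
  - by exists (P false false); exact: PA.
apply/seteqP; split=> y /=.
  move=> [yr y0 yq].
  have [n|e1] := eqVneq (y ord0 (inord 1)) (q ord0 (inord 1)); last first.
    have [lt|] := ltP (q ord0 (inord 1)) (y ord0 (inord 1)).
      by left; left; left; split=> //; rewrite mul1r subr_gt0.
    rewrite le_eqVlt (negPf e1) /= => lt.
    by left; right; split=> //; rewrite expr1 mulN1r oppr_gt0 subr_lt0.
  have [n2|e2] := eqVneq (y ord0 (inord 2)) (q ord0 (inord 2)); last first.
    have [lt|] := ltP (q ord0 (inord 2)) (y ord0 (inord 2)).
      by left; left; right; split=> //; rewrite mul1r subr_gt0.
    rewrite le_eqVlt (negPf e2) /= => lt.
    by right; split=> //; rewrite expr1 mulN1r oppr_gt0 subr_lt0.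
  exfalso; apply: yq; apply/rowP; apply: forall_ord3 => //; by rewrite y0 q0.
have neq i b : A i b y -> y <> q.
  by move=> [_ _ +] E; rewrite E subrr mulr0 ltxx.
by move=> [[[|]|]|] Ay; move: (Ay) => /neq ?; case: Ay.
Qed.

Lemma boundary_punctured_connected M p (O : set T) :
  manifold K 3 M -> manifold_boundary K 3 M p -> nbhs p O ->
  exists C, [/\ connected C, C `<=` (manifold_boundary K 3 M `&` O) `\ p &
    nbhs p [set x | manifold_boundary K 3 M x -> x <> p -> C x]].
Proof.
move=> mM bp nO; have [U [W [f [g [Up fp0 bc]]]]] := manifold_boundary_chart mM bp.
have Mp : M p by case: bp.
have [r r0 Hr] := bd_chart_small bc Mp Up fp0 nO.
pose D := [set y : V | [/\ `|f p - y| < r, y ord0 ord0 = 0 & y <> f p]].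
have cD : connected D by exact: punctured_square_connected.
have DW y : D y -> (W `&` H) y.
  by move=> [/Hr[Wy _] y0 _]; split=> //; apply/half_spaceE; rewrite y0.
exists (g @` D); split.
- apply: connected_continuous_connected cD _.
  exact: continuous_subspaceW DW (bc_cg bc).
- move=> _ [y [yr y0 yp] <-]; have y0' : 0 <= y ord0 ord0 by rewrite y0.
  have [Wy /(_ y0') Oy] := Hr y yr.
  have [Mg Ug] := bc_g bc Wy y0'; split; last first.
    by move=> E; apply: yp; rewrite -E (bc_fg bc).
  by split=> //; apply/(bd_chart_boundary bc) => //; rewrite (bc_fg bc).
have := bd_chart_back bc Mp Up r0; apply: filterS => x Hx bx xp.
have Mx : M x by case: bx.
have [Ux xr] := Hx Mx.
exists (f x); last exact: (bc_gf bc).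
split=> //; first exact/(bd_chart_boundary bc).
by move=> E; apply: xp; rewrite -(bc_gf bc Mx Ux) E (bc_gf bc).
Qed.

(** * Manifolds seen through an injective parametrization of a compact set *)

Section Parametrization.
Variables (Q : set V) (F : V -> T).
Hypotheses (cQ : compact Q) (cF : {within Q, continuous F}).
Hypothesis injF : forall x y, Q x -> Q y -> F x = F y -> x = y.

Lemma compact_inverse : exists2 G : T -> V,
  forall x, Q x -> G (F x) = x & {within F @` Q, continuous G}.
Proof.
have /choice[G HG] : forall y, exists x, (exists2 x, Q x & F x = y) -> Q x /\ F x = y.
  move=> y; have [[x Qx Fx]|n] := pselect (exists2 x, Q x & F x = y).
    by exists x.
  by exists 0 => /n.
have GF x : Q x -> G (F x) = x.
  by move=> Qx; have [|? ?] := HG (F x); [exists x|exact: injF].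
exists G => //; apply/within_contP => _ [x Qx <-] e e0.
have [m m0 Hm] := compact_injective_modulus cQ cF injF e0.
by exists m => // _ [y Qy <-] ?; rewrite !GF//; exact: Hm.
Qed.

(** The inverse of [F] composed with a chart of [M] is injective on an open set, hence open by
    invariance of domain; its image is a neighborhood of [x] made of parameters of points of [M]. *)
Lemma interior_parametrized M x (O : set T) : Q x -> open O -> O (F x) ->
  M `&` O `<=` F @` Q -> manifold_interior K 3 M (F x) ->
  nbhs x [set y | Q y /\ M (F y)].
Proof.
move=> Qx oO Ox MO [MFx [U [W [oU Up oW [f [g [[fA gB gf fg] [cf cg]]]]]]]].
have [G GF cG] := compact_inverse.
pose W2 := W `&` g @^-1` O.
have oW2 : open W2 by exact: open_within_preimage.
have Mg y : W y -> M (g y) by move=> Wy; case: (gB (g y)) => //; exists y.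
have gQ y : W2 y -> (F @` Q) (g y) by move=> [Wy Oy]; apply: MO; split=> //; exact: Mg.
have oG : open ((G \o g) @` W2).
  apply: invariance_of_domain => //.
    apply: (@within_continuous_comp_sub _ _ _ _ (F @` Q)) => //.
      by move=> _ [y /gQ ? <-].
    by apply: continuous_subspaceW cg => y [].
  move=> y z Wy Wz /=; have [u Qu Eu] := gQ y Wy; have [v Qv Ev] := gQ z Wz.
  rewrite -Eu -Ev !GF// => uv; rewrite -(fg y); last by case: Wy.
  by rewrite -(fg z); [rewrite -Eu -Ev uv|case: Wz].
have : nbhs x ((G \o g) @` W2).
  apply: open_nbhs_nbhs; split=> //; exists (f (F x)).
    by split; [apply: fA; exists (F x)|rewrite /= gf].
  by rewrite /= gf// GF.
apply: filterS => _ [y Wy <-] /=; have [u Qu Eu] := gQ y Wy.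
by rewrite -Eu GF//; split=> //; rewrite Eu; apply: Mg; case: Wy.
Qed.

(** Otherwise a boundary chart composed with [F] would be an open map near [x], with image in the
    half-space and touching its plane. *)
Lemma boundary_parametrized M x : manifold K 3 M -> manifold_boundary K 3 M (F x) ->
  Q x -> ~ nbhs x [set y | Q y /\ M (F y)].
Proof.
move=> mM bp Qx nM; have [U [W [f [g [Up fp0 bc]]]]] := manifold_boundary_chart mM bp.
pose A := [set y | Q y /\ M (F y)]°.
have oA : open A by exact: open_interior.
have AQ : A `<=` Q by move=> y /interior_subset [].
have cFA : {within A, continuous F} by exact: continuous_subspaceW AQ cF.
pose A2 := A `&` F @^-1` U.
have oA2 : open A2 by apply: open_within_preimage => //; exact: bc_oU bc.
have A2M y : A2 y -> M (F y) /\ U (F y) by move=> [/interior_subset[]].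
have : open ((f \o F) @` A2).
  apply: invariance_of_domain => //.
    apply: (@within_continuous_comp_sub _ _ _ _ (M `&` U)) (bc_cf bc).
      by move=> _ [y /A2M ? <-].
    by apply: continuous_subspaceW cFA => y [].
  move=> y z Ay Az /= E; have [? ?] := A2M y Ay; have [? ?] := A2M z Az.
  apply: injF; [by apply: AQ; case: Ay|by apply: AQ; case: Az|].
  by rewrite -(bc_gf bc (x:=F y))// E (bc_gf bc).
move=> /(@open_not_in_half_space _ (f (F x))); case=> //; first by exists x.
move=> _ [y /A2M[My Uy] <-]; rewrite ltNge.
by have [_ ->] := bc_f bc My Uy.
Qed.

End Parametrization.
End ManifoldCharts.

(** * Strata of a cube *)

Lemma locally_constant_connected (T : topologicalType) (C : set T) (k : T -> bool) :
  connected C -> (forall x, C x -> nbhs x [set y | C y -> k y = k x]) ->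
  forall x y, C x -> C y -> k x = k y.
Proof.
move=> cC lk; suff key x y : C x -> C y -> k x -> k y.
  by move=> x y Cx Cy; apply/idP/idP; exact: key.
move=> Cx Cy kx.
pose A (b : bool) : set T := [set z : T | nbhs z [set u | C u -> k u = b]].
have oA b : open (A b) by rewrite openE => z; exact: nbhs_interior.
have AE b z : C z -> A b z <-> k z = b.
  by move=> Cz; split=> [/nbhs_singleton|<-]; [exact|exact: lk].
suff E : C `&` A true = C.
  by have [_ /(AE _ _ Cy)] : (C `&` A true) y by rewrite E.
apply: cC; first by exists x; split=> //; exact/AE.
  by exists (A true).
exists (~` A false); first exact: open_closedC.
apply/seteqP; split=> z [Cz Az]; split=> //.
  by move/(AE _ _ Cz): Az => kz /(AE _ _ Cz); rewrite kz.
by apply/AE => //; apply/negP => /negP/negbTE kz; apply: Az; exact/(AE _ _ Cz).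
Qed.

Section Strata.
Variable K : realType.
Local Notation V := 'rV[K]_3.
Local Notation C0 := (@open_unit_cube K).

Definition octant := {ffun 'I_3 -> bool}.

(** Incidence of strata: that of [f] lies in the closure of that of [g]. The center of the cube is
    the least element, the open octants [oface s] are the maximal ones. *)
Definition fle (f g : face) := [forall i, (f i == None) || (g i == f i)].
Definition oface (s : octant) : face := [ffun i => Some (s i)].
Definition fill (f : face) : octant := [ffun i => odflt true (f i)].
Definition flip (s : octant) (i : 'I_3) : octant :=
  [ffun j => if j == i then ~~ s j else s j].

(* Read as a stratum of the open cube, a face f stands for the points whose
   coordinate i is 1/2 if f i = None, and on the side b of 1/2 if f i = Some b. *)
Definition mid (f : face) : V :=
  \row_i (if f i is Some b then (if b then 3 / 4 else 4^-1) else 2^-1).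

Definition str (x : V) : face :=
  [ffun i => if x ord0 i == 2^-1 then None else Some (2^-1 < x ord0 i)].

Lemma fleP (f g : face) : reflect (forall i b, f i = Some b -> g i = Some b) (fle f g).
Proof.
apply: (iffP forallP) => [H i b fi|H i].
  by have := H i; rewrite fi /= => /eqP.
by case E: (f i) => [b|] //=; rewrite (H _ _ E).
Qed.

Lemma fle_refl f : fle f f. Proof. exact/fleP. Qed.

Lemma fle_trans g f h : fle f g -> fle g h -> fle f h.
Proof. by move=> /fleP H1 /fleP H2; apply/fleP => i b /H1/H2. Qed.

Lemma fle_fill f : fle f (oface (fill f)).
Proof. by apply/fleP => i b fi; rewrite !ffunE fi. Qed.

Lemma fle_oface s f : fle (oface s) f -> f = oface s.
Proof. by move=> /fleP H; apply/ffunP => i; rewrite (H i (s i)) !ffunE. Qed.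

Lemma fill_oface s : fill (oface s) = s.
Proof. by apply/ffunP => i; rewrite !ffunE. Qed.

Lemma flipK s i : flip (flip s i) i = s.
Proof. by apply/ffunP => j; rewrite !ffunE; case: eqP => // _; rewrite negbK. Qed.

Lemma fle_flip (f : face) s i : fle f (oface s) -> f i = None -> fle f (oface (flip s i)).
Proof.
move=> /fleP H fi; apply/fleP => j b fj; have := H _ _ fj; rewrite !ffunE.
by case: eqP => // ji; rewrite ji fi in fj.
Qed.

(** The octants above [f] form a subcube, connected by flips of free coordinates: induction on the
    number of coordinates where [s] and [s'] differ. *)
Lemma subcube_constant (A : Type) (f : face) (k : octant -> A) :
  (forall s i, fle f (oface s) -> f i = None -> k (flip s i) = k s) ->
  forall s s', fle f (oface s) -> fle f (oface s') -> k s = k s'.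
Proof.
move=> H s s'; have [n] := ubnP #|[pred i | s i != s' i]|.
elim: n s => // n IH s; rewrite ltnS => sn fs fs'.
have [i si|E] := pickP [pred i | s i != s' i]; last first.
  by congr k; apply/ffunP => i; apply/eqP; have := E i => /= /negbFE.
have fi : f i = None.
  case E: (f i) => [b|] //; move/fleP: fs => /(_ _ _ E); move/fleP: fs' => /(_ _ _ E).
  by rewrite !ffunE => -[e1] [e2]; move: si; rewrite /= e1 e2 eqxx.
rewrite -(H s i fs fi); apply: IH => //; last exact: fle_flip.
apply: leq_trans sn; apply: proper_card; apply/properP; split.
  apply/fintype.subsetP => j; rewrite !inE /= ffunE; case: (eqVneq j i) => [->|_ //].
  by move: si => /=; case: (s i); case: (s' i).
by exists i; rewrite !inE /= // ffunE eqxx; move: si => /=; case: (s i); case: (s' i).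
Qed.

Lemma mid_in f : C0 (mid f).
Proof. by move=> i; rewrite mxE; case: (f i) => [[]|]; apply/andP; split; lra. Qed.

Lemma str_mid f : str (mid f) = f.
Proof.
apply/ffunP => i; rewrite ffunE mxE; case: (f i) => [[]|]; rewrite ?eqxx//.
- by case: eqP => [?|_]; [exfalso; lra|congr Some; apply/idP; lra].
- by case: eqP => [?|_]; [exfalso; lra|congr Some; apply/negbTE; rewrite -leNgt; lra].
Qed.

Lemma strP (x : V) i : match str x i return Prop with
  | None => x ord0 i = 2^-1
  | Some true => 2^-1 < x ord0 i
  | Some false => x ord0 i < 2^-1 end.
Proof.
rewrite ffunE; case: eqP => // /eqP ne; case: ltP => //.
by rewrite le_eqVlt (negPf ne).
Qed.

Lemma str_uniq (x : V) (f : face) : (forall i, match f i return Prop with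
  | None => x ord0 i = 2^-1
  | Some true => 2^-1 < x ord0 i
  | Some false => x ord0 i < 2^-1 end) -> str x = f.
Proof.
move=> H; apply/ffunP => i; have := H i; have := strP x i.
by case: (str x i) => [[]|]; case: (f i) => [[]|] // *; exfalso; lra.
Qed.

Definition near_set (f : face) := [set y : V | C0 y /\ fle f (str y)].

(** A small move reaches no facet, and a coordinate different from 1/2 keeps its side. *)
Lemma near_str (x : V) : C0 x -> nbhs x (near_set (str x)).
Proof.
move=> Cx.
pose d i : K := Num.min (Num.min (x ord0 i) (1 - x ord0 i))
  (if str x i is Some _ then `|2^-1 - x ord0 i| else 1).
have d0 i : 0 < d i.
  have /andP[x0 x1] := Cx i; rewrite !lt_min x0 subr_gt0 x1 /=.
  by have := strP x i; case: (str x i) => [[]|] // ?; rewrite normr_gt0 subr_eq0; apply/eqP; lra.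
apply/nbhs_norm_ltP; exists (\big[Num.min/1]_i d i).
  by apply: lt_bigmin.
move=> y xy; have Hi i : `|x ord0 i - y ord0 i| < d i.
  have := row_coord_le (x - y) i; rewrite !mxE => /le_lt_trans; apply.
  exact: lt_le_trans xy (bigmin_le_cond _ _ _).
split=> [i|].
  have := Hi i; rewrite !lt_min -!andbA => /and3P[+ + _].
  by rewrite !ltr_norml => /andP[? ?] /andP[? ?]; apply/andP; split; lra.
apply/fleP => i b fi; have := Hi i; rewrite !lt_min fi -!andbA => /and3P[_ _].
have := strP x i; have := strP y i; rewrite fi; case: b {fi} => H1 H2.
  rewrite [X in _ < X]ltr0_norm; last by lra.
  rewrite ltr_norml => /andP[? ?]; move: H1; case: (str y i) => [[]|] // ?; exfalso; lra.
rewrite [X in _ < X]gtr0_norm; last by lra.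
rewrite ltr_norml => /andP[? ?]; move: H1; case: (str y i) => [[]|] // ?; exfalso; lra.
Qed.

Lemma near_mid f : nbhs (mid f) (near_set f).
Proof. by rewrite -{2}(str_mid f); apply: near_str; exact: mid_in. Qed.

(** A segment directed towards a larger stratum enters it at once, so that segments suffice to link
    incident strata. *)
Lemma str_segment (x y : V) (t : K) : C0 x -> C0 y -> fle (str x) (str y) ->
  0 < t <= 1 -> C0 (x + t *: (y - x)) /\ str (x + t *: (y - x)) = str y.
Proof.
move=> Cx Cy /fleP fx /andP[t0 t1].
have E i : (x + t *: (y - x)) ord0 i =
    (1 - t) * x ord0 i + t * y ord0 i by rewrite !mxE; ring.
split.
  move=> i; rewrite E; have /andP[a0 a1] := Cx i; have /andP[b0 b1] := Cy i.
  by apply/andP; split; nra.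
apply: str_uniq => i; rewrite E.
have := strP y i; case: (str y i) (fx i) => [b|]; last first.
  have := strP x i; case: (str x i) => [c|]; first by move=> _ /(_ c erefl).
  by move=> -> _ ->; ring.
have := strP x i; case: (str x i) => [c|] H1 H2.
  by have [E1] := H2 c erefl; rewrite E1 in H1 *; case: c E1 H1 {H2} => _ ? ?; nra.
by rewrite H1; case: b {H2} => ?; nra.
Qed.

Lemma str_segment_set (x y : V) : C0 x -> C0 y -> fle (str x) (str y) ->
  forall z, segment_set x y z -> C0 z /\ (str z = str x \/ str z = str y).
Proof.
move=> Cx Cy fx z [t /= + <-]; rewrite in_itv /= => /andP[t0 t1].
have [->|tn0] := eqVneq t 0; first by rewrite scale0r addr0; split=> //; left.
have [|? ?] := @str_segment x y t Cx Cy fx; first by rewrite lt0r tn0 t0.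
by split=> //; right.
Qed.

Lemma near_stratum f h (A : set V) : fle f h -> nbhs (mid f) A ->
  exists y, [/\ A y, C0 y & str y = h].
Proof.
move=> fh /nbhs_norm_ltP[d d0 Hd].
pose t := Num.min 1 (d / 2).
have t01 : 0 < t <= 1 by rewrite lt_min ltr01 ge_min lexx /=; lra.
have [] := @str_segment (mid f) (mid h) t (mid_in f) (mid_in h); rewrite ?str_mid//.
move=> Cy Ey; exists (mid f + t *: (mid h - mid f)); split=> //.
apply: Hd; rewrite opprD addrA subrr sub0r normrN normrZ gtr0_norm; last by case/andP: t01.
apply: (@le_lt_trans _ _ (d / 2 * 1)); last by lra.
apply: ler_pM => //; first by case/andP: t01 => /ltW.
  by rewrite ge_min lexx orbT.
apply/row_norm_le => // i; rewrite !mxE ler_norml.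
by case: (f i) => [[]|]; case: (h i) => [[]|]; apply/andP; split; lra.
Qed.

(** Inside the open cube the constraints of a dual cell only compare coordinates with 1/2, so dual
    cells are unions of strata there. *)
Lemma dual_set_str g (x : V) : C0 x -> @dual_set K g x <-> @dual_set K g (mid (str x)).
Proof.
move=> Cx; split=> H i; have := H i; have := strP x i; have /andP[? ?] := Cx i;
  rewrite ?mxE; case: (g i) => [[]|]; case: (str x i) => [[]|] //= *;
  try (apply/andP; split); lra.
Qed.

Lemma dual_set_fle g f h : fle f h -> @dual_set K g (mid h) -> @dual_set K g (mid f).
Proof.
move=> /fleP fh H i; have := H i; rewrite !mxE.
case Ef: (f i) => [b|]; first by rewrite (fh _ _ Ef).
by case: (g i) => [[]|]; case: (h i) => [[]|] //= *; try (apply/andP; split); lra.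
Qed.

End Strata.

(* The traces on an open cube, read in its chart, of a 3-manifold X and of its
   boundary B, a union of dual cells of dimension at most 2. *)
Record local_region (K : realType) (X B : set 'rV[K]_3) (G : set face) := LocalRegion {
  lr_sub : forall x, open_unit_cube x -> B x -> X x ;
  lr_closed : forall x, open_unit_cube x -> ~ X x -> nbhs x (~` X) ;
  lr_open : forall x, open_unit_cube x -> X x -> ~ B x -> nbhs x X ;
  lr_boundary : forall x, open_unit_cube x -> B x -> ~ nbhs x X ;
  lr_cells : forall x, open_unit_cube x ->
    (B x <-> exists2 g, G g & @dual_set K g x) ;
  lr_dim : forall g, G g -> (0 < face_dim g)%N ;
  lr_connected : forall x W, open_unit_cube x -> B x -> nbhs x W ->
    exists C, [/\ connected C, C `<=` (X `\` B) `&` W &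
      nbhs x [set y | X y -> closure C y]] ;
  lr_punctured : forall x W, open_unit_cube x -> B x -> nbhs x W ->
    exists C, [/\ connected C, C `<=` (B `&` W) `\ x &
      nbhs x [set y | B y -> y <> x -> C y]] }.

(** * Octants occupied by a local region *)

Section LocalRegion.
Variables (K : realType) (X B : set 'rV[K]_3) (G : set face).
Hypothesis H : local_region X B G.
Local Notation V := 'rV[K]_3.
Local Notation C0 := (@open_unit_cube K).
Local Notation md f := (@mid K f).

(** Away from [B], the set [X] is both open and closed in the open cube. *)
Lemma region_constant (C : set V) x y : connected C -> C `<=` C0 `\` B ->
  C x -> C y -> X x -> X y.
Proof.
move=> cC CB Cx Cy Xx; suff : `[< X x >] = `[< X y >].
  by move=> E; apply/asboolP; rewrite -E; exact/asboolP.
apply: (@locally_constant_connected _ _ (fun z => `[< X z >])) Cx Cy => // z Cz.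
have [Cz0 nBz] := CB z Cz; have [Xz|nXz] := pselect (X z).
  have := lr_open H Cz0 Xz nBz; apply: filterS => u Xu _.
  by rewrite !asboolT.
have := lr_closed H Cz0 nXz; apply: filterS => u Xu _.
by rewrite !asboolF.
Qed.

Lemma boundary_str x : C0 x -> B x <-> B (md (str x)).
Proof.
move=> Cx; have Cm := @mid_in K (str x).
split=> [/(lr_cells H Cx)|/(lr_cells H Cm)] [g Gg gx].
  by apply/(lr_cells H Cm); exists g => //; exact/(dual_set_str g Cx).
by apply/(lr_cells H Cx); exists g => //; exact/(dual_set_str g Cx).
Qed.

Lemma boundary_fle f h : fle f h -> B (md h) -> B (md f).
Proof.
move=> fh /(lr_cells H (@mid_in K h))[g Gg gh].
apply/(lr_cells H (@mid_in K f)); exists g => //; exact: dual_set_fle gh.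
Qed.

Lemma region_segment x y : C0 x -> C0 y -> fle (str x) (str y) -> ~ B (md (str x)) ->
  X x <-> X y.
Proof.
move=> Cx Cy xy nB.
have S : segment_set x y `<=` C0 `\` B.
  move=> z /(str_segment_set Cx Cy xy)[Cz Ez]; split=> // /(boundary_str Cz).
  by case: Ez => -> // /(boundary_fle xy).
by split; apply: (region_constant (@segment_set_connected _ _ x y) S);
  by [exact: segment_set0|exact: segment_set1].
Qed.

Lemma region_str x : C0 x -> X x <-> X (md (str x)).
Proof.
move=> Cx; have [Bx|nB] := pselect (B (md (str x))).
  have Bx' := (boundary_str Cx).2 Bx.
  by split=> _; apply: (lr_sub H) => //; exact: mid_in.
by apply: region_segment => //; rewrite ?str_mid ?fle_refl//; exact: mid_in.
Qed.

Lemma region_fle f h : fle f h -> ~ B (md f) -> X (md f) <-> X (md h).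
Proof. by move=> fh nB; apply: region_segment; rewrite ?str_mid//; exact: mid_in. Qed.

Definition occ (s : octant) : bool := `[< X (md (oface s)) >].

(** The dual of a cell of positive dimension keeps some coordinate equal to 1/2, so [B] avoids the
    open octants. *)
Lemma octant_out s : ~ B (md (oface s)).
Proof.
move=> /(lr_cells H (@mid_in K _))[g /(lr_dim H) g0 gs].
move: g0 => /card_gt0P[i]; rewrite inE => /eqP gi.
by have := gs i; rewrite gi mxE ffunE; case: (s i); lra.
Qed.

Lemma free_occ f s s' : ~ B (md f) -> fle f (oface s) -> fle f (oface s') ->
  occ s = occ s'.
Proof.
move=> nB fs fs'; apply: asbool_equiv_eq.
by rewrite -(region_fle fs nB) -(region_fle fs' nB).
Qed.

Lemma free_occE f s : ~ B (md f) -> fle f (oface s) -> X (md f) <-> occ s.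
Proof. by move=> nB fs; rewrite (region_fle fs nB); split=> /asboolP. Qed.

(** An occupied octant is found because [X] off [B] is adherent to every point of [B], an empty one
    because [X] is a neighborhood of no point of [B]. *)
Lemma boundary_occ f : B (md f) ->
  (exists2 s, fle f (oface s) & occ s) /\ (exists2 s, fle f (oface s) & ~~ occ s).
Proof.
move=> Bf; have Cf := @mid_in K f; split.
  have [C [cC CX nC]] := lr_connected H Cf Bf (@near_mid K f).
  have : closure C (md f) by exact: (nbhs_singleton nC) (lr_sub H Cf Bf).
  move=> /(_ _ (@near_mid K f))[y [/CX [[Xy nBy] [Cy fy]] _]].
  exists (fill (str y)); first exact: fle_trans fy (fle_fill _).
  have nB : ~ B (md (str y)) by move=> /(boundary_str Cy).
  by apply/(free_occE nB (fle_fill _)); exact/(region_str Cy).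
apply: contrapT => nex; apply: (lr_boundary H Cf Bf).
apply: filterS (@near_mid K f) => y [Cy fy].
apply/(region_str Cy); have [By|nBy] := pselect (B (md (str y))).
  by apply: (lr_sub H) => //; exact: mid_in.
apply/(free_occE nBy (fle_fill _)); apply/negPn/negP => no; apply: nex.
by exists (fill (str y)) => //; exact: fle_trans fy (fle_fill _).
Qed.

(** Connectedness of the occupied octants around [f], phrased with test functions. If [f] lies in
    [B], the function [k] is read along a small connected subset of [X] off [B] that meets every
    occupied octant around [f]: near each of its points all octants are occupied, so [k] is locally
    constant on it. *)
Lemma occ_connected f (k : octant -> bool) :
  (forall s i, fle f (oface s) -> f i = None -> occ s -> occ (flip s i) ->
     k (flip s i) = k s) ->
  forall s s', fle f (oface s) -> fle f (oface s') -> occ s -> occ s' -> k s = k s'.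
Proof.
move=> Hk s s' fs fs' os os'.
have [Bf|nB] := pselect (B (md f)); last first.
  apply: (subcube_constant _ fs fs') => u i fu fi; apply: Hk => //.
    by rewrite (free_occ nB fu fs).
  by rewrite (free_occ nB (fle_flip fu fi) fs).
have Cf := @mid_in K f.
have [C [cC CX nC]] := lr_connected H Cf Bf (@near_mid K f).
have meet u : fle f (oface u) -> occ u -> exists2 y, C y & str y = oface u.
  move=> fu ou.
  have [y [+ Cy Ey]] := near_stratum fu nC.
  have Xy : X y by apply/(region_str Cy); rewrite Ey; exact/asboolP.
  move=> /(_ Xy) /(_ _ (near_str Cy))[z [Cz [_]]]; rewrite Ey => /fle_oface Ez.
  by exists z.
have [y Cy Ey] := meet s fs os; have [y' Cy' Ey'] := meet s' fs' os'.
rewrite -(fill_oface s) -(fill_oface s') -Ey -Ey'.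
apply: (@locally_constant_connected _ _ (fun z => k (fill (str z)))) Cy Cy' => // z Cz.
have [[Xz nBz] [C0z fz]] := CX z Cz.
apply: filterS (near_str C0z) => u [C0u zu] Cu.
have nB' : ~ B (md (str z)) by move=> /(boundary_str C0z).
have oz v : fle (str z) (oface v) -> occ v.
  by move=> zv; apply/(free_occE nB' zv); exact/(region_str C0z).
apply: (@subcube_constant _ (str z) k); last exact: fle_fill.
  move=> v i zv zi; apply: Hk; [exact: fle_trans zv| |exact: oz|].
    by case E: (f i) => [b|] //; move/fleP: fz => /(_ _ _ E); rewrite zi.
  by apply: oz; exact: fle_flip.
exact: fle_trans zu (fle_fill _).
Qed.

Definition center_face : face := [ffun=> None].

Lemma center_fle f : fle center_face f.
Proof. by apply/fleP => i b; rewrite ffunE. Qed.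

Definition antipode (s : octant) : octant := [ffun i => ~~ s i].

(* Otherwise B would be, near the center, two cones with a common apex. *)
Lemma occ_not_annulus s0 : B (md center_face) -> ~~ occ s0 -> ~~ occ (antipode s0) ->
  exists s, [/\ s <> s0, s <> antipode s0 & ~~ occ s].
Proof.
move=> Bc no0 no1; apply: contrapT => nex.
have oth s : s <> s0 -> s <> antipode s0 -> occ s.
  by move=> n0 n1; apply/negPn/negP => ns; apply: nex; exists s.
have Cc := @mid_in K center_face.
have [C [cC CB nC]] := lr_punctured H Cc Bc (@near_mid K center_face).
pose k (z : V) := fle (str z) (oface s0).
(* A stratum of [B] lies below some empty octant, hence below one of the only two. *)
have cover f : B (md f) -> fle f (oface s0) \/ fle f (oface (antipode s0)).
  move=> /boundary_occ[_ [s fs ns]].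
  have [<-|n0] := eqVneq s s0; first by left.
  have [<-|n1] := eqVneq s (antipode s0); first by right.
  by move: ns; rewrite oth //; exact/eqP.
have kc y y' : C y -> C y' -> k y = k y'.
  apply: locally_constant_connected => // z Cz.
  have [[Bz [C0z _]] zc] := CB z Cz.
  apply: filterS (near_str C0z) => u [C0u zu] Cu.
  have [[Bu _] _] := CB u Cu.
  apply/idP/idP => [|ks]; first exact: fle_trans.
  case: (cover (str u)) => //; first exact/(boundary_str C0u).
  (* Only the center is below both [s0] and its antipode, so near any other point of [B] the two
     cones do not mix. *)
  move=> us; exfalso; apply: zc; apply/rowP => i.
  have := strP z i; case E: (str z i) => [b|]; last by move=> ->; rewrite mxE ffunE.
  move/fleP: (ks) => /(_ _ _ E); move/fleP: (fle_trans zu us) => /(_ _ _ E).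
  by rewrite !ffunE => -[<-] []; case: (s0 i).
(* The squares that separate [s0] and its antipode from their neighbors in direction 0 lie in [B],
   and give a point of [C] on each cone. *)
pose sq (s : octant) : face := [ffun i => if i == ord0 then None else Some (s i)].
have sqs s : fle (sq s) (oface s).
  by apply/fleP => i b; rewrite !ffunE; case: eqP.
have sqf s : fle (sq s) (oface (flip s ord0)).
  by apply: fle_flip => //; rewrite ffunE eqxx.
have meet s : ~~ occ s -> occ (flip s ord0) -> exists2 y, C y & str y = sq s.
  move=> ns os; have [y [+ Cy Ey]] := near_stratum (center_fle (sq s)) nC.
  move=> yC; exists y => //; apply: yC.
    apply/(boundary_str Cy); rewrite Ey; apply: contrapT => nB.
    by move: ns; rewrite (free_occ nB (sqs s) (sqf s)) os.
  move=> Ec; move: Ey; rewrite Ec str_mid => /ffunP/(_ (inord 1)).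
  by rewrite !ffunE -val_eqE /= inordK.
have [y Cy Ey] : exists2 y, C y & str y = sq s0.
  apply: meet => //; apply: oth => /ffunP.
    by move=> /(_ ord0); rewrite !ffunE eqxx; case: (s0 _).
  by move=> /(_ (inord 1)); rewrite !ffunE -val_eqE /= inordK//; case: (s0 _).
have [z Cz Ez] : exists2 y, C y & str y = sq (antipode s0).
  apply: meet => //; apply: oth => /ffunP.
    by move=> /(_ (inord 1)); rewrite !ffunE -val_eqE /= inordK//; case: (s0 _).
  by move=> /(_ ord0); rewrite !ffunE eqxx; case: (s0 _).
have := kc y z Cy Cz; rewrite /k Ey Ez sqs => /esym/fleP/(_ (inord 1) (~~ s0 (inord 1))).
rewrite !ffunE -val_eqE /= inordK// => /(_ erefl)[].
by case: (s0 _).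
Qed.

End LocalRegion.

(** * Sets of octants whose link is a disk *)

Section OctantPatterns.

Local Notation tern := (bool -> bool -> bool -> bool).

(** Octants and faces become plain Boolean triples, so that the check of the 256 patterns evaluates
    by computation. *)
Definition allb (P : bool -> bool) := P true && P false.
Definition exb (P : bool -> bool) := P true || P false.
Definition sumo (F : option bool -> nat) : nat := (F None + F (Some true) + F (Some false))%N.
Definition all3 (P : tern) := allb (fun a => allb (fun b => allb (fun c => P a b c))).
Definition ex3 (P : tern) := exb (fun a => exb (fun b => exb (fun c => P a b c))).
Definition fits (x : option bool) (a : bool) := if x is Some b then b == a else true.
Definition hit3 (g : tern) x y z :=
  ex3 (fun a b c => [&& fits x a, fits y b, fits z c & g a b c]).
Definition dim3 (x y z : option bool) : nat :=
  ((x == None) + (y == None) + (z == None))%N.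
Definition count3 (g : tern) k : nat :=
  sumo (fun x => sumo (fun y => sumo (fun z => (dim3 x y z == k) && hit3 g x y z : nat))).

Definition sep3 (g k : tern) := all3 (fun a b c =>
  [&& g a b c && g (~~ a) b c ==> (k a b c == k (~~ a) b c),
      g a b c && g a (~~ b) c ==> (k a b c == k a (~~ b) c)
    & g a b c && g a b (~~ c) ==> (k a b c == k a b (~~ c))]).
Definition cst3 (g k : tern) := all3 (fun a b c => all3 (fun a' b' c' =>
  g a b c && g a' b' c' ==> (k a b c == k a' b' c'))).

Definition of_seq (l : seq bool) : tern :=
  fun a b c => nth false l (4 * a + 2 * b + c)%N.
Fixpoint bitseqs n : seq (seq bool) :=
  if n is m.+1 then [seq true :: l | l <- bitseqs m] ++ [seq false :: l | l <- bitseqs m]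
  else [:: [::]].
Definition conn3 (g : tern) :=
  all (fun l => sep3 g (of_seq l) ==> cst3 g (of_seq l)) (bitseqs 8).

(** The link of the center is an octahedron whose triangles are the octants; this forbids a vertex
    at which the occupied triangles are just two opposite ones. *)
Definition diag3 (g : tern) := all3 (fun a b c =>
  [&& ~~ [&& g a b c, g a (~~ b) (~~ c), ~~ g a (~~ b) c & ~~ g a b (~~ c)],
      ~~ [&& g a b c, g (~~ a) b (~~ c), ~~ g (~~ a) b c & ~~ g a b (~~ c)]
    & ~~ [&& g a b c, g (~~ a) (~~ b) c, ~~ g (~~ a) b c & ~~ g a (~~ b) c]]).
Definition annulus3 (g : tern) := all3 (fun a b c =>
  ~~ g a b c && ~~ g (~~ a) (~~ b) (~~ c) ==>
  ex3 (fun a' b' c' => [&& (a', b', c') != (a, b, c),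
    (a', b', c') != (~~ a, ~~ b, ~~ c) & ~~ g a' b' c'])).

(** Without pinched vertices, distinct components of empty triangles have no common vertex, so two
    of them use up the six vertices and are opposite triangles. [annulus3] excludes this case, and a
    single hole leaves a disk. The equation is its Euler characteristic, as [count3 g k] counts link
    cells of dimension 2 - k. *)
Definition disk3 (g : tern) :=
  [&& ex3 g, ex3 (fun a b c => ~~ g a b c), diag3 g, conn3 g & annulus3 g] ==>
  (count3 g 2 + count3 g 0 == count3 g 1 + 1)%N && conn3 (fun a b c => ~~ g a b c).

Lemma disk3_check : all (fun l => disk3 (of_seq l)) (bitseqs 8).
Proof. by vm_compute. Qed.

Definition to_seq (g : tern) : seq bool :=
  [:: g false false false; g false false true; g false true false; g false true true;
      g true false false; g true false true; g true true false; g true true true].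

Lemma to_seqK g a b c : of_seq (to_seq g) a b c = g a b c.
Proof. by case: a; case: b; case: c. Qed.

Lemma mem_bitseqs n (l : seq bool) : size l = n -> l \in bitseqs n.
Proof.
elim: n l => [|n IH] [|b l] //= [sl]; rewrite mem_cat.
by case: b; rewrite (map_f _ (IH _ sl)) ?orbT.
Qed.

Lemma disk3P g : disk3 g.
Proof.
have <- : of_seq (to_seq g) = g.
  by apply/funext => a; apply/funext => b; apply/funext => c; exact: to_seqK.
by move/allP: disk3_check; apply; exact: mem_bitseqs.
Qed.

Lemma all3P (P : tern) : reflect (forall a b c, P a b c) (all3 P).
Proof.
apply: (iffP idP) => [|Q]; last by rewrite /all3 /allb !Q.
rewrite /all3 /allb => /andP[/andP[/andP[? ?] /andP[? ?]] /andP[/andP[? ?] /andP[? ?]]].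
by move=> [] [] [].
Qed.

Lemma ex3P (P : tern) : reflect (exists a b c, P a b c) (ex3 P).
Proof.
apply: (iffP idP) => [|[a [b [c Q]]]]; last first.
  by move: Q; case: a; case: b; case: c => Q; rewrite /ex3 /exb Q ?orbT.
by move=> /orP[/orP[/orP[|]|/orP[|]]|/orP[/orP[|]|/orP[|]]] Q; do 3 eexists; exact: Q.
Qed.

Lemma conn3P g : reflect (forall k : tern, sep3 g k -> forall a b c a' b' c',
  g a b c -> g a' b' c' -> k a b c = k a' b' c') (conn3 g).
Proof.
apply: (iffP allP) => [Q k sk a b c a' b' c' ga ga'|Q l _].
  have : cst3 g (of_seq (to_seq k)).
    have /implyP := Q (to_seq k) (mem_bitseqs (l := to_seq k) erefl); apply.
    suff -> : of_seq (to_seq k) = k by [].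
    by apply/funext => ?; apply/funext => ?; apply/funext => ?; exact: to_seqK.
  move=> /all3P/(_ a b c)/all3P/(_ a' b' c'); rewrite ga ga' !to_seqK.
  by move=> /eqP.
apply/implyP => sk; apply/all3P => a b c; apply/all3P => a' b' c'.
by apply/implyP => /andP[ga ga']; apply/eqP; exact: Q.
Qed.

Definition oc (a b c : bool) : octant := [ffun i : 'I_3 => nth false [:: a; b; c] i].
Definition fc (x y z : option bool) : face := [ffun i : 'I_3 => nth None [:: x; y; z] i].

Lemma oc_surj (s : octant) : exists a b c, s = oc a b c.
Proof.
exists (s ord0), (s (inord 1)), (s (inord 2)); apply/ffunP.
by apply: forall_ord3; rewrite ffunE ?inordK.
Qed.

Lemma fc_surj (f : face) : f = fc (f ord0) (f (inord 1)) (f (inord 2)).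
Proof. by apply/ffunP; apply: forall_ord3; rewrite [RHS]ffunE ?inordK. Qed.

Lemma flip_oc a b c : [/\ flip (oc a b c) ord0 = oc (~~ a) b c,
  flip (oc a b c) (inord 1) = oc a (~~ b) c & flip (oc a b c) (inord 2) = oc a b (~~ c)].
Proof.
by split; apply/ffunP; apply: forall_ord3; rewrite !ffunE -?val_eqE /= ?inordK.
Qed.

Lemma antipode_oc a b c : antipode (oc a b c) = oc (~~ a) (~~ b) (~~ c).
Proof. by apply/ffunP; apply: forall_ord3; rewrite !ffunE ?inordK. Qed.

Lemma fle_fc x y z a b c :
  fle (fc x y z) (oface (oc a b c)) = [&& fits x a, fits y b & fits z c].
Proof.
apply/fleP/and3P => [Q|[xa yb zc]].
  have ft (i : 'I_3) : fits (fc x y z i) (oc a b c i).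
    by case E: (fc x y z i) => [d|] //=; have := Q _ _ E; rewrite ffunE => -[->].
  have := ft ord0; have := ft (inord 1); have := ft (inord 2).
  by rewrite !ffunE !inordK.
by apply: forall_ord3 => d; rewrite !ffunE ?inordK //= => E; congr Some; apply/esym/eqP;
  [move: xa|move: yb|move: zc]; rewrite /= E.
Qed.

Lemma dim_fc x y z : face_dim (fc x y z) = dim3 x y z.
Proof.
rewrite /face_dim -sum1_card big_mkcond !big_ord_recl big_ord0 /= addn0.
by rewrite !inE !ffunE /= addnA; case: x; case: y; case: z.
Qed.

Definition hit (g : octant -> bool) (f : face) := [exists s, fle f (oface s) && g s].

Lemma hit_fc g x y z : hit g (fc x y z) = hit3 (fun a b c => g (oc a b c)) x y z.
Proof.
apply/existsP/ex3P => [[s]|[a [b [c /and4P[xa yb zc gs]]]]].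
  have [a [b [c ->]]] := oc_surj s; rewrite fle_fc -!andbA => Q; by exists a, b, c.
by exists (oc a b c); rewrite fle_fc xa yb zc.
Qed.

Lemma sum_obool (F : option bool -> nat) : (\sum_x F x = sumo F)%N.
Proof.
rewrite (bigD1 None)// (bigD1 (Some true))// (bigD1 (Some false))//= big1 ?addn0 ?addnA//.
by case=> [[]|].
Qed.

(* The number of cells of dimension 2 - k of the link of the center: they are the
   traces of the dual cells of the faces f of dimension k. *)
Definition count_hit (g : octant -> bool) k : nat :=
  \sum_(f : face) ((face_dim f == k) && hit g f : nat).

Lemma count_hit_fc g k : count_hit g k = count3 (fun a b c => g (oc a b c)) k.
Proof.
rewrite /count_hit (reindex (fun p : option bool * option bool * option bool =>
  fc p.1.1 p.1.2 p.2)); last first.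
  exists (fun f : face => (f ord0, f (inord 1), f (inord 2))).
    by move=> [[x y] z] _; rewrite !ffunE !inordK.
  by move=> f _; rewrite -fc_surj.
rewrite -(pair_bigA _ (fun p z => ((face_dim (fc p.1 p.2 z) == k) && hit g (fc p.1 p.2 z) : nat))).
rewrite -(pair_bigA _ (fun x y => \sum_z ((face_dim (fc x y z) == k) && hit g (fc x y z) : nat)))%N.
rewrite /count3 -sum_obool; apply: eq_bigr => x _; rewrite -sum_obool; apply: eq_bigr => y _.
by rewrite -sum_obool; apply: eq_bigr => z _; rewrite dim_fc hit_fc.
Qed.

(** If the two other octants around the half-edge were empty, no flip would join occupied ones, and
    every [k] would be admissible; coordinate i, taken as [k], separates [s] from the opposite
    octant. *)
Lemma no_diagonal (g : octant -> bool) :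
  (forall f (k : octant -> bool),
    (forall s i, fle f (oface s) -> f i = None -> g s -> g (flip s i) -> k (flip s i) = k s) ->
    forall s s', fle f (oface s) -> fle f (oface s') -> g s -> g s' -> k s = k s') ->
  forall s i j, i != j ->
  ~~ [&& g s, g (flip (flip s i) j), ~~ g (flip s i) & ~~ g (flip s j)].
Proof.
move=> gc s i j ij; apply/negP => /and4P[gs gij /negP ngi /negP ngj].
pose f : face := [ffun l => if (l == i) || (l == j) then None else Some (s l)].
have fs : fle f (oface s) by apply/fleP => l b; rewrite !ffunE; case: ifP.
have fi : f i = None by rewrite ffunE eqxx.
have fj : f j = None by rewrite ffunE eqxx orbT.
have : s i = flip (flip s i) j i.
  apply: (gc f (fun u => u i)) => // [u l fu fl gu gul|]; last first.
    by apply: fle_flip => //; exact: fle_flip.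
  exfalso.
  have uE (v : octant) : v i = u i -> v j = u j ->
      (forall m, m != i -> m != j -> v m = s m) -> v = u.
    move=> vi vj vm; apply/ffunP => m; have [->//|mi] := eqVneq m i.
    have [->//|mj] := eqVneq m j; rewrite vm//.
    by move/fleP: fu => /(_ m (s m)); rewrite !ffunE (negPf mi) (negPf mj) => /(_ erefl)[].
  have lij : (l == i) || (l == j) by move: fl; rewrite ffunE; case: ifP.
  have ji : (j == i) = false by rewrite eq_sym (negPf ij).
  have [] : [\/ u = s, u = flip s i, u = flip s j | u = flip (flip s i) j].
    have [ei|ni] := eqVneq (u i) (s i); have [ej|nj] := eqVneq (u j) (s j).
    - by constructor 1; apply/esym/uE.
    - constructor 3; apply/esym/uE; rewrite ?ffunE ?eqxx ?(negPf ij)//.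
        by move: nj; case: (u j); case: (s j).
      by move=> m mi mj; rewrite ffunE (negPf mj).
    - constructor 2; apply/esym/uE; rewrite ?ffunE ?eqxx ?ji//.
        by move: ni; case: (u i); case: (s i).
      by move=> m mi mj; rewrite ffunE (negPf mi).
    - constructor 4; apply/esym/uE; rewrite ?ffunE ?eqxx ?ji ?(negPf ij) ?ffunE ?eqxx ?ji//.
      + by move: ni; case: (u i); case: (s i).
      + by move: nj; case: (u j); case: (s j).
      by move=> m mi mj; rewrite ffunE (negPf mj) ffunE (negPf mi).
  - by move=> E; move: gul; rewrite E; case/orP: lij => /eqP ->.
  - by move=> E; move: gu; rewrite E.
  - by move=> E; move: gu; rewrite E.
  - move=> E; move: gul; rewrite E; case/orP: lij => /eqP ->; last by rewrite flipK.
    suff -> : flip (flip (flip s i) j) i = flip s j by [].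
    apply/ffunP => m; rewrite !ffunE; have [->|] := eqVneq m i; last by [].
    by rewrite (negPf ij) negbK.
by rewrite !ffunE eqxx (negPf ij); case: (s i).
Qed.

(** The third hypothesis gives connectedness when taken at the center, and the absence of pinched
    vertices when taken at faces with two free coordinates. *)
Lemma disk_pattern (g : octant -> bool) :
  (exists s, g s) -> (exists s, ~~ g s) ->
  (forall f (k : octant -> bool),
    (forall s i, fle f (oface s) -> f i = None -> g s -> g (flip s i) -> k (flip s i) = k s) ->
    forall s s', fle f (oface s) -> fle f (oface s') -> g s -> g s' -> k s = k s') ->
  (forall s0, ~~ g s0 -> ~~ g (antipode s0) ->
    exists s, [/\ s <> s0, s <> antipode s0 & ~~ g s]) ->
  (count_hit g 2 + count_hit g 0 = count_hit g 1 + 1)%N /\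
  (forall k : octant -> bool,
    (forall s i, ~~ g s -> ~~ g (flip s i) -> k (flip s i) = k s) ->
    forall s s', ~~ g s -> ~~ g s' -> k s = k s').
Proof.
move=> g1 g0 gc ga; pose h a b c := g (oc a b c).
have := disk3P h; rewrite /disk3 -!(count_hit_fc g).
have -> : [&& ex3 h, ex3 (fun a b c => ~~ h a b c), diag3 h, conn3 h & annulus3 h].
  apply/and5P; split.
  - by apply/ex3P; have [s] := g1; have [a [b [c ->]]] := oc_surj s; exists a, b, c.
  - by apply/ex3P; have [s] := g0; have [a [b [c ->]]] := oc_surj s; exists a, b, c.
  - apply/all3P => a b c; have nd := no_diagonal gc (oc a b c).
    have [e0 e1 e2] := flip_oc a b c.
    have [_ f1 f2] := flip_oc (~~ a) b c; have [_ _ f3] := flip_oc a (~~ b) c.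
    have n01 : ord0 != inord 1 :> 'I_3 by rewrite -val_eqE /= inordK.
    have n02 : ord0 != inord 2 :> 'I_3 by rewrite -val_eqE /= inordK.
    have n12 : inord 1 != inord 2 :> 'I_3 by rewrite -val_eqE /= !inordK.
    have := nd _ _ n01; have := nd _ _ n02; have := nd _ _ n12.
    by rewrite e0 e1 e2 f1 f2 f3 /h => -> -> ->.
  - apply/conn3P => k3 /all3P sk a b c a' b' c' ha ha'.
    pose k (s : octant) := k3 (s ord0) (s (inord 1)) (s (inord 2)).
    have kE x y z : k (oc x y z) = k3 x y z by rewrite /k !ffunE !inordK.
    rewrite -!kE; apply: (gc center_face) => //; try exact: center_fle.
    move=> s i _ _; have [x [y [z ->]]] := oc_surj s.
    have [e0 e1 e2] := flip_oc x y z; have /and3P[s0 s1 s2] := sk x y z.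
    move: i; apply: forall_ord3; rewrite ?e0 ?e1 ?e2 !kE => g1' g2'.
    + by move: s0; rewrite /h g1' g2' => /eqP.
    + by move: s1; rewrite /h g1' g2' => /eqP.
    + by move: s2; rewrite /h g1' g2' => /eqP.
  - apply/all3P => a b c; apply/implyP => /andP[n1 n2].
    have [||s [s1 s2 ns]] := ga (oc a b c) => //; first by rewrite antipode_oc.
    have [x [y [z E]]] := oc_surj s; apply/ex3P; exists x, y, z.
    apply/and3P; split; last by rewrite /h -E.
      by apply/eqP => -[ex ey ez]; apply: s1; rewrite E ex ey ez.
    by apply/eqP => -[ex ey ez]; apply: s2; rewrite E antipode_oc ex ey ez.
rewrite implyTb => /andP[/eqP chi /conn3P cn]; split=> // k Hk s s'.
have [a [b [c ->]]] := oc_surj s; have [a' [b' [c' ->]]] := oc_surj s' => ns ns'.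
apply: (cn (fun x y z => k (oc x y z))) => //.
apply/all3P => x y z; have [e0 e1 e2] := flip_oc x y z.
apply/and3P; split; apply/implyP => /andP[n1 n2]; apply/eqP/esym.
- by rewrite -e0; apply: Hk; rewrite ?e0.
- by rewrite -e1; apply: Hk; rewrite ?e1.
- by rewrite -e2; apply: Hk; rewrite ?e2.
Qed.

End OctantPatterns.

(** * Cubical complexes and the local structure of M1 at a cube *)

Section CubeGeometry.
Variable K : realType.
Local Notation V := 'rV[K]_3.

Lemma bool_neq_half (b : bool) : b%:R <> 2^-1 :> K.
Proof. by case: b => /= ?; lra. Qed.

Lemma unit_cube_compact : compact (@unit_cube K).
Proof.
have -> : @unit_cube K = [set v : V | forall i, `[0, 1]%classic (v ord0 i)].
  by apply/seteqP; split=> x H i; have := H i; rewrite /= in_itv.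
by apply: (@rV_compact K 3 (fun=> `[0, 1]%classic)) => i; exact: segment_compact.
Qed.

Lemma open_unit_cubeW (x : V) : open_unit_cube x -> unit_cube x.
Proof. by move=> H i; have /andP[? ?] := H i; rewrite !ltW. Qed.

Lemma open_unit_cube_nbhs (x : V) : open_unit_cube x -> nbhs x (@open_unit_cube K).
Proof. by move=> /near_str; apply: filterS => y []. Qed.

Lemma dual_set_unit g (x : V) : @dual_set K g x -> unit_cube x.
Proof.
move=> H i; have := H i; case: (g i) => [[]|].
- by move=> /andP[? ?]; apply/andP; split; lra.
- by move=> /andP[? ?]; apply/andP; split; lra.
- by move=> ->; apply/andP; split; lra.
Qed.

Lemma cube_move_unit h (x : V) : unit_cube x -> unit_cube (cube_move h x).
Proof.
move=> H i; rewrite mxE; have /andP[? ?] := H (h.1 i).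
by case: ifP => _; apply/andP; split; lra.
Qed.

Lemma face_dim_lt3 (f : face) : (face_dim f < 3)%N -> exists i b, f i = Some b.
Proof.
move=> f3; apply: contrapT => n; move: f3; rewrite ltnNge => /negP; apply.
rewrite /face_dim -{1}(card_ord 3); apply: subset_leq_card.
apply/fintype.subsetP => i _; rewrite inE; case E: (f i) => [b|] //.
by case: n; exists i, b.
Qed.

Definition face_center (f : face) : V :=
  \row_i (if f i is Some b then b%:R else 2^-1).

Lemma face_center_in f : face_set f (face_center f).
Proof.
split=> [i|i b fi]; last by rewrite mxE fi.
by rewrite mxE; case: (f i) => [[]|] /=; apply/andP; split; lra.
Qed.

End CubeGeometry.

Section ComplexGeometry.
Variables (K : realType) (N : nat) (R : cubical_complex K N).
Local Notation V := 'rV[K]_3.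
Implicit Types (c d v w : cube R).

Lemma chart_cont c : {within @unit_cube K, continuous (@chart K N R c)}.
Proof. by case: (chart_pl c). Qed.

Lemma chart_injective c (x y : V) : unit_cube x -> unit_cube y ->
  chart c x = chart c y -> x = y.
Proof. exact: chart_inj. Qed.

Lemma glue_at c d (x y : V) : c != d -> unit_cube x -> unit_cube y ->
  chart c x = chart d y -> exists f h, [/\ (face_dim f < 3)%N,
    glued (chart c) (chart d) f h, face_set f x & y = cube_move h x].
Proof.
move=> cd x1 y1 E; have [|f [h [f3 gl]]] := chart_glue cd; first by exists x, y.
by exists f, h; have [/(_ E)[? ?] _] := gl x y x1 y1.
Qed.

(** A point shared with another cube lies in a proper face, so one of its coordinates is 0 or 1. *)
Lemma open_cube_unique c d (x y : V) : open_unit_cube x -> unit_cube y ->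
  chart c x = chart d y -> d = c /\ y = x.
Proof.
move=> x1 y1 E; have [cd|cd] := eqVneq c d.
  rewrite -cd in E *; split=> //.
  by apply/esym/(chart_injective (c:=c)) => //; exact: open_unit_cubeW.
have [f [h [f3 _ [_ fx] _]]] := glue_at cd (open_unit_cubeW x1) y1 E.
have [i [b /fx xi]] := face_dim_lt3 f3.
by have := x1 i; rewrite xi; case: b {xi}; rewrite /= ltxx ?andbF.
Qed.

(** A cell may be named from several cubes. The center of [f] has coordinate 1/2 in the free
    directions, gluing isometries preserve this value, and [g] cannot fix the corresponding
    directions. *)
Lemma cell_dim_le c d f g : cell c f `<=` cell d g -> (face_dim f <= face_dim g)%N.
Proof.
move=> sub; have fc := @face_center_in K f.
have [y [y1 gy] Ey] : cell d g (chart c (face_center K f)) by apply: sub; exists (face_center K f).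
have [s ys] : exists s : 'S_3, forall i, f (s i) = None -> y ord0 i = 2^-1.
  have [cd|cd] := eqVneq c d.
    exists 1%g => i; rewrite perm1 => fi; rewrite -cd in Ey.
    by rewrite (chart_injective y1 fc.1 Ey) mxE fi.
  have [_ [h [_ _ _ ->]]] := glue_at cd fc.1 y1 (esym Ey).
  by exists h.1 => i fi; rewrite !mxE fi; case: ifP => _; lra.
rewrite /face_dim -(fintype.card_image (@perm_inj _ s^-1%g) [pred i | f i == None]).
apply: subset_leq_card; apply/fintype.subsetP => i /fintype.imageP[j]; rewrite !inE => /eqP fj ij.
have fi : f (s i) = None by rewrite ij permKV.
case E: (g i) => [b|] //; by have := ys i fi; rewrite (gy _ _ E) => /bool_neq_half.
Qed.

Lemma cube_set_closed c : closed (@cube_set K N R c).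
Proof.
apply: compact_closed; first exact: row_hausdorff.
by apply: continuous_compact; [exact: chart_cont|exact: unit_cube_compact].
Qed.

Lemma near_cubes (p : 'rV[K]_N) :
  nbhs p [set q | forall d : cube R, cube_set d q -> cube_set d p].
Proof.
apply: (@filter_forall _ (cube R) (fun d q => cube_set d q -> cube_set d p) (nbhs p) _) => d.
have [pd|npd] := pselect (cube_set d p).
  exact: filterE.
have : nbhs p (~` cube_set d).
  by apply: open_nbhs_nbhs; split=> //; apply: closed_openC; exact: cube_set_closed.
by apply: filterS => q.
Qed.

Lemma dual_complex_carrier : dual_complex R `<=` carrier R.
Proof.
move=> p [c [f [_ [d [g [_ [x gx <-]]]]]]].
by exists d; exists x => //; exact: dual_set_unit gx.
Qed.

Lemma chart_nbhs c (x : V) (P : set 'rV[K]_N) : open_unit_cube x ->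
  nbhs (chart c x) P -> nbhs x [set y | P (chart c y)].
Proof.
move=> x1 /nbhs_norm_ltP[e e0 He].
have [d d0 Hd] := (within_contP _ _).1 (@chart_cont c) x (open_unit_cubeW x1) _ e0.
have : nbhs x [set y | `|x - y| < d] by apply/nbhs_norm_ltP; exists d.
apply: filterS2 (open_unit_cube_nbhs x1) => y y1 xy; apply: He; apply: Hd => //.
exact: open_unit_cubeW.
Qed.

Lemma chart_inverse c : exists2 G : 'rV[K]_N -> V,
  forall x, unit_cube x -> G (chart c x) = x & {within cube_set c, continuous G}.
Proof.
apply: compact_inverse; [exact: unit_cube_compact|exact: chart_cont|].
exact: chart_injective.
Qed.

Lemma chart_open c (x : V) (W : set V) : open_unit_cube x -> nbhs x W ->
  nbhs (chart c x) [set q | carrier R q ->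
    exists y, [/\ W y, open_unit_cube y & chart c y = q]].
Proof.
move=> x1 nW.
have [e e0 He] := (nbhs_norm_ltP _ _).1 (filterI nW (open_unit_cube_nbhs x1)).
have [d d0 Hd] := compact_injective_modulus (@unit_cube_compact K)
  (@chart_cont c) (chart_injective (c:=c)) e0.
have : nbhs (chart c x) [set q | `|chart c x - q| < d] by apply/nbhs_norm_ltP; exists d.
apply: filterS2 (near_cubes (chart c x)) => q Hq xq [a aq].
have [y y1 Ey] := Hq a aq; have [ac _] := open_cube_unique x1 y1 (esym Ey).
rewrite ac in aq; have [z z1 zq] := aq; exists z.
have [|? ?] := He z; last by split.
by apply: Hd => //; rewrite ?zq//; exact: open_unit_cubeW.
Qed.

End ComplexGeometry.

(** * The trace of the manifold on an open cube *)

Section LocalStructure.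
Variables (K : realType) (N : nat) (R : cubiculated_region K N).
Variable S : embedded_discrete_surface R.
Variable M : set 'rV[K]_N.
Hypothesis Msub : M `<=` dual_complex R.
Hypothesis Mcompact : compact M.
Hypothesis Mman : manifold K 3 M.
Hypothesis Mbd : manifold_boundary K 3 M = range (psi S).
Local Notation V := 'rV[K]_3.
Local Notation B := (range (psi S)).

Lemma boundary_sub : B `<=` M.
Proof. by rewrite -Mbd => p []. Qed.

Lemma interior_of p : M p -> ~ B p -> manifold_interior K 3 M p.
Proof. by rewrite -Mbd => Mp nB; apply: contrapT => nI; apply: nB; split. Qed.

Lemma interior_not_boundary p : manifold_interior K 3 M p -> M p /\ ~ B p.
Proof. by rewrite -Mbd => Ip; split=> [|[_]//]; case: Ip. Qed.

Lemma M_closed : closed M.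
Proof. by apply: compact_closed => //; exact: row_hausdorff. Qed.

Lemma M_carrier : M `<=` carrier R.
Proof. by move=> p /Msub/dual_complex_carrier. Qed.

(** [psi_cells] may describe a cell of the surface from any cube; here the dual cells contained in
    the surface are named from [v]. *)
Definition surface_faces (v : cube R) : set face := [set g | exists (c : cube R) f,
  [/\ has_dual c f, (1 <= face_dim f)%N, cell v g = cell c f & dual_cell c f `<=` B]].

Lemma surface_facesP (v : cube R) (x : V) : unit_cube x -> B (chart v x) ->
  exists (d : cube R) g (y : V), [/\ surface_faces d g, dual_set g y & chart d y = chart v x].
Proof.
move=> x1; have [F [HF BE]] := psi_cells S.
rewrite BE => -[[c f] Fcf /= [d [g [cg [y gy Ey]]]]].
have [? ?] := HF _ Fcf; exists d, g, y; split=> //; exists c, f; split=> //.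
by move=> q qcf; rewrite BE; exists (c, f).
Qed.

Lemma surface_faces_sub (v : cube R) g (x : V) :
  surface_faces v g -> dual_set g x -> B (chart v x).
Proof. by move=> [c [f [_ _ E sub]]] gx; apply: sub; exists v, g; split=> //; exists x. Qed.

Lemma interior_chart (v : cube R) (x : V) (O : set 'rV[K]_N) : unit_cube x ->
  manifold_interior K 3 M (chart v x) -> nbhs (chart v x) O ->
  M `&` O `<=` cube_set v -> nbhs x [set y | unit_cube y /\ M (chart v y)].
Proof.
move=> x1 Ix nO MO.
apply: (interior_parametrized (@unit_cube_compact K) (@chart_cont _ _ _ v)
  (chart_injective (c:=v)) (O := O°)) => //.
- exact: open_interior.
- by move=> p [Mp /interior_subset Op]; exact: MO.
Qed.

(** A point of an open cube is in no other cube, so near it [M] is seen in a single chart. Openness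
    off [B] comes from [interior_chart], its failure on [B] from [boundary_parametrized], and the
    last two clauses from connected sets pulled back by the inverse chart. *)
Lemma local_region_at (v : cube R) : local_region
  [set x : V | M (chart v x)] [set x : V | B (chart v x)] (surface_faces v).
Proof.
have [G GE cG] := chart_inverse v.
split.
- by move=> x _; exact: boundary_sub.
- move=> x x1 nM; apply: (chart_nbhs x1 (P := ~` M)).
  by apply: open_nbhs_nbhs; split=> //; apply: closed_openC; exact: M_closed.
- move=> x x1 Mx nB; have Ix := interior_of Mx nB.
  apply: filterS (interior_chart (open_unit_cubeW x1) Ix (near_cubes R (chart v x)) _).
    by move=> y [].
  move=> q [/M_carrier[a aq] /(_ a aq)[y y1 Ey]].
  by have [<- _] := open_cube_unique x1 y1 (esym Ey).
- move=> x x1 Bx nX.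
  have bp : manifold_boundary K 3 M (chart v x) by rewrite Mbd.
  have := boundary_parametrized (@chart_cont _ _ _ v)
    (chart_injective (c:=v)) Mman bp (open_unit_cubeW x1); apply.
  by apply: filterS2 (open_unit_cube_nbhs x1) nX => y /open_unit_cubeW.
- move=> x x1; split=> [/(surface_facesP (open_unit_cubeW x1))|[g]].
    move=> [d [g [y [dg gy E]]]].
    have [dv yx] := open_cube_unique x1 (dual_set_unit gy) (esym E).
    by rewrite dv yx in dg gy *; exists g.
  exact: surface_faces_sub.
- move=> g [c [f [_ f1 E _]]]; apply: leq_trans f1 _.
  by apply: (@cell_dim_le _ _ _ c v); rewrite E.
- move=> x W x1 Bx nW.
  have bp : manifold_boundary K 3 M (chart v x) by rewrite Mbd.
  have [C [cC CO nC]] := boundary_interior_connected Mman bp (chart_open v x1 nW).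
  have Cv q : C q -> exists y, [/\ W y, open_unit_cube y & chart v y = q].
    move=> /CO[/interior_not_boundary[Mq _]]; apply; exact: M_carrier.
  exists (G @` C); split.
  + apply: connected_continuous_connected cC _; apply: continuous_subspaceW cG.
    by move=> q /Cv[y [_ /open_unit_cubeW y1 <-]]; exists y.
  + move=> _ [q Cq <-]; have [y [Wy y1 Ey]] := Cv q Cq.
    have [/interior_not_boundary[Mq nBq] _] := CO q Cq.
    by rewrite -Ey GE ?Ey; [split; [split; rewrite /= Ey|]|exact: open_unit_cubeW].
  have := chart_nbhs x1 nC; apply: filterS2 (open_unit_cube_nbhs x1) => y y1 Hy My P nP.
  have [q [Cq]] := Hy My _ (chart_open v y1 nP).
  have [/interior_not_boundary[Mq _] _] := CO q Cq.
  move=> /(_ (M_carrier Mq))[z [Pz z1 Ez]]; exists z; split=> //.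
  by exists q => //; rewrite -Ez GE//; exact: open_unit_cubeW.
- move=> x W x1 Bx nW.
  have bp : manifold_boundary K 3 M (chart v x) by rewrite Mbd.
  have [C [cC CO nC]] := boundary_punctured_connected Mman bp (chart_open v x1 nW).
  rewrite Mbd in CO nC.
  have Cv q : C q -> exists y, [/\ W y, open_unit_cube y & chart v y = q].
    by move=> /CO[[Bq + _]]; apply; apply: M_carrier; exact: boundary_sub.
  exists (G @` C); split.
  + apply: connected_continuous_connected cC _; apply: continuous_subspaceW cG.
    by move=> q /Cv[y [_ /open_unit_cubeW y1 <-]]; exists y.
  + move=> _ [q Cq <-]; have [y [Wy y1 Ey]] := Cv q Cq.
    have [[Bq _] qx] := CO q Cq.
    rewrite -Ey GE ?Ey; last exact: open_unit_cubeW.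
    split; first by split=> //; rewrite /= Ey.
    by move=> /= yx; apply: qx; rewrite /= -Ey yx.
  have := chart_nbhs x1 nC; apply: filterS2 (open_unit_cube_nbhs x1) => y y1 Hy By yx.
  exists (chart v y); last by rewrite GE//; exact: open_unit_cubeW.
  apply: Hy => // E; apply: yx; apply: (chart_injective (c:=v)) => //; exact: open_unit_cubeW.
Qed.

End LocalStructure.

(** * Crossing the facets of the cubes of R *)

Section Flags.
Variable K : realType.
Local Notation V := 'rV[K]_3.
Implicit Types f g : face.

Lemma near_bit (b : bool) (t : K) : 0 <= t <= 1 -> t != b%:R -> `|b%:R - t| < 4^-1 ->
  0 < t < 1 /\ (if b then 2^-1 < t else t < 2^-1).
Proof.
rewrite ltr_norml => /andP[t0 t1]; case: b => /= [t1'|t0'] /andP[? ?].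
  have : t < 1 by rewrite lt_neqAle t1' t1.
  by move=> ?; split; [apply/andP; split|]; lra.
have : 0 < t by rewrite lt_neqAle eq_sym t0' t0.
by move=> ?; split; [apply/andP; split|]; lra.
Qed.

Lemma bit_push (b : bool) (r : K) : 0 < r ->
  ~ (0 <= b%:R + (-1) ^+ (~~ b) * (r / 2) <= 1).
Proof. by move=> r0; case: b => /=; rewrite ?expr0 ?expr1 => /andP[? ?]; lra. Qed.

Lemma near_quarter (b : bool) (t : K) : `|(if b then 3 / 4 else 4^-1) - t| < 4^-1 ->
  0 < t < 1 /\ (if b then 2^-1 < t else t < 2^-1).
Proof.
by rewrite ltr_norml; case: b => /andP[? ?]; split; [apply/andP; split| |apply/andP; split|]; lra.
Qed.

(* A point of the facet (i, f i), in the relative interior of the trace on that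
   facet of the dual cell of f. *)
Definition facet_pt (f : face) (i : 'I_3) : V :=
  \row_j (if j == i then (odflt false (f i))%:R else mid K f ord0 j).

Lemma facet_pt_unit f i : unit_cube (facet_pt f i).
Proof.
move=> j; rewrite !mxE; case: eqP => _; last by case: (f j) => [[]|]; apply/andP; split; lra.
by case: (f i) => [[]|] /=; apply/andP; split; lra.
Qed.

(** The flag is read off the point: [i] marks the only coordinate equal to 0 or 1, and the others,
    equal to 1/4, 1/2 or 3/4, give back the rest of [f]. *)
Lemma facet_pt_inj f i g j : f i <> None -> g j <> None ->
  facet_pt f i = facet_pt g j -> f = g /\ i = j.
Proof.
move=> fi gj /rowP E.
have ij : i = j.
  apply: contrapT => /eqP ij; have := E i; rewrite !mxE eqxx (negPf ij).
  by case: (f i) => [[]|]; case: (g i) => [[]|] /=; clear => ?; lra.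
rewrite -{j}ij in gj E *; split=> //; apply/ffunP => j; have := E j; rewrite !mxE.
case: eqP => [->|_].
  case: (f i) fi => [b|] // _; case: (g i) gj => [c|] // _ /=.
  by case: b; case: c => //= Q; exfalso; move: Q; clear => ?; lra.
by case: (f j) => [[]|]; case: (g j) => [[]|] // Q; exfalso; move: Q; clear => ?; lra.
Qed.

Definition act_bit (r : bool) (b : bool) := if r then ~~ b else b.
Definition act_face (h : cube_isometry) (f : face) : face :=
  [ffun i => omap (act_bit (h.2 i)) (f (h.1 i))].
Definition act_octant (h : cube_isometry) (s : octant) : octant :=
  [ffun i => act_bit (h.2 i) (s (h.1 i))].

Lemma act_face_oface h s : act_face h (oface s) = oface (act_octant h s).
Proof. by apply/ffunP => i; rewrite !ffunE. Qed.

Lemma act_face_fle h f g : fle f g -> fle (act_face h f) (act_face h g).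
Proof.
move=> /fleP fg; apply/fleP => i b; rewrite !ffunE.
by case E: (f (h.1 i)) => [c|] //=; rewrite (fg _ _ E).
Qed.

Lemma act_face_dim h f : face_dim (act_face h f) = face_dim f.
Proof.
rewrite /face_dim -(fintype.card_image (@perm_inj _ h.1^-1%g) [pred i | f i == None]).
apply: eq_card => i; rewrite inE ffunE; apply/idP/fintype.imageP.
  by case E: (f (h.1 i)) => //= _; exists (h.1 i); rewrite ?inE ?E// permK.
by move=> [j]; rewrite inE => /eqP fj ->; rewrite permKV fj.
Qed.

Lemma cube_move_facet_pt h f i : f i <> None ->
  cube_move h (facet_pt f i) = facet_pt (act_face h f) (h.1^-1%g i).
Proof.
move=> fi; apply/rowP => j; rewrite !mxE.
have -> : (h.1 j == i) = (j == h.1^-1%g i).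
  by apply/eqP/eqP => [<-|->]; rewrite ?permK ?permKV.
case: eqP => [->|_].
  rewrite ffunE permKV; case: (f i) fi => [b|] // _ /=; rewrite /act_bit.
  by case: ifP => _; case: b => /=; lra.
rewrite ffunE; case: (f (h.1 j)) => [b|] /=; rewrite /act_bit; case: ifP => _ //.
  by case: b => /=; lra.
by lra.
Qed.

Lemma act_face_neq h f i : f i <> None -> act_face h f (h.1^-1%g i) <> None.
Proof. by rewrite ffunE permKV; case: (f i). Qed.

Lemma octant_pt_neq_half s i j : facet_pt (oface s) i ord0 j <> 2^-1.
Proof.
rewrite !mxE; case: eqP => _; first by rewrite ffunE; exact: bool_neq_half.
by rewrite ffunE; case: (s j) => ?; lra.
Qed.

Lemma facet_pt_face g f i b : f i = Some b -> (face_dim g < 3)%N ->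
  face_set g (facet_pt f i) -> g = facet (i, b).
Proof.
move=> fi /face_dim_lt3[k [c gk]] [_ Hg].
have gj j : j != i -> g j = None.
  move=> ji; case E: (g j) => [d|] //; have := Hg _ _ E; rewrite !mxE (negPf ji).
  by case: (f j) => [[]|]; case: (d) => /= Q; exfalso; move: Q; clear => ?; lra.
have ki : k = i by apply/eqP; apply: contraTT isT => /gj; rewrite gk.
rewrite {}ki in gk; apply/ffunP => j; rewrite ffunE /=; case: eqP => [->|/eqP/gj//].
have := Hg _ _ gk; rewrite mxE eqxx fi gk /=.
by case: (b); case: (c) => //= Q; exfalso; move: Q; clear => ?; lra.
Qed.

End Flags.

(** The pairing is a relation, so no involution has to be built: exchanging the two members of each
    pair shows that the sum equals its opposite. *)
Lemma sum_paired (T : finType) (A : pred T) (P : rel T) (c : T -> int) :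
  (forall a b, P a b -> P b a) -> (forall a, A a -> exists2 b, A b & P a b) ->
  (forall a b b', P a b -> P a b' -> b = b') -> (forall a b, P a b -> c b = - c a) ->
  \sum_(a | A a) c a = 0.
Proof.
move=> Ps Pe Pu Pc.
have E : \sum_(a | A a) c a = \sum_(a | A a) \sum_(b | A b && P a b) c a.
  apply: eq_bigr => a /Pe[b Ab Pab]; rewrite (big_pred1 b)// => b' /=.
  apply/andP/eqP => [[_ /(Pu _ _ _ Pab)//]|->//].
suff : \sum_(a | A a) c a = - \sum_(a | A a) c a by lia.
rewrite {1}E (exchange_big_dep A) /=; last by move=> a b _ /andP[].
rewrite -sumrN; apply: eq_bigr => b Ab.
have [a Aa Pba] := Pe b Ab; rewrite (big_pred1 a) ?(Pc _ _ Pba)// => a' /=.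
rewrite Ab; apply/andP/eqP => [[_ /Ps /(Pu _ _ _ Pba)//]|->]; split=> //; exact: Ps.
Qed.

Section Transport.
Variables (K : realType) (N : nat) (R : cubiculated_region K N).
Variable S : embedded_discrete_surface R.
Variable M : set 'rV[K]_N.
Hypothesis Msub : M `<=` dual_complex R.
Hypothesis Mcompact : compact M.
Hypothesis Mman : manifold K 3 M.
Hypothesis Mbd : manifold_boundary K 3 M = range (psi S).
Local Notation V := 'rV[K]_3.
Local Notation B := (range (psi S)).
Implicit Types (v w : cube R) (f g : face).

Definition inside v (s : octant) : bool := occ [set x : V | M (chart v x)] s.

Lemma glue_facet v w f i b (y : V) : v != w -> f i = Some b -> unit_cube y ->
  chart v (facet_pt K f i) = chart w y ->
  exists2 h, glued (chart v) (chart w) (facet (i, b)) h & y = cube_move h (facet_pt K f i).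
Proof.
move=> vw fi y1 E; have [g [h [g3 gl fg yE]]] := glue_at vw (facet_pt_unit K f i) y1 E.
by exists h => //; rewrite -(facet_pt_face fi g3 fg).
Qed.

Lemma glue_neighbor v w f i (y : V) : v != w -> f i <> None -> unit_cube y ->
  chart v (facet_pt K f i) = chart w y -> black w = ~~ black v.
Proof.
move=> vw fi y1 E; case Ef: (f i) fi => [b|] // _.
have [h gl _] := glue_facet vw Ef y1 E.
by apply: (@black_neighbor _ _ R v (i, b)); split=> //; exists h.
Qed.

(** Two other cubes through the same facet point would be neighbors of each other and of [v], which
    two colors do not allow. *)
Lemma facet_cube_unique v w w' f i (y y' : V) : v != w -> v != w' -> f i <> None ->
  unit_cube y -> unit_cube y' -> chart v (facet_pt K f i) = chart w y ->
  chart v (facet_pt K f i) = chart w' y' -> w = w'.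
Proof.
move=> vw vw' fi y1 y1' E E'; apply/eqP/negPn/negP => ww'.
have b1 := glue_neighbor vw fi y1 E; have b2 := glue_neighbor vw' fi y1' E'.
case Ef: (f i) => [b|] //; have [h _ yE] := glue_facet vw Ef y1 E.
rewrite yE cube_move_facet_pt // in E.
have := @glue_neighbor w w' _ _ y' ww' (act_face_neq (h := h) fi) y1'.
by rewrite -E E' b1 b2 => /(_ erefl); case: (black v).
Qed.

Lemma near_preimages (p : 'rV[K]_N) (e : K) : 0 < e -> nbhs p [set q |
  forall w (y z : V), unit_cube y -> unit_cube z -> chart w y = p -> chart w z = q ->
  `|y - z| < e].
Proof.
move=> e0.
apply: (@filter_forall _ (cube R) (fun w q => forall y z : V, unit_cube y ->
  unit_cube z -> chart w y = p -> chart w z = q -> `|y - z| < e) (nbhs p) _) => w.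
have [d d0 Hd] := compact_injective_modulus (@unit_cube_compact K)
  (@chart_cont _ _ R w) (chart_injective (c:=w)) e0.
have : nbhs p [set q | `|p - q| < d] by apply/nbhs_norm_ltP; exists d.
by apply: filterS => q pq y z y1 z1 yp zq; apply: Hd; rewrite ?yp ?zq.
Qed.

(** The segment from the facet point to the middle of the octant runs in the octant, and [M] is
    closed. *)
Lemma octant_facet_pt_in v s i : inside v s -> M (chart v (facet_pt K (oface s) i)).
Proof.
move=> /asboolP Ms; apply: (M_closed Mcompact) => P /nbhs_norm_ltP[e e0 He].
set x := facet_pt K (oface s) i in He *.
have [d d0 Hd] := (within_contP _ _).1 (@chart_cont _ _ R v) x (facet_pt_unit _ _ _) _ e0.
pose t := Num.min 1 (d / 2); pose m := mid K (oface s).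
have t0 : 0 < t by rewrite lt_min; apply/andP; split; lra.
have t1 : t <= 1 by rewrite ge_min lexx.
have td : t < d by rewrite gt_min; apply/orP; right; lra.
have zE j : (x + t *: (m - x)) ord0 j = (1 - t) * x ord0 j + t * m ord0 j.
  by rewrite !mxE; ring.
have z1 : open_unit_cube (x + t *: (m - x)).
  move=> j; rewrite zE /x /m !mxE !ffunE.
  by case: eqP => [->|_]; case: (s _) => /=; apply/andP; split; nra.
have zs : str (x + t *: (m - x)) = oface s.
  apply: str_uniq => j; rewrite zE /x /m !mxE !ffunE.
  by case: eqP => [->|_]; case: (s _) => /=; nra.
exists (chart v (x + t *: (m - x))); split.
  by apply/(region_str (local_region_at Msub Mcompact Mman Mbd v) z1); rewrite zs.
apply: He; apply: Hd; first exact: open_unit_cubeW.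
rewrite opprD addrA subrr sub0r normrN normrZ gtr0_norm//.
apply: le_lt_trans td; apply: ler_piMr; first exact: ltW.
apply/row_norm_le => // j; rewrite !mxE !ffunE ler_norml.
by case: eqP => [->|_]; case: (s _) => /=; apply/andP; split; lra.
Qed.

(** The coordinates of this point are 0, 1, 1/4 or 3/4, while a cell of the surface has a coordinate
    equal to 1/2, a value kept by gluing isometries. *)
Lemma octant_facet_pt_out v s i : ~ B (chart v (facet_pt K (oface s) i)).
Proof.
move=> /(surface_facesP (facet_pt_unit _ _ _))[d [g [y [dg gy E]]]].
have := lr_dim (local_region_at Msub Mcompact Mman Mbd d) dg.
move=> /card_gt0P[j]; rewrite inE => /eqP gj.
have yj : y ord0 j = 2^-1 by have := gy j; rewrite gj.
have [dv|dv] := eqVneq v d.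
  rewrite -dv in E; apply: (@octant_pt_neq_half K s i j).
  by rewrite -(chart_injective (dual_set_unit gy) (facet_pt_unit _ _ _) E).
have [_ [h [_ _ _ yE]]] := glue_at dv (facet_pt_unit _ _ _) (dual_set_unit gy) (esym E).
move: yj; rewrite yE mxE => yj; apply: (@octant_pt_neq_half K s i (h.1 j)).
by move: yj; case: ifP => _; lra.
Qed.

(* Since the facet point is interior to M, invariance of domain prevents M from
   staying on one side of the facet. *)
Lemma octant_transport v s i : inside v s -> exists w h, [/\ v != w,
  glued (chart v) (chart w) (facet (i, s i)) h & inside w (act_octant h s)].
Proof.
move=> vs; apply: contrapT => nex.
set x := facet_pt K (oface s) i; pose p := chart v x.
have x1 : unit_cube x by exact: facet_pt_unit.
have si : oface s i = Some (s i) by rewrite ffunE.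
have si' : oface s i <> None by rewrite si.
have Ip : manifold_interior K 3 M p.
  apply: (interior_of Mbd); first exact: octant_facet_pt_in.
  exact: octant_facet_pt_out.
have e0 : 0 < 4^-1 :> K by lra.
pose O1 := [set q | forall d : cube R, cube_set d q -> cube_set d p].
pose O2 := [set q | forall w (y z : V), unit_cube y -> unit_cube z ->
  chart w y = p -> chart w z = q -> `|y - z| < 4^-1].
have nO : nbhs p (O1 `&` O2).
  by apply: filterI; [exact: near_cubes|exact: near_preimages].
(* If no octant across the facet is occupied, a point of [M] near [p] in another cube is either on
   the common facet, hence in [v], or in the open octant facing [s], which is empty. *)
have MO : M `&` (O1 `&` O2) `<=` cube_set v.
  move=> q [Mq [Hq1 Hq2]]; have [w wq] := M_carrier Msub Mq.
  have [vw|vw] := eqVneq v w; first by rewrite vw.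
  have [y y1 Ey] := Hq1 w wq; have [z z1 Ez] := wq.
  have yz := Hq2 w y z y1 z1 Ey Ez.
  have [h gl yE] := glue_facet vw si y1 (esym Ey).
  have nw : ~ inside w (act_octant h s) by move=> ?; apply: nex; exists w, h.
  rewrite cube_move_facet_pt // act_face_oface in yE.
  set s' := act_octant h s in nw yE; set i' := (h.1^-1)%g i in yE.
  have si2 : oface s' i' = Some (s' i') by rewrite ffunE.
  have wv : w != v by rewrite eq_sym.
  rewrite yE in Ey; have [h' gl' _] := glue_facet wv si2 x1 Ey.
  have zc j : `|y ord0 j - z ord0 j| < 4^-1.
    by have := row_coord_le (y - z) j; rewrite !mxE => /le_lt_trans; apply.
  have [zi|zi] := eqVneq (z ord0 i') (s' i')%:R.
    have [_ H] := gl' z (cube_move h' z) z1 (cube_move_unit h' z1).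
    exists (cube_move h' z); first exact: cube_move_unit.
    rewrite -H -?Ez//; split=> //; split=> // j b; rewrite ffunE /=.
    by case: eqP => // -> [<-].
  exfalso; apply: nw; apply/asboolP => /=.
  have zj j : 0 < z ord0 j < 1 /\ (if s' j then 2^-1 < z ord0 j else z ord0 j < 2^-1).
    have := zc j; rewrite yE mxE; case: eqP => [->|_]; last first.
      by rewrite mxE [oface s' j]ffunE; exact: near_quarter.
    by rewrite si2 /=; exact: near_bit.
  have zopen : open_unit_cube z by move=> j; case: (zj j).
  have zs : str z = oface s'.
    by apply: str_uniq => j; have [_] := zj j; rewrite [oface s' j]ffunE; case: (s' j).
  rewrite -zs.
  by apply/(region_str (local_region_at Msub Mcompact Mman Mbd w) zopen); rewrite /= Ez.
have /nbhs_norm_ltP[r r0 Hr] := interior_chart x1 Ip nO MO.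
(* [u] leaves the unit cube through the facet while staying in the neighborhood of parameters given
   by [interior_chart]. *)
pose u : V := x + ((-1) ^+ (~~ s i) * (r / 2)) *: delta_mx ord0 i.
have [|/(_ i) + _] := Hr u.
  rewrite /u opprD addrA subrr sub0r normrN normrZ normrM normrX normrN1 expr1n mul1r.
  rewrite gtr0_norm; last by lra.
  apply: (@le_lt_trans _ _ (r / 2 * 1)); last by lra.
  rewrite ler_pM2l; last by lra.
  by apply/row_norm_le => // j; rewrite mxE; case: andP => _; rewrite ?normr1 ?normr0.
by rewrite /u !mxE !eqxx ffunE /= mulr1 => /(bit_push r0).
Qed.

End Transport.

(** * Color-weighted counts of link cells *)

Section Weights.
Variables (K : realType) (N : nat) (R : cubiculated_region K N).
Variable S : embedded_discrete_surface R.
Variable M : set 'rV[K]_N.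
Hypothesis Msub : M `<=` dual_complex R.
Hypothesis Mcompact : compact M.
Hypothesis Mman : manifold K 3 M.
Hypothesis Mbd : manifold_boundary K 3 M = range (psi S).
Local Notation V := 'rV[K]_3.
Local Notation B := (range (psi S)).
Implicit Types (v w : cube R) (f g : face).
Local Notation lr v := (local_region_at Msub Mcompact Mman Mbd v).

Definition flag := (cube R * face * 'I_3)%type.
(** Crossing a facet is expressed by coincidence of points: symmetry is immediate, and the partner
    is unique by [facet_cube_unique] and [facet_pt_inj]. *)
Definition same_facet_pt (a b : flag) : bool :=
  [&& a.1.1 != b.1.1, a.1.2 a.2 != None, b.1.2 b.2 != None &
    `[< chart a.1.1 (facet_pt K a.1.2 a.2) = chart b.1.1 (facet_pt K b.1.2 b.2) >]].
Definition active (k : nat) (a : flag) : bool :=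
  [&& a.1.2 a.2 != None, face_dim a.1.2 == k & hit (inside M a.1.1) a.1.2].

Lemma sum_active k : \sum_(a | active k a) color (a.1.1 : cube R) = 0.
Proof.
apply: (@sum_paired _ _ same_facet_pt).
- move=> [[v f] i] [[w g] j]; rewrite /same_facet_pt /= => /and4P[vw fi gj /asboolP E].
  by apply/and4P; split=> //; [rewrite eq_sym|exact/asboolP].
- move=> [[v f] i] /and3P[/= fi fk /existsP[s /andP[fs vs]]].
  have [w [h [vw gl ws]]] := octant_transport Msub Mcompact Mman Mbd i vs.
  exists (w, act_face h f, (h.1^-1)%g i) => /=.
    apply/and3P; split=> /=; [exact/eqP/act_face_neq/eqP|by rewrite act_face_dim|].
    apply/existsP; exists (act_octant h s); rewrite -act_face_oface act_face_fle//.
  apply/and4P; split=> //=; first exact/eqP/act_face_neq/eqP.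
  apply/asboolP; rewrite -cube_move_facet_pt; last exact/eqP.
  have [_ ->] := gl (facet_pt K f i) (cube_move h (facet_pt K f i))
    (facet_pt_unit _ _ _) (cube_move_unit h (facet_pt_unit _ _ _)) => //.
  split=> //; split; first exact: facet_pt_unit.
  move=> j b; rewrite ffunE /= mxE; case: eqP => // _ [<-].
  case E: (f i) fi => [c|] // _; move/fleP: fs => /(_ _ _ E).
  by rewrite ffunE => -[->].
- move=> [[v f] i] [[w g] j] [[w' g'] j'] /and4P[/= vw fi gj /asboolP E].
  move=> /and4P[/= vw' _ gj' /asboolP E'].
  have ww' : w = w'.
    apply: (facet_cube_unique vw vw' _ (facet_pt_unit _ _ _) (facet_pt_unit _ _ _) E E').
    exact/eqP.
  move: E'; rewrite -ww' E => E'.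
  have /(facet_pt_inj (elimN eqP gj) (elimN eqP gj'))[-> ->] :=
    chart_injective (facet_pt_unit _ _ _) (facet_pt_unit _ _ _) E'.
  by [].
- move=> [[v f] i] [[w g] j] /and4P[/= vw /eqP fi _ /asboolP E].
  rewrite /color (glue_neighbor vw fi (facet_pt_unit _ _ _) E).
  by case: (black v).
Qed.

Lemma free_indices f : #|[pred i | f i != None]| = (3 - face_dim f)%N.
Proof.
have := cardC [pred i | f i == None]; rewrite card_ord -/(face_dim f) => E.
apply: (@addnI (face_dim f)); rewrite subnKC -?E ?leq_addr//.
Qed.

(** A face of dimension k fixes 3 - k coordinates and so occurs in 3 - k flags, a factor that can be
    cancelled for k < 3. *)
Lemma sum_count k : (k < 3)%N ->
  \sum_(v : cube R) color v * (count_hit (inside M v) k)%:R = 0.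
Proof.
move=> k3; have := sum_active k.
rewrite (_ : \sum_(a | _) _ =
    \sum_(v : cube R) color v * (count_hit (inside M v) k)%:R * (3 - k)%:R).
  rewrite -mulr_suml => /eqP; rewrite mulf_eq0 => /orP[/eqP//|].
  by rewrite pnatr_eq0 subn_eq0 leqNgt k3.
rewrite big_mkcond -(pair_bigA _ (fun (p : cube R * face) i =>
  if active k (p, i) then color p.1 else 0)).
rewrite -(pair_bigA _ (fun (v : cube R) f => \sum_i
  if active k (v, f, i) then color v else 0)) /=.
apply: eq_bigr => v _; rewrite /count_hit natr_sum mulr_sumr mulr_suml.
apply: eq_bigr => f _; rewrite -big_mkcond /active /=.
case: eqP => [fk|_] /=; last by rewrite mulr0 mul0r big1// => i; rewrite andbF.
case: hit => /=; last by rewrite mulr0 mul0r big1// => i; rewrite andbF.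
under eq_bigl do rewrite andbT.
by rewrite sumr_const (free_indices f) fk mulr1 mulr_natr.
Qed.

(* The Euler characteristic of the link of the center of v in M. *)
Definition weight v : int :=
  if `[< B (Defs.center v) >] then 1 else if `[< M (Defs.center v) >] then 2 else 0.

Lemma centerE v : Defs.center v = chart v (mid K center_face).
Proof. by rewrite /Defs.center; congr chart; apply/rowP => i; rewrite !mxE ffunE. Qed.

Lemma center_disk v : B (Defs.center v) ->
  (count_hit (inside M v) 2 + count_hit (inside M v) 0 = count_hit (inside M v) 1 + 1)%N /\
  (forall k : octant -> bool,
    (forall s i, ~~ inside M v s -> ~~ inside M v (flip s i) -> k (flip s i) = k s) ->
    forall s s', ~~ inside M v s -> ~~ inside M v s' -> k s = k s').
Proof.
rewrite centerE => Bc; have [[s1 _ o1] [s2 _ o2]] := boundary_occ (lr v) Bc.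
apply: disk_pattern; [by exists s1|by exists s2| |].
  by move=> f k Hk; exact: (occ_connected (lr v)).
by move=> s0; exact: (occ_not_annulus (lr v)).
Qed.

Lemma center_free v s : ~ B (Defs.center v) -> inside M v s = `[< M (Defs.center v) >].
Proof.
rewrite centerE => nB; have := free_occE (lr v) nB (center_fle (oface s)).
by move=> E; apply/idP/asboolP; rewrite -E.
Qed.

Lemma weightE v : weight v =
  (count_hit (inside M v) 2)%:R - (count_hit (inside M v) 1)%:R + (count_hit (inside M v) 0)%:R.
Proof.
rewrite /weight; case: asboolP => [Bc|nB].
  have [+ _] := center_disk Bc.
  move: (count_hit _ 2) (count_hit _ 1) (count_hit _ 0) => a b c E.
  by rewrite addrAC -natrD E natrD addrAC subrr add0r.
have -> : inside M v = fun=> `[< M (Defs.center v) >].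
  by apply/funext => s; exact: center_free.
(* Off [B] the eight octants agree: the whole octahedron gives 6 - 12 + 8 = 2, the empty set 0. *)
by rewrite !count_hit_fc; case: asboolP => _; vm_compute.
Qed.

Lemma sum_weight : \sum_(v : cube R) color v * weight v = 0.
Proof.
under eq_bigr do rewrite weightE mulrDr mulrBr.
by rewrite big_split /= sumrB !sum_count.
Qed.

End Weights.

(** * The flux *)

Section Frames.
Variable K : realType.

Lemma dvec_dot (a b : direction) : \sum_j dvec K a ord0 j * dvec K b ord0 j =
  (a.1 == b.1)%:R * ((-1) ^+ (~~ a.2) * (-1) ^+ (~~ b.2)).
Proof.
rewrite (bigD1 a.1)//= big1 ?addr0 => [|j ja]; last by rewrite !mxE (negPf ja) !mulr0 mul0r.
by rewrite !mxE !eqxx /= mulr1 [_ * (_ == _)%:R]mulrC mulrCA.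
Qed.

Lemma dvec_dot_self (a : direction) : \sum_j dvec K a ord0 j * dvec K a ord0 j = 1.
Proof. by rewrite dvec_dot eqxx mul1r; case: (a.2); rewrite ?expr0 ?expr1 ?mulrNN mulr1. Qed.

Lemma dvec_dot_neq (a b : direction) : a.1 != b.1 ->
  \sum_j dvec K a ord0 j * dvec K b ord0 j = 0.
Proof. by move=> ab; rewrite dvec_dot (negPf ab) mul0r. Qed.

Definition frame (n a b : direction) : 'M[K]_3 :=
  \matrix_(k < 3) nth 0 [:: dvec K n; dvec K a; dvec K b] k.

Lemma frame_det_neq0 n a b : n.1 != a.1 -> n.1 != b.1 -> a.1 != b.1 ->
  \det (frame n a b) != 0.
Proof.
move=> na nb ab; suff E : frame n a b *m (frame n a b)^T = 1%:M.
  have /eqP := congr1 determinant E; rewrite det_mulmx det_tr det1.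
  by apply: contraTneq => ->; rewrite mul0r eq_sym oner_eq0.
have an : a.1 != n.1 by rewrite eq_sym.
have bn : b.1 != n.1 by rewrite eq_sym.
have ba : b.1 != a.1 by rewrite eq_sym.
apply/matrixP => k l; rewrite !mxE.
under eq_bigr do rewrite !mxE.
by case: k => [[|[|[|]]]] // ?; case: l => [[|[|[|]]]] // ? /=;
  rewrite ?dvec_dot_self ?dvec_dot_neq.
Qed.

Lemma frame_det_opp n a b : \det (frame (opposite n) a b) = - \det (frame n a b).
Proof.
rewrite (@determinant_multilinear _ _ _ (frame n a b) (frame n a b) ord0 (-1) 0).
- by rewrite mul0r addr0 mulN1r.
- rewrite scale0r addr0 scaleN1r; apply/rowP => j; rewrite !mxE /= ?mxE /=.
  by case: (n.2); rewrite /= ?expr0 ?expr1 ?mul1r ?mulN1r ?opprK.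
- by apply/matrixP => k j; rewrite !mxE.
- by apply/matrixP => k j; rewrite !mxE.
Qed.

Definition oct3 (a b n : direction) : octant :=
  [ffun i => if i == a.1 then a.2 else if i == b.1 then b.2 else n.2].

Lemma ord3_cover (i j k l : 'I_3) : i != j -> i != k -> j != k -> [|| l == i, l == j | l == k].
Proof.
case: i => [[|[|[|]]]] // ?; case: j => [[|[|[|]]]] // ?; case: k => [[|[|[|]]]] // ?;
  by case: l => [[|[|[|]]]] // ?; rewrite -!val_eqE.
Qed.

Lemma mid_facet (d : direction) : const_mx 2^-1 + 4^-1 *: dvec K d = mid K (facet d).
Proof.
apply/rowP => i; rewrite !mxE ffunE.
by case: (eqVneq i d.1) => _ /=; rewrite ?mulr0 ?mulr1 ?addr0//;
  case: (d.2) => /=; rewrite ?expr0 ?expr1; lra.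
Qed.

Lemma mid_oct3 (a b n : direction) : n.1 != a.1 -> n.1 != b.1 -> a.1 != b.1 ->
  const_mx 2^-1 + 4^-1 *: (dvec K a + dvec K b + dvec K n) = mid K (oface (oct3 a b n)).
Proof.
move=> na nb ab; apply/rowP => i; rewrite !mxE !ffunE /=.
have := ord3_cover i na nb ab.
have [->|ia] := eqVneq i a.1.
  rewrite (negPf ab) (eq_sym a.1) (negPf na) /= !mulr0 mulr1 !addr0 => _.
  by case: (a.2) => /=; rewrite ?expr0 ?expr1; lra.
have [->|ib] := eqVneq i b.1.
  rewrite (eq_sym b.1) (negPf nb) /= !mulr0 mulr1 add0r !addr0 => _.
  by case: (b.2) => /=; rewrite ?expr0 ?expr1; lra.
rewrite !orbF => /eqP ->; rewrite eqxx /= !mulr0 mulr1 !add0r.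
by case: (n.2) => /=; rewrite ?expr0 ?expr1; lra.
Qed.

Lemma oct3_fle a b n : fle (edge_face a b) (oface (oct3 a b n)).
Proof. by apply/fleP => i c; rewrite !ffunE; case: eqP => // _; case: eqP. Qed.

Lemma oct3_cases a b n s : n.1 != a.1 -> n.1 != b.1 -> a.1 != b.1 ->
  fle (edge_face a b) (oface s) -> s = oct3 a b n \/ s = oct3 a b (opposite n).
Proof.
move=> na nb ab /fleP fs.
have sa : s a.1 = a.2 by have := fs a.1 a.2; rewrite !ffunE eqxx => /(_ erefl)[].
have sb : s b.1 = b.2.
  by have := fs b.1 b.2; rewrite !ffunE eqxx eq_sym (negPf ab) => /(_ erefl)[].
suff E c : s n.1 = c.2 -> c.1 = n.1 -> s = oct3 a b c.
  have [sn|sn] := eqVneq (s n.1) n.2; first by left; exact: E.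
  by right; apply: E => //=; move: sn; case: (s n.1); case: (n.2).
move=> sn cn; apply/ffunP => i; rewrite ffunE.
have := ord3_cover i na nb ab; have [->//|_] := eqVneq i a.1.
by have [->//|_] := eqVneq i b.1; rewrite !orbF => /eqP ->.
Qed.

Lemma edge_faceC a b : a.1 != b.1 -> edge_face a b = edge_face b a.
Proof.
move=> ab; apply/ffunP => i; rewrite !ffunE.
by have [->|_] := eqVneq i a.1; first by rewrite (negPf ab).
Qed.

Lemma dual_set_mid f : @dual_set K f (mid K f).
Proof. by move=> i; rewrite mxE; case: (f i) => [[]|] //; apply/andP; split; lra. Qed.

Lemma dual_set_mid_cases g f i : @dual_set K g (mid K f) ->
  g i = None /\ f i = None \/ g i <> None /\ (f i <> None -> g i = f i).
Proof.
move=> /(_ i); rewrite mxE.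
case: (g i) => [[]|]; case: (f i) => [[]|]; (try by [left|right]);
  by [move=> /andP[? ?]; exfalso; lra|move=> ?; exfalso; lra].
Qed.

(** A free direction of [g] is free for [f], and the dimension bounds force equality. Thus a cell of
    the surface through the middle of a quarter of a square is that square. *)
Lemma dual_set_mid_eq g f : (0 < face_dim g)%N -> (face_dim f <= 1)%N ->
  @dual_set K g (mid K f) -> g = f.
Proof.
move=> g0 f1 gf.
have sub : [pred i | g i == None] \subset [pred i | f i == None].
  apply/fintype.subsetP => i; rewrite !inE => /eqP gi.
  by case: (dual_set_mid_cases i gf) => -[E1 E2]; [rewrite E2|rewrite gi in E1].
have E : [pred i | g i == None] =i [pred i | f i == None].
  by apply/subset_cardP => //; apply/eqP; rewrite eqn_leq (subset_leq_card sub) (leq_trans f1).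
apply/ffunP => i; case: (dual_set_mid_cases i gf) => -[E1 E2]; first by rewrite E1.
by apply: E2 => fi; have := E i; rewrite !inE fi eqxx => /eqP.
Qed.

Lemma edge_face_dim a b : a.1 != b.1 -> (face_dim (edge_face a b) <= 1)%N.
Proof.
move=> ab; have := cardC [pred i | edge_face a b i == None].
rewrite card_ord => E.
suff H : (2 <= #|[predC [pred i | edge_face a b i == None]]|)%N.
  by rewrite -(leq_add2r 2) (leq_trans _ (eq_leq E))// leq_add2l.
have c2 : #|[set a.1; b.1]%SET| = 2%N by rewrite cards2 ab.
apply: leq_trans (eq_leq (esym c2)) _.
apply: subset_leq_card; apply/fintype.subsetP => i; rewrite !inE ffunE.
by case: eqP => //= _; case: eqP.
Qed.

Lemma facet_dim d : (face_dim (facet d) < 3)%N.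
Proof.
rewrite /face_dim -[X in (_ < X)%N](card_ord 3); apply: proper_card.
apply/properP; split; first exact/fintype.subsetP.
by exists d.1; rewrite ?inE // ffunE eqxx.
Qed.

Lemma facet_inj : injective facet.
Proof.
move=> [i b] [j c] /ffunP E; have := E i; rewrite !ffunE /= eqxx.
by case: eqP => // -> [->].
Qed.

Lemma facet_in (f : face) d : f d.1 = Some d.2 -> face_set (facet d) (facet_pt K f d.1).
Proof.
move=> fd; split; first exact: facet_pt_unit.
by move=> j b; rewrite ffunE mxE; case: eqP => // _ [<-]; rewrite fd.
Qed.

Lemma fle_facet d s : fle (facet d) (oface s) = (s d.1 == d.2).
Proof.
apply/fleP/eqP => [H|E i b]; first by have := H d.1 d.2; rewrite !ffunE eqxx => /(_ erefl)[].
by rewrite !ffunE; case: eqP => // -> [<-]; rewrite E.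
Qed.

End Frames.

(** * The two sides of the surface at a vertex, and the status of a dimer *)

Section FluxOfBoundary.
Variables (K : realType) (N : nat) (R : cubiculated_region K N).
Variable S : embedded_discrete_surface R.
Variable M : set 'rV[K]_N.
Hypothesis Msub : M `<=` dual_complex R.
Hypothesis Mcompact : compact M.
Hypothesis Mman : manifold K 3 M.
Hypothesis Mbd : manifold_boundary K 3 M = range (psi S).
Hypothesis Mor : boundary_orientation S M.
Local Notation V := 'rV[K]_3.
Local Notation B := (range (psi S)).
Implicit Types (u v w : cube R) (f g : face) (a b d n : direction).
Local Notation lr v := (local_region_at Msub Mcompact Mman Mbd v).
Local Notation md f := (mid K f).

Lemma near_centerE v d : near_center v (dvec K d) = chart v (md (facet d)).
Proof. by rewrite /near_center mid_facet. Qed.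

Lemma besideE v a b n : n.1 != a.1 -> n.1 != b.1 -> a.1 != b.1 ->
  beside v a b n = chart v (md (oface (oct3 a b n))).
Proof. by move=> na nb ab; rewrite /beside /near_center mid_oct3. Qed.

Lemma positive_frame_opposite v n a b : n.1 != a.1 -> n.1 != b.1 -> a.1 != b.1 ->
  positive_frame v (opposite n) a b = ~~ positive_frame v n a b.
Proof.
move=> na nb ab; rewrite /positive_frame -!/(frame K _ _ _) frame_det_opp oppr_gt0.
have := frame_det_neq0 K na nb ab.
by case: (ltgtP 0 (\det _)) => // _ _; case: (orient v).
Qed.

Lemma corner_sym X u v w a b : corner X u v w a b -> corner X w v u b a.
Proof. by move=> [? ? ab ? ?]; split=> //; rewrite 1?eq_sym// -edge_faceC. Qed.

(** One of the two octants beside the quarter of square is occupied and the other is empty. Were [n]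
    on the occupied side, [boundary_orientation] applied to its opposite would make both directions
    give a positive frame. *)
Lemma normal_outward u v w a b n : Defs.normal S u v w a b n ->
  inside M v (oct3 a b (opposite n)) /\ ~~ inside M v (oct3 a b n).
Proof.
move=> [[vaw vbu ab int sub] pos na nb pf].
have Bm : B (chart v (md (edge_face a b))).
  by apply: sub; exists v, (edge_face a b); split=> //; exists (md (edge_face a b)) => //;
    exact: dual_set_mid.
have [[s1 f1 i1] [s2 f2 o2]] := boundary_occ (lr v) Bm.
have c1 := oct3_cases na nb ab f1; have c2 := oct3_cases na nb ab f2.
suff no : ~~ inside M v (oct3 a b n).
  split=> //; case: c1 i1 => -> //.
  by move=> i1; move: no; rewrite /inside i1.
apply/negP => io.
have oo : ~~ inside M v (oct3 a b (opposite n)).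
  by case: c2 o2 => -> // o2; move: io; rewrite /inside (negPf o2).
have : positive_frame v n a b = positive_frame v (opposite n) a b.
  rewrite pf -(Mor (u := u) (w := w) (v := v) (a := a) (b := b) (n := opposite n)) ?pos//.
  by rewrite besideE// => Mb; move: oo; rewrite /inside /occ asboolT.
by rewrite positive_frame_opposite// pf.
Qed.

Lemma center_mixed v : B (Defs.center v) ->
  exists s i, ~~ inside M v s /\ inside M v (flip s i).
Proof.
rewrite centerE => Bc; have [[s1 f1 i1] [s2 f2 o2]] := boundary_occ (lr v) Bc.
apply: contrapT => nex.
have : inside M v s1 = inside M v s2.
  apply: subcube_constant f1 f2 => s i _ _.
  case E1: (inside M v s); case E2: (inside M v (flip s i)) => //; exfalso; apply: nex.
    by exists (flip s i), i; rewrite flipK E1 E2.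
  by exists s, i; rewrite E1 E2.
by rewrite /inside i1 (negPf o2).
Qed.

(** Between an empty octant and an occupied one lies a quarter of a square of [B]. The neighbors
    needed for a corner exist because the occupied octant continues across facets; exchanging [u]
    and [w] if necessary makes the corner positive. *)
Lemma normal_exists v : B (Defs.center v) ->
  exists u w a b n, Defs.normal S u v w a b n /\ a.1 != b.1.
Proof.
move=> /center_mixed[s [i [so si]]].
pose j := lift i ord0; pose k := lift i ord_max.
pose a : direction := (j, s j); pose b : direction := (k, s k); pose n : direction := (i, s i).
have na : n.1 != a.1 by exact: neq_lift.
have nb : n.1 != b.1 by exact: neq_lift.
have ab : a.1 != b.1 by rewrite /= (inj_eq lift_inj).
have Es : oct3 a b n = s.
  apply/ffunP => l; rewrite ffunE /=; have := ord3_cover l na nb ab.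
  have [->//|_] := eqVneq l j; have [->//|_] := eqVneq l k.
  by rewrite !orbF /= => /eqP ->.
have fs : fle (edge_face a b) (oface s) by rewrite -Es; exact: oct3_fle.
have fi : edge_face a b i = None by rewrite ffunE /= (negPf na) (negPf nb).
have Bm : B (chart v (md (edge_face a b))).
  apply: contrapT => nB; move: so; rewrite /inside.
  by rewrite (free_occ (lr v) nB fs (fle_flip fs fi)) -/(inside M v _) si.
have [g Gg gm] := (lr_cells (lr v) (@mid_in K _)).1 Bm.
have gE : g = edge_face a b.
  exact: dual_set_mid_eq (lr_dim (lr v) Gg) (edge_face_dim ab) gm.
rewrite {}gE in Gg; have [c [f [hd f1 Ec sub]]] := Gg.
have dE : dual_cell v (edge_face a b) = dual_cell c f by rewrite /dual_cell Ec.
have int : interior_cell v (edge_face a b).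
  have fd : face_dim f = 1%N.
    apply/eqP; rewrite eqn_leq f1 andbT.
    apply: leq_trans (_ : face_dim (edge_face a b) <= 1)%N.
      by apply: (@cell_dim_le _ _ _ c v); rewrite Ec.
    exact: edge_face_dim.
  by move: hd; rewrite /has_dual fd /interior_cell Ec.
have nbr l : l != i -> exists w, neighbor v (l, s l) w.
  move=> li; have [w [h [vw gl _]]] := octant_transport Msub Mcompact Mman Mbd l si.
  exists w; split=> //; exists h; move: gl; by rewrite ffunE (negPf li).
have [w vw] : exists w, neighbor v a w by apply: nbr; rewrite eq_sym.
have [u vu] : exists u, neighbor v b u by apply: nbr; rewrite eq_sym.
have co : corner B u v w a b by split=> //; rewrite dE.
have nM : ~ M (beside v a b n).
  by rewrite besideE// Es => Ms; move: so; rewrite /inside /occ asboolT.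
have [pos1 _ _] := positive_orientation S.
case E: (positive S u v w).
  exists u, w, a, b, n; split=> //; split=> //.
  by rewrite -(Mor co na nb nM).
exists w, u, b, a, n; rewrite eq_sym; split=> //; split=> //; first exact: corner_sym.
  by rewrite (pos1 _ _ _ _ _ co) E.
rewrite -(Mor (corner_sym co) nb na).
  by rewrite (pos1 _ _ _ _ _ co) E.
by move: nM; rewrite /beside (addrC (dvec K a)).
Qed.

Lemma cube_minus_segment v (x y : V) : open_unit_cube x -> open_unit_cube y ->
  fle (str x) (str y) -> ~ B (chart v (md (str x))) ->
  connected_component (cube_minus S v) (chart v x) (chart v y).
Proof.
move=> x1 y1 xy nB; exists (chart v @` segment_set x y); last first.
  by exists y => //; exact: segment_set1.
have sub z : segment_set x y z -> open_unit_cube z.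
  by move=> /(str_segment_set x1 y1 xy)[].
split; first by exists x => //; exact: segment_set0.
  move=> _ [z zs <-]; have z1 := sub z zs; split; first by exists z.
  move=> /(boundary_str (lr v) z1).
  by have [_ [->|->]] := str_segment_set x1 y1 xy zs; [|move/(boundary_fle (lr v) xy)].
apply: connected_continuous_connected; first exact: segment_set_connected.
apply: continuous_subspaceW (@chart_cont _ _ R v) => z /sub; exact: open_unit_cubeW.
Qed.

Lemma cube_minus_mid v f g : fle f g -> ~ B (chart v (md f)) ->
  connected_component (cube_minus S v) (chart v (md f)) (chart v (md g)).
Proof.
by move=> fg nB; apply: cube_minus_segment; rewrite ?str_mid//; exact: mid_in.
Qed.

Lemma cube_minus_M v (x y : V) : unit_cube x -> unit_cube y ->
  connected_component (cube_minus S v) (chart v x) (chart v y) ->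
  M (chart v x) -> M (chart v y).
Proof.
move=> x1 y1 [C [Cx Csub cC] Cy]; have [G GE cG] := chart_inverse v.
have CG : (G @` C) `<=` @open_unit_cube K `\` [set z : V | B (chart v z)].
  move=> _ [q /Csub [[z z1 <-] nB] <-]; rewrite GE; last exact: open_unit_cubeW.
  by split.
have cGC : connected (G @` C).
  apply: connected_continuous_connected cC _; apply: continuous_subspaceW cG.
  by move=> q /Csub[[z /open_unit_cubeW z1 <-] _]; exists z.
apply: (region_constant (lr v) cGC CG).
  by exists (chart v x) => //; rewrite GE.
by exists (chart v y) => //; rewrite GE.
Qed.

Lemma flip_free v s i : inside M v (flip s i) = inside M v s ->
  exists2 f, fle f (oface s) /\ fle f (oface (flip s i)) & ~ B (chart v (md f)).
Proof.
move=> E; pose f : face := [ffun l => if l == i then None else Some (s l)].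
have fs : fle f (oface s) by apply/fleP => l c; rewrite !ffunE; case: eqP.
have ff : fle f (oface (flip s i)) by apply: fle_flip => //; rewrite ffunE eqxx.
exists f => // Bf; have [[s1 f1 i1] [s2 f2 o2]] := boundary_occ (lr v) Bf.
have eqs s' : fle f (oface s') -> inside M v s' = inside M v s.
  move=> /fleP f'; have sl l : l != i -> s' l = s l.
    by move=> li; have := f' l (s l); rewrite !ffunE (negPf li) => /(_ erefl)[].
  have [si|si] := eqVneq (s' i) (s i).
    congr inside; apply/ffunP => l; have [->//|] := eqVneq l i; exact: sl.
  rewrite -E; congr inside; apply/ffunP => l; rewrite ffunE.
  have [->|] := eqVneq l i; last exact: sl.
  by move: si; case: (s' i); case: (s i).
by move: o2; rewrite -/(inside M v s2) (eqs _ f2) -(eqs _ f1) /inside i1.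
Qed.

Lemma flip_linked v s i : inside M v (flip s i) = inside M v s ->
  connected_component (cube_minus S v) (chart v (md (oface s)))
    (chart v (md (oface (flip s i)))).
Proof.
move=> /flip_free[f [fs ff] nB].
apply: connected_component_trans (cube_minus_mid ff nB).
exact/connected_component_sym/cube_minus_mid.
Qed.

Lemma octant_refl v s : connected_component (cube_minus S v)
  (chart v (md (oface s))) (chart v (md (oface s))).
Proof. by apply: cube_minus_mid; [exact: fle_refl|exact: (octant_out (lr v))]. Qed.

(** Occupied octants are linked by [occ_connected], empty ones by the second half of [center_disk];
    the test function is the indicator of the component of [s]. *)
Lemma same_side_linked v s s' : B (Defs.center v) -> inside M v s = inside M v s' ->
  connected_component (cube_minus S v) (chart v (md (oface s))) (chart v (md (oface s'))).
Proof.
move=> Bc ss.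
pose k z := `[< connected_component (cube_minus S v) (chart v (md (oface s)))
  (chart v (md (oface z))) >].
have ks : k s by apply/asboolP; exact: octant_refl.
have kf z i : inside M v (flip z i) = inside M v z -> k (flip z i) = k z.
  move=> /flip_linked zf; apply/asbool_equiv_eq; split=> H.
    exact: connected_component_trans H (connected_component_sym zf).
  exact: connected_component_trans H zf.
suff : k s = k s' by rewrite ks => /esym/asboolP.
case E: (inside M v s) ss => /esym ss.
  apply: (occ_connected (lr v) (f := center_face)) => //; try exact: center_fle.
  by move=> z i _ _ zi zf; apply: kf; rewrite /inside zi zf.
have [_ H] := center_disk Msub Mcompact Mman Mbd Bc.
apply: H; rewrite ?E ?ss// => z i /negbTE zi /negbTE zf; apply: kf; by rewrite zi zf.
Qed.

(* 2, 1 or 0 according as the half-edge at v of direction d runs inside M, on its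
   boundary, or outside M. *)
Definition status v d : int :=
  (hit (inside M v) (facet d))%:R + (~~ hit (fun s => ~~ inside M v s) (facet d))%:R.

Lemma status_boundary v d : B (chart v (md (facet d))) -> status v d = 1.
Proof.
move=> /(boundary_occ (lr v))[[s1 f1 i1] [s2 f2 o2]]; rewrite /status.
have -> : hit (inside M v) (facet d) by apply/existsP; exists s1; rewrite f1.
by have -> : hit (fun s => ~~ inside M v s) (facet d) by apply/existsP; exists s2; rewrite f2.
Qed.

Lemma status_free v d : ~ B (chart v (md (facet d))) ->
  status v d = if `[< M (chart v (md (facet d))) >] then 2 else 0.
Proof.
move=> nB; have E s : fle (facet d) (oface s) ->
    inside M v s = `[< M (chart v (md (facet d))) >].
  by move=> fs; have E := free_occE (lr v) nB fs; apply/idP/asboolP; rewrite -E.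
rewrite /status; case: asboolP E => [_|_] E.
  have -> : hit (inside M v) (facet d).
    by apply/existsP; exists (fill (facet d)); rewrite fle_fill E ?fle_fill.
  have -> // : hit (fun s => ~~ inside M v s) (facet d) = false.
  by apply/negbTE/negP => /existsP[s /andP[fs]]; rewrite E.
have -> : hit (inside M v) (facet d) = false.
  by apply/negbTE/negP => /existsP[s /andP[fs]]; rewrite E.
have -> // : hit (fun s => ~~ inside M v s) (facet d).
by apply/existsP; exists (fill (facet d)); rewrite fle_fill E ?fle_fill.
Qed.

(** Normals point to empty octants, and these are linked to each other but never to occupied ones.
    Hence, off [B], [points_above] means that the half-edge runs outside [M], and [points_below]
    inside. *)
Lemma status_epsilon t v d : B (Defs.center v) -> dimer_direction t v d ->
  (forall d', dimer_direction t v d' -> d' = d) -> epsilon t S v = 1 - status v d.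
Proof.
move=> Bc td tu.
have above : (exists2 d, dimer_direction t v d & points_above S v d) <-> points_above S v d.
  by split=> [[d' /tu ->]|]; last by exists d.
have below : (exists2 d, dimer_direction t v d & points_below S v d) <-> points_below S v d.
  by split=> [[d' /tu ->]|]; last by exists d.
rewrite /epsilon (asbool_equiv_eq above) (asbool_equiv_eq below).
have m1 f : unit_cube (md f) by apply: open_unit_cubeW; exact: mid_in.
have [Bd|nB] := pselect (B (chart v (md (facet d)))).
  rewrite status_boundary// subrr !asboolF//.
    by move=> [u [w [a [b [n [_ /connected_component_sub[_]]]]]]]; rewrite near_centerE.
  by move=> [u [w [a [b [n [_ /connected_component_sub[_]]]]]]]; rewrite near_centerE.
rewrite status_free//; pose s := fill (facet d).
have fs : fle (facet d) (oface s) by exact: fle_fill.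
have sE := free_occE (lr v) nB fs.
have link := cube_minus_mid fs nB.
have [u [w [a [b [n [nrm ab]]]]]] := normal_exists Bc.
have [_ _ na nb _] := nrm; have [i1 o1] := normal_outward nrm.
case: (asboolP (M (chart v (md (facet d))))) => Md.
  have ins : inside M v s := sE.1 Md.
  (* [epsilon] tests [points_above] first, so the value -1 also requires its failure. *)
  rewrite asboolF ?asboolT//.
    exists u, w, a, b, n; split=> //; rewrite near_centerE besideE//.
    apply: connected_component_trans (connected_component_sym link).
    by apply: same_side_linked => //; rewrite i1 ins.
  move=> [u' [w' [a' [b' [n' [nrm' cc]]]]]].
  have [co' _ na' nb' _] := nrm'; have [_ _ ab' _ _] := co'.
  have [_ /negP o1'] := normal_outward nrm'; apply: o1'; apply/asboolP => /=.
  move: cc; rewrite near_centerE besideE// => /connected_component_sym cc.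
  exact: cube_minus_M cc Md.
rewrite asboolT ?subr0//.
exists u, w, a, b, n; split=> //; rewrite near_centerE besideE//.
apply: connected_component_trans (connected_component_sym link).
apply: same_side_linked => //; rewrite (negPf o1); apply/esym/negP => ins.
exact/Md/(sE.2 ins).
Qed.

Lemma neighbor_sym v d w : neighbor v d w -> exists d', neighbor w d' v.
Proof.
move=> [vw [h gl]]; pose f := facet d.
have fd : f d.1 = Some d.2 by rewrite ffunE eqxx.
have x1 := facet_pt_unit K f d.1; have y1 := cube_move_unit h x1.
have [_ E] := gl _ _ x1 y1; have {}E := E (conj (facet_in K fd) erefl).
rewrite cube_move_facet_pt ?fd// in E.
have wv : w != v by rewrite eq_sym.
have [c Ec] : exists c, act_face h f ((h.1^-1)%g d.1) = Some c.
  by rewrite ffunE permKV fd; eexists.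
have [h' gl' _] := glue_facet wv Ec x1 (esym E).
by exists ((h.1^-1)%g d.1, c); split=> //; exists h'.
Qed.

Lemma neighbor_unique v d d' w : neighbor v d w -> neighbor v d' w -> d = d'.
Proof.
move=> [vw [h gl]] [_ [h' gl']]; pose f := facet d.
have fd : f d.1 = Some d.2 by rewrite ffunE eqxx.
have x1 := facet_pt_unit K f d.1; have y1 := cube_move_unit h x1.
have [_ E] := gl _ _ x1 y1; have {}E := E (conj (facet_in K fd) erefl).
have [/(_ E)[fx _] _] := gl' _ _ x1 y1.
by apply: facet_inj; rewrite (facet_pt_face fd (facet_dim _) fx); case: (d).
Qed.

(** An occupied octant continues into [w], the only other cube at its facet point, and there into
    the octant with the same facet point. Doing this in both directions settles empty octants
    too. *)
Lemma octant_across v d w d' s : neighbor v d w -> neighbor w d' v ->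
  fle (facet d) (oface s) -> exists2 s', fle (facet d') (oface s') &
    inside M w s' = inside M v s.
Proof.
move=> [vw [h gl]] wv; rewrite fle_facet => /eqP sd.
have fd : oface s d.1 = Some d.2 by rewrite ffunE sd.
have fd' : oface s d.1 <> None by rewrite fd.
have x1 := facet_pt_unit K (oface s) d.1; have y1 := cube_move_unit h x1.
have [_ E] := gl _ _ x1 y1; have {}E := E (conj (facet_in K fd) erefl).
have step (c : cube R) (r : octant) j (e : cube R) (r' : octant) j' : c != e ->
    chart c (facet_pt K (oface r) j) = chart e (facet_pt K (oface r') j') ->
    inside M c r -> inside M e r'.
  move=> ce Ece cr; have [e' [h' [ce' gl' er']]] :=
    octant_transport Msub Mcompact Mman Mbd j cr.
  have rj : oface r j = Some (r j) by rewrite ffunE.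
  have rj' : oface r j <> None by rewrite rj.
  have z1 := facet_pt_unit K (oface r) j; have u1 := cube_move_unit h' z1.
  have rin : face_set (facet (j, r j)) (facet_pt K (oface r) j).
    by apply: (@facet_in K (oface r) (j, r j)).
  have [_ E'] := gl' _ _ z1 u1; have {}E' := E' (conj rin erefl).
  have ee : e = e' by exact: (facet_cube_unique ce ce' rj' (facet_pt_unit _ _ _) u1 Ece E').
  rewrite -{e'}ee in ce' gl' er' E'; rewrite Ece cube_move_facet_pt// act_face_oface in E'.
  have [||/(congr1 fill)] := facet_pt_inj _ _
    (chart_injective (facet_pt_unit _ _ _) (facet_pt_unit _ _ _) E'); rewrite ?ffunE//.
  by rewrite !fill_oface => ->.
rewrite cube_move_facet_pt// act_face_oface in E.
exists (act_octant h s).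
  have [wv' [h' gl']] := wv; rewrite fle_facet.
  have [E' _] := gl' _ _ (facet_pt_unit K (oface (act_octant h s)) ((h.1^-1)%g d.1)) x1.
  have [fx _] := E' (esym E).
  have sd' : oface (act_octant h s) ((h.1^-1)%g d.1) = Some (act_octant h s ((h.1^-1)%g d.1)).
    by rewrite ffunE.
  by rewrite (facet_inj (facet_pt_face sd' (facet_dim _) fx)).
have wv' : w != v by rewrite eq_sym.
by apply/idP/idP; [exact: step (esym E)|exact: step E].
Qed.

Lemma status_sym v d w d' : neighbor v d w -> neighbor w d' v -> status v d = status w d'.
Proof.
move=> vw wv.
have hitE (c : bool -> bool) :
    hit (fun s => c (inside M v s)) (facet d) = hit (fun s => c (inside M w s)) (facet d').
  apply/existsP/existsP => -[s /andP[fs cs]].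
    have [s' fs' E] := octant_across vw wv fs; exists s'; by rewrite fs' E.
  have [s' fs' E] := octant_across wv vw fs; exists s'; by rewrite fs' E.
by rewrite /status (hitE id) (hitE negb).
Qed.

(** * Summation over the dimers *)

Section Tiling.
Variable t : {set {set cube R}}.
Hypothesis tt : tiling t.

Lemma dimer_exists v : exists d w, neighbor v d w /\ [set v; w]%SET \in t.
Proof.
have [te tv] := tt; have /eqP/cards1P[e Ee] := tv v.
have : e \in [set e in t | v \in e]%SET by rewrite Ee inE.
rewrite inE => /andP[et ve]; have [x [a [y [xy Exy]]]] := te e et.
move: ve; rewrite Exy !inE => /orP[/eqP ->|/eqP ->].
  by exists a, y; split=> //; rewrite -Exy.
have [d yx] := neighbor_sym xy; exists d, x; split=> //.
by rewrite finset.setUC -Exy.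
Qed.

Lemma dimer_unique v w w' : v != w -> v != w' ->
  [set v; w]%SET \in t -> [set v; w']%SET \in t -> w = w'.
Proof.
move=> vw vw' ew ew'; have [_ tv] := tt; have /eqP/cards1P[e Ee] := tv v.
have : [set v; w]%SET \in [set e in t | v \in e]%SET by rewrite inE ew !inE eqxx.
have : [set v; w']%SET \in [set e in t | v \in e]%SET by rewrite inE ew' !inE eqxx.
rewrite Ee !inE => /eqP <- /eqP/setP/(_ w); rewrite !inE eqxx orbT eq_sym (negPf vw) /=.
by move=> /esym/eqP.
Qed.

Lemma flux_boundary : surface_boundary S = set0 -> flux t S = 0.
Proof.
move=> S0.
have /choice[d Hd] : forall v, exists d, exists w, neighbor v d w /\ [set v; w]%SET \in t.
  exact: dimer_exists.
have dd v : dimer_direction t v (d v) by have [w [? ?]] := Hd v; exists w.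
have du v d' : dimer_direction t v d' -> d' = d v.
  move=> [w vw ew]; have [w' [vw' ew']] := Hd v.
  have ww : w = w' by apply: (@dimer_unique v) => //; [case: vw|case: vw'].
  by rewrite -ww in vw'; exact: neighbor_unique vw vw'.
(* Off [B] the vertex is absent from the flux; its half-edge also avoids [B], so that weight and
   status cancel. *)
have key v : (if `[< B (Defs.center v) >] then color v * epsilon t S v else 0) =
    color v * weight S M v - color v * status v (d v).
  rewrite /weight; case: asboolP => [Bc|nB].
    by rewrite (status_epsilon Bc (dd v) (@du v)) mulrBr.
  have nBf : ~ B (chart v (md (facet (d v)))).
    by move=> /(boundary_fle (lr v) (center_fle _)); rewrite /= -centerE.
  rewrite status_free// -mulrBr; suff -> : `[< M (Defs.center v) >] =
    `[< M (chart v (md (facet (d v)))) >] by rewrite subrr mulr0.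
  apply: asbool_equiv_eq; rewrite centerE; apply: (region_fle (lr v) (center_fle _)).
  by rewrite /= -centerE.
rewrite /flux S0 setC0 big_mkcond /= (eq_bigr _ (fun v _ => key v)) sumrB.
rewrite (sum_weight Msub Mcompact Mman Mbd) sub0r; apply/eqP; rewrite oppr_eq0; apply/eqP.
apply: (@sum_paired _ predT (fun v w => (v != w) && ([set v; w]%SET \in t))).
- by move=> v w /andP[vw e]; rewrite eq_sym vw finset.setUC.
- by move=> v _; have [w [[vw _] e]] := Hd v; exists w => //; rewrite vw.
- by move=> v w w' /andP[vw e] /andP[vw' e']; exact: dimer_unique e e'.
move=> v w /andP[vw e].
have nvw : neighbor v (d v) w.
  have [w' [n' e']] := Hd v; suff -> : w = w' by [].
  by apply: (@dimer_unique v) => //; case: n'.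
have nwv : neighbor w (d w) v.
  have [w' [n' e']] := Hd w; suff -> : v = w' by [].
  by apply: (@dimer_unique w) => //; [rewrite eq_sym|case: n'|rewrite finset.setUC].
rewrite (status_sym nwv nvw) /color (black_neighbor nvw).
by case: (black v); rewrite ?mulN1r ?mul1r ?opprK.
Qed.

End Tiling.
End FluxOfBoundary.

Theorem theorem6p1 (K : realType) (N : nat) (R : cubiculated_region K N)
    (t : {set {set cube R}}) (ht : tiling t)
    (S : embedded_discrete_surface R)
    (hS : surface_boundary S = set0)
    (M1 : set 'rV[K]_N)
    (hM1sub : M1 `<=` dual_complex R)
    (hM1compact : compact M1)
    (hM1 : manifold K 3 M1)
    (hM1bd : manifold_boundary K 3 M1 = range (psi S))
    (hor : boundary_orientation S M1) :
  flux t S = 0.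
Proof. exact: (flux_boundary hM1sub hM1compact hM1 hM1bd hor ht hS). Qed.
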